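(* Let $\bar u>0$ and $\beta>0$. Given gains $K\in\mathbb{R}^{1\times n}$ and $c>0$, and tuning parameters $r>0$, $0<r_1<2$, $0<\delta_1=\delta_0$, let there exist a symmetric $n\times n$ matrix $P>0$ and scalars $p_1>0$, $p_2>0$, $\lambda>0$, $\lambda_1\ge0$ satisfying $$\Xi+(p_1r^{-1}+p_2r_1^{-1})R<0,$$ $$\begin{bmatrix}(-2c+2\delta_0+r)p_1+2\lambda&a_2p_1&0\\ a_2p_1&-2\delta_1p_1&-a_2p_2\\ 0&-a_2p_2&-(2-r_1)p_2+\lambda_1\end{bmatrix}<0,$$ $$-2p_1-2p_2c+\lambda+2\delta_0p_2-\frac{\pi^2}{4}\lambda_1\le0,$$ $$P\le\beta I,\quad p_1\le\beta,\quad p_2\le\beta,\qquad P\frac{\bar u^2}{3}-c_1^2I\ge0,\quad p_1\frac{\bar u^2}{3}-c_2^2\ge0,\quad p_2\frac{\bar u^2}{3}-c_3^2\ge0,$$ where $$\Xi=\begin{bmatrix}P(A+BK)+(A+BK)^\top P+2\delta_0P&PA_1&PB\\ A_1^\top P&-2\delta_1P&0\\ B^\top P&0&-\lambda\end{bmatrix},\qquad R=\mathrm{diag}\{0,\zeta(A_1-a_2I)^\top(A_1-a_2I),0\},$$ and $\zeta,c_1,c_2,c_3$ are the constants defined in the context. Then for all $h_0>0$ and $h>0$, the classical solutions of the system $$\dot X(t)=AX(t)+A_1X(t-\tau(t))+Bu(0,t),\qquad u_t(x,t)=u_{xx}(x,t)+a_2u(x,t-\tau(t))+au(x,t),\qquad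 u_x(0,t)=0,$$ with saturated Neumann boundary actuation $u_x(1,t)=\mathrm{sat}(U(t),\bar u)$, where $$U(t)=\int_0^1k_x(1,y)u(y,t)dy+\gamma'(1)X(t)+q(1,1)w(1,t)+\int_0^1q_x(1,y)w(y,t)dy,$$ $$w(x,t)=u(x,t)-\int_0^xk(x,y)u(y,t)dy-\gamma(x)X(t),$$ starting from initial functions $(X_0,u_0)\in\mathcal X_u$, converge to zero for all delays $\tau$ satisfying $0<h_0\le\tau(t)\le h$, i.e. $$\lim_{t\to\infty}\|(X(t;X_0),u(x,t;u_0))\|_{\mathcal H_1}=0.$$ Here $$\mathcal X_u=\Big\{(X_0,u_0)\in W_1:\ M_1\max_{[-h,0]}|X_0|^2+M_2\max_{[-h,0]}\|u_0\|^2+4\max_{[-h,0]}\|u_0'\|^2\le\beta^{-1}\Big\}.$$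
   Context: Data: $A,A_1\in\mathbb{R}^{n\times n}$, $B\in\mathbb{R}^{n\times1}$, $(A,B)$ controllable; $a,a_2\in\mathbb{R}$; $x\in(0,1)$; $X(t)\in\mathbb{R}^n$, $u(x,t)\in\mathbb{R}$; the delay $\tau$ is continuously differentiable. $P>0$ means symmetric positive definite; inequalities between symmetric matrices are in the semidefinite/definite sense. $|\cdot|$ is the Euclidean norm (also for row vectors), $\|\cdot\|$ the $L^2(0,1)$ norm. $\mathrm{sat}(U,\bar u)=\mathrm{sign}(U)\min(|U|,\bar u)$. $\mathcal H_1=\mathbb{R}^n\times H^1(0,1)$ with $\|(f,g)\|_{\mathcal H_1}^2=|f|^2+\|g\|^2+\|g'\|^2$. Subscripts $x$ denote partial derivatives in the first variable of the kernels. Kernels (for $0\le y\le x\le1$): $$\gamma(x)=\begin{bmatrix}K&0\end{bmatrix}\exp\left(\begin{bmatrix}0&A-aI\\ I&0\end{bmatrix}x\right)\begin{bmatrix}I\\0\end{bmatrix},\qquad k(x,y)=\int_0^{x-y}\gamma(\sigma)B\,d\sigma,$$ $$\psi(x)=\begin{bmatrix}K&0\end{bmatrix}\exp\left(\begin{bmatrix}0&A+BK-aI\\ I&0\end{bmatrix}x\right)\begin{bmatrix}I\\0\end{bmatrix},\qquad n(x,y)=\int_0^{x-y}\psi(\sigma)B\,d\sigma,$$ $$q(x,y)=-(a+c)x\frac{I_1(\sqrt{(a+c)(x^2-y^2)})}{\sqrt{(a+c)(x^2-y^2)}},\qquad l(x,y)=-(a+c)x\frac{J_1(\sqrt{(a+c)(x^2-y^2)})}{\sqrt{(a+c)(x^2-y^2)}},$$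 with $I_1(s)=\sum_{m\ge0}\frac{(s/2)^{2m+1}}{m!(m+1)!}$ and $J_1(s)=\sum_{m\ge0}\frac{(-1)^m(s/2)^{2m+1}}{m!(m+1)!}$ ($I_1(s)/s$, $J_1(s)/s$ understood as entire even power series). (The kernel function $n(x,y)$ is unrelated to the dimension $n$.) Constants: $$\zeta=\Big(1+\max_{0\le y\le x\le1}|q(x,y)|\Big)^2\Big(\max_{0\le x\le1}|\gamma(x)|\Big)^2,$$ $$\xi=\max_{0\le y\le1}|n_x(1,y)|\Big(1+\max_{0\le y\le x\le1}|l(x,y)|\Big)+\max_{0\le y\le1}|l_x(1,y)|,$$ $$c_1=|\psi'(1)|,\qquad c_2=\sqrt2\,|l(1,1)|+\xi,\qquad c_3=|l(1,1)|,$$ $$M_1=\Big\{8\Big[\max_{0\le x\le1}|q(x,x)|+\max_{0\le y\le x\le1}|q_x(x,y)|\Big]^2+2\Big[1+\max_{0\le y\le x\le1}|q(x,y)|\Big]^2\Big\}\Big[\max_{0\le x\le1}|\gamma(x)|\Big]^2+4\max_{0\le x\le1}|\gamma'(x)|^2+1,$$ $$M_2=8\Big[\max_{0\le x\le1}|q(x,x)|+\max_{0\le y\le x\le1}|q_x(x,y)|\Big]^2\Big[1+\max_{0\le y\le x\le1}|k(x,y)|\Big]^2+4\max_{0\le y\le x\le1}|k_x(x,y)|^2$$ $$\qquad+2\Big[1+\max_{0\le y\le x\le1}|k(x,y)|\Big]^2\Big[1+\max_{0\le y\le x\le1}|q(x,y)|\Big]^2.$$ Initial data: $(X_0,u_0)$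 denotes the initial function $(X(\theta),u(\cdot,\theta))$, $\theta\in[-h,0]$, $u_0'$ is the derivative in $x$, and $(X(t;X_0),u(x,t;u_0))$ is the corresponding solution. $W_1=C([-h,0],D(\mathcal A_u))\cap C^1([-h,0],\mathcal H_1)$, where $D(\mathcal A_u)$ is the set of $(X,u)\in\mathbb{R}^n\times H^2(0,1)$ with $u'(0)=0$ and $$u'(1)=\int_0^1k_x(1,y)u(y)dy+\gamma'(1)X+q(1,1)\Big[u(1)-\int_0^1k(1,y)u(y)dy-\gamma(1)X\Big]+\int_0^1q_x(1,y)\Big[u(y)-\int_0^yk(y,s)u(s)ds-\gamma(y)X\Big]dy.$$ *)

(* Defs.v *)
From HB Require Import structures.
From mathcomp Require Import all_boot all_order all_algebra.
From mathcomp Require Import all_classical all_reals all_analysis.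
Set Implicit Arguments.
Unset Strict Implicit.
Unset Printing Implicit Defensive.

Import Order.TTheory GRing.Theory Num.Theory numFieldNormedType.Exports.
Local Open Scope classical_set_scope.
Local Open Scope ring_scope.

Section calculus.
Context {R : realType}.
Implicit Types (f : R -> R) (S : set R).

(* On a compact S with f continuous (all uses below) this is a maximum. *)
Definition max_on (T : Type) (S : set T) (f : T -> R) : R := sup (f @` S).

Definition triangle : set (R * R) :=
  [set p | [/\ 0 <= p.2, p.2 <= p.1 & p.1 <= 1]].

(* Oriented integral: the kernels k and n, and hence their partial
   derivatives in x, are thereby defined in a neighbourhood of the diagonal
   x = y and of x = 1. *)
Definition oriented_int (f : R -> R) (s : R) : R :=
  if 0 <= s then \int[lebesgue_measure]_(y in `[0, s]) f y
  else - \int[lebesgue_measure]_(y in `[s, 0]) f y.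

(* Continuity and differentiability on S, one-sided at boundary points of S,
   of a curve F in a space V normed by N. *)
Definition cont_in (V : zmodType) (N : V -> R) S (F : R -> V) : Prop :=
  forall t, S t -> N (F s - F t) @[s --> within S (nbhs t)] --> 0.

Definition deriv_in (V : lmodType R) (N : V -> R) S (F F' : R -> V) : Prop :=
  forall t, S t ->
    N ((s - t)^-1 *: (F s - F t) - F' t) @[s --> within S t^'] --> 0.

Definition L2norm f : R :=
  Num.sqrt (\int[lebesgue_measure]_(x in `[0, 1]) f x ^+ 2).

Definition in_L2 f : Prop :=
  measurable_fun (`[0, 1] : set R) f /\
  lebesgue_measure.-integrable `[0, 1] (fun x => (f x ^+ 2)%:E).

(* Derivative in the space variable of a function on [0, 1]; only the values
   of f on [0, 1] matter, so that it is one-sided at 0 and 1 (and 0 by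
   convention where f is not differentiable). *)
Definition dx f (x : R) : R :=
  lim ((f y - f x) / (y - x) @[y --> within `[0, 1] x^']).

(* H^1(0,1): absolutely continuous functions, i.e. integrals of their
   derivative, whose derivative is in L^2(0,1). *)
Definition in_H1 f : Prop :=
  in_L2 (dx f) /\
  forall x, 0 <= x <= 1 ->
    f x = f 0 + \int[lebesgue_measure]_(y in `[0, x]) dx f y.

Definition in_H2 f : Prop := in_H1 f /\ in_H1 (dx f).

End calculus.

Section matrices.
Context {R : realType}.

Definition enorm (m n : nat) (M : 'M[R]_(m, n)) : R :=
  Num.sqrt (\sum_i \sum_j M i j ^+ 2).

Definition expmx (m : nat) (M : 'M[R]_m) : 'M[R]_m :=
  \matrix_(i, j) lim (series (fun k : nat => (M ^+ k) i j / k`!%:R) @ \oo).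

Definition mx_gt0 (m : nat) (M : 'M[R]_m) : Prop :=
  M^T = M /\ forall v : 'cV[R]_m, v != 0 -> 0 < (v^T *m M *m v) 0 0.

Definition mx_ge0 (m : nat) (M : 'M[R]_m) : Prop :=
  M^T = M /\ forall v : 'cV[R]_m, 0 <= (v^T *m M *m v) 0 0.

Definition mx_lt0 (m : nat) (M : 'M[R]_m) : Prop := mx_gt0 (- M).

Definition controllable (n : nat) (A : 'M[R]_n) (B : 'cV[R]_n) : Prop :=
  forall x0 x1 : 'cV[R]_n, exists (T : R) (v : R -> R) (x : R -> 'cV[R]_n),
    [/\ 0 < T, cont_in Num.norm `[0, T] v, x 0 = x0, x T = x1 &
        deriv_in (@enorm n 1) `[0, T] x (fun t => A *m x t + v t *: B)].

End matrices.

(* The state space R^n x (functions of the space variable on [0, 1]). *)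
Section states.
Context {R : realType} {n : nat}.
Implicit Types z : 'cV[R]_n * (R -> R).

Definition normH z : R := Num.sqrt (enorm z.1 ^+ 2 + L2norm z.2 ^+ 2).

Definition normH1 z : R :=
  Num.sqrt (enorm z.1 ^+ 2 + L2norm z.2 ^+ 2 + L2norm (dx z.2) ^+ 2).

(* Norm of R^n x H^2(0,1), equivalent to the graph norm on D(A_u). *)
Definition normH2 z : R :=
  Num.sqrt (enorm z.1 ^+ 2 + L2norm z.2 ^+ 2 + L2norm (dx z.2) ^+ 2
            + L2norm (dx (dx z.2)) ^+ 2).

End states.

Section kernels.
Context {R : realType} {n : nat}.
Variables (A : 'M[R]_n) (B : 'cV[R]_n) (a : R) (K : 'rV[R]_n) (c : R).

(* [K 0] exp([0 M - aI; I 0] x) [I; 0] *)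
Definition row_kernel (M : 'M[R]_n) (x : R) : 'rV[R]_n :=
  row_mx K 0 *m expmx (x *: block_mx 0 (M - a%:M) 1%:M 0) *m col_mx 1%:M 0.

Definition gamma_ker : R -> 'rV[R]_n := row_kernel A.
Definition psi_ker : R -> 'rV[R]_n := row_kernel (A + B *m K).

Definition dgamma_ker (x : R) : 'rV[R]_n :=
  \row_j derive1 (fun s => gamma_ker s 0 j) x.
Definition dpsi_ker (x : R) : 'rV[R]_n :=
  \row_j derive1 (fun s => psi_ker s 0 j) x.

Definition k_ker (x y : R) : R :=
  oriented_int (fun s => (gamma_ker s *m B) 0 0) (x - y).
Definition n_ker (x y : R) : R :=
  oriented_int (fun s => (psi_ker s *m B) 0 0) (x - y).

(* I_1(s) / s and J_1(s) / s as power series in w = s^2, so that they also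
   make sense at the square roots of negative w. *)
Definition I1_quot (w : R) : R :=
  lim (series (fun m : nat =>
    (w / 4) ^+ m / (2 * m`!%:R * (m.+1)`!%:R)) @ \oo).
Definition J1_quot (w : R) : R :=
  lim (series (fun m : nat =>
    (-1) ^+ m * (w / 4) ^+ m / (2 * m`!%:R * (m.+1)`!%:R)) @ \oo).

Definition q_ker (x y : R) : R :=
  - (a + c) * x * I1_quot ((a + c) * (x ^+ 2 - y ^+ 2)).
Definition l_ker (x y : R) : R :=
  - (a + c) * x * J1_quot ((a + c) * (x ^+ 2 - y ^+ 2)).

Definition partial1 (f : R -> R -> R) (x y : R) : R := derive1 (f ^~ y) x.

Definition zeta : R :=
  (1 + max_on triangle (fun p => `|q_ker p.1 p.2|)) ^+ 2
  * max_on `[0, 1] (fun x => enorm (gamma_ker x)) ^+ 2.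

Definition xi : R :=
  max_on `[0, 1] (fun y => `|partial1 n_ker 1 y|)
  * (1 + max_on triangle (fun p => `|l_ker p.1 p.2|))
  + max_on `[0, 1] (fun y => `|partial1 l_ker 1 y|).

Definition c1 : R := enorm (dpsi_ker 1).
Definition c2 : R := Num.sqrt 2 * `|l_ker 1 1| + xi.
Definition c3 : R := `|l_ker 1 1|.

Definition M1 : R :=
  (8 * (max_on `[0, 1] (fun x => `|q_ker x x|)
        + max_on triangle (fun p => `|partial1 q_ker p.1 p.2|)) ^+ 2
   + 2 * (1 + max_on triangle (fun p => `|q_ker p.1 p.2|)) ^+ 2)
  * max_on `[0, 1] (fun x => enorm (gamma_ker x)) ^+ 2
  + 4 * max_on `[0, 1] (fun x => enorm (dgamma_ker x) ^+ 2) + 1.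

Definition M2 : R :=
  8 * (max_on `[0, 1] (fun x => `|q_ker x x|)
       + max_on triangle (fun p => `|partial1 q_ker p.1 p.2|)) ^+ 2
    * (1 + max_on triangle (fun p => `|k_ker p.1 p.2|)) ^+ 2
  + 4 * max_on triangle (fun p => `|partial1 k_ker p.1 p.2| ^+ 2)
  + 2 * (1 + max_on triangle (fun p => `|k_ker p.1 p.2|)) ^+ 2
      * (1 + max_on triangle (fun p => `|q_ker p.1 p.2|)) ^+ 2.

Implicit Types z : 'cV[R]_n * (R -> R).

Definition w_transf z (x : R) : R :=
  z.2 x - \int[lebesgue_measure]_(y in `[0, x]) (k_ker x y * z.2 y)
  - (gamma_ker x *m z.1) 0 0.

Definition feedback z : R :=
  \int[lebesgue_measure]_(y in `[0, 1]) (partial1 k_ker 1 y * z.2 y)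
  + (dgamma_ker 1 *m z.1) 0 0
  + q_ker 1 1 * w_transf z 1
  + \int[lebesgue_measure]_(y in `[0, 1]) (partial1 q_ker 1 y * w_transf z y).

Definition DAu : set ('cV[R]_n * (R -> R)) :=
  [set z | [/\ in_H2 z.2, dx z.2 0 = 0 & dx z.2 1 = feedback z]].

(* C([-h,0], D(A_u)) /\ C^1([-h,0], R^n x H^1(0,1)) *)
Definition W1 (h : R) (z : R -> 'cV[R]_n * (R -> R)) : Prop :=
  [/\ forall t, - h <= t <= 0 -> DAu (z t),
      cont_in normH2 `[- h, 0] z &
      exists z' : R -> 'cV[R]_n * (R -> R),
        [/\ forall t, - h <= t <= 0 -> in_H1 (z' t).2,
            deriv_in normH1 `[- h, 0] z z' &
            cont_in normH1 `[- h, 0] z']].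

Definition Xu (beta h : R) (z : R -> 'cV[R]_n * (R -> R)) : Prop :=
  W1 h z /\
  M1 * max_on `[- h, 0] (fun t => enorm (z t).1 ^+ 2)
  + M2 * max_on `[- h, 0] (fun t => L2norm (z t).2 ^+ 2)
  + 4 * max_on `[- h, 0] (fun t => L2norm (dx (z t).2) ^+ 2) <= beta^-1.

End kernels.

Section lmis.
Context {R : realType} {n : nat}.

Definition Xi_mx (A A1 : 'M[R]_n) (B : 'cV[R]_n) (K : 'rV[R]_n)
    (d0 d1 : R) (P : 'M[R]_n) (lam : R) : 'M[R]_(n + n + 1) :=
  block_mx
    (block_mx
       (P *m (A + B *m K) + (A + B *m K)^T *m P + (2 * d0) *: P) (P *m A1)
       (A1^T *m P) (- (2 * d1) *: P))
    (col_mx (P *m B) 0)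
    (row_mx (B^T *m P) 0) (- lam)%:M.

Definition R_mx (A A1 : 'M[R]_n) (B : 'cV[R]_n) (a a2 : R) (K : 'rV[R]_n)
    (c : R) : 'M[R]_(n + n + 1) :=
  block_mx
    (block_mx 0 0
       0 (zeta A a K c *: ((A1 - a2%:M)^T *m (A1 - a2%:M))))
    0 0 0.

Definition heat_mx (a2 c r r1 d0 d1 p1 p2 lam lam1 : R) : 'M[R]_3 :=
  \matrix_(i, j) nth 0 (nth [::] [::
    [:: (- 2 * c + 2 * d0 + r) * p1 + 2 * lam; a2 * p1; 0];
    [:: a2 * p1; - 2 * d1 * p1; - (a2 * p2)];
    [:: 0; - (a2 * p2); - (2 - r1) * p2 + lam1]] i) j.

End lmis.

Section system.
Context {R : realType} {n : nat}.
Variables (A A1 : 'M[R]_n) (B : 'cV[R]_n) (a a2 : R) (K : 'rV[R]_n) (c : R).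

Definition sat (U ubar : R) : R := Num.sg U * Num.min `|U| ubar.

Definition admissible_delay (h0 h : R) (tau : R -> R) : Prop :=
  (exists tau' : R -> R,
     deriv_in Num.norm `[0, +oo[ tau tau' /\ cont_in Num.norm `[0, +oo[ tau')
  /\ forall t, 0 <= t -> h0 <= tau t /\ tau t <= h.

Definition rhs (tau : R -> R) (z : R -> 'cV[R]_n * (R -> R)) (t : R) :
    'cV[R]_n * (R -> R) :=
  (A *m (z t).1 + A1 *m (z (t - tau t)).1 + (z t).2 0 *: B,
   fun x => dx (dx (z t).2) x + a2 * (z (t - tau t)).2 x + a * (z t).2 x).

(* Classical solution z(t) = (X(t), u(., t)) of the saturated closed loop with
   initial function z0:  z is in C([0,oo), R^n x H^2) and in
   C^1([0,oo), R^n x L^2), where u_t is the derivative in L^2(0,1). *)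
Definition classical_solution (ubar h : R) (tau : R -> R)
    (z0 z : R -> 'cV[R]_n * (R -> R)) : Prop :=
  [/\ forall t, - h <= t <= 0 -> z t = z0 t,
      (forall t, 0 <= t -> in_H2 (z t).2) /\ cont_in normH2 `[0, +oo[ z,
      deriv_in normH `[0, +oo[ z (rhs tau z) /\
        cont_in normH `[0, +oo[ (rhs tau z),
      forall t, 0 <= t -> dx (z t).2 0 = 0 &
      forall t, 0 <= t -> dx (z t).2 1 = sat (feedback A B a K c (z t)) ubar].

End system.

(* Main.v *)
Require Import Defs.
From mathcomp Require Import all_boot all_order all_algebra.
From mathcomp Require Import all_classical all_reals all_analysis.
From mathcomp Require Import measurable_realfun.
From mathcomp Require Import ring lra.
Set Implicit Arguments.
Unset Strict Implicit.
Unset Printing Implicit Defensive.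
Import Order.TTheory GRing.Theory Num.Theory numFieldNormedType.Exports.
Local Open Scope classical_set_scope.
Local Open Scope ring_scope.

(** The feedback is a backstepping design. A first Volterra transformation,
    w = u - int k u - gamma X, moves K X into the ordinary differential equation,
    and a second one, v = w - int q w, replaces the reaction a by the damping
    - c. In the variables (X, v) the system becomes
      X' = (A + B K) X + A1 X_tau + B v(0),
      v_t = v'' - c v + a2 v_tau + g,   v'(0) = 0,   v'(1) = u'(1) - U,
    where the index tau marks delayed values and g is the image of
    ((A1 - a2) X_tau, 0): the delayed terms commute with the transformation up to
    the difference of A1 and a2, which is what R and zeta measure. As long as
    |U| <= ubar, v'(1) vanishes.

    Let V = X^T P X + p1 |v|^2 + p2 |v'|^2. Integration by parts and the
    inequalities of Young, Agmon and Wirtinger bound V' + 2 delta0 V by the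
    quadratic forms of the two matrix inequalities. These are strict, which
    leaves room for
      V' <= - 2 delta0 V + 2 d1' V(t - tau)   with d1' < delta0
    (dissipation, V_dini). The constants M1 and M2 are such that the initial
    ball is contained in V <= 1 (transform_bound, V_init). In the target
    variables |U| <= c1 |X| + c2 |v| + c3 |v'| (feedback_bound), so that the last
    three inequalities give |U| <= ubar on V <= 1 (V_unsaturated). The growth of V
    is thus controlled while V <= 1, and V stays below 1 while its growth is
    controlled: a continuous induction proves V(t) <= exp (- al t) outright
    (halanay). Both transformations are boundedly invertible (inverse_bound), and
    the decay carries over to (X, u) in H^1.

    Three points need care. The kernels of the first transformation are
    exponentials of matrices; instead of kernel equations the proof uses that
    w = u - K p, where p solves the linear equation p'' = (A - a) p + B u, and
    uniqueness for such equations (St_pde, St_closed_loop). The kernels q and l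
    are resolvents of each other by a convolution identity between Bessel
    functions, which a differential equation proves (phi_conv). Finally, a
    solution is differentiable in time only with values in L^2, so that |v'|^2 is
    differentiated through its increments; the boundary term which then appears
    is of smaller order, by the trace inequality (step_bound). *)

(** * Absolutely continuous functions on the unit interval *)

Section AbsCont.
Context {R : realType}.
Implicit Types (f g h : R -> R) (x y : R).

Local Notation mu := (@lebesgue_measure R).
Local Notation D := (`[0%R, 1%R]%classic : set R).

Definition intg f : Prop := mu.-integrable D (EFin \o f).

Definition bmeas f : Prop :=
  measurable_fun D f /\ exists M : R, forall x, 0 <= x <= 1 -> `|f x| <= M.

(** The pair (f, g) rather than f alone: g is a density of f, known only up to
    null sets, and the calculus below computes one density from another. *)
Definition ac f g : Prop :=
  intg g /\ forall x, 0 <= x <= 1 -> f x = f 0 + \int[mu]_(y in `[0, x]) g y.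

Lemma sub01 x y : 0 <= x -> y <= 1 -> `[x, y]%classic `<=` D.
Proof.
move=> x0 y1 z /=; rewrite !in_itv/= => /andP[xz zy].
by rewrite (le_trans x0 xz) (le_trans zy y1).
Qed.

Lemma intg_sub f x y : intg f -> 0 <= x -> y <= 1 ->
  mu.-integrable `[x, y] (EFin \o f).
Proof.
move=> If x0 y1; apply: integrableS If => //; exact: sub01.
Qed.

Lemma intg_meas f : intg f -> measurable_fun D f.
Proof. by move=> /integrableP[/measurable_EFinP]. Qed.

Lemma mu01 : mu D = 1%E.
Proof. by rewrite lebesgue_measure_itv/= lte_fin ltr01 oppr0 adde0. Qed.

Lemma bmeas_bounded f : bmeas f -> [bounded f x | x in D].
Proof.
move=> [_ [M fM]]; rewrite /bounded_near; near=> N => /= x.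
rewrite in_itv/= => x01; rewrite (le_trans (fM _ x01))//.
Unshelve. all: by end_near. Qed.

Lemma bmeas_intg f : bmeas f -> intg f.
Proof.
move=> bf; apply: measurable_bounded_integrable => //=.
- by rewrite -ge0_fin_numE// mu01.
- by case: bf.
- exact: bmeas_bounded.
Qed.

Lemma intgM f g : bmeas f -> intg g -> intg (fun x => f x * g x).
Proof.
move=> bf Ig.
have -> : intg (fun x => f x * g x) =
   mu.-integrable D ((EFin \o f) \* (EFin \o g))%E by [].
by apply: integrableMr => //; [case: bf|exact: bmeas_bounded].
Qed.

Lemma intgD f g : intg f -> intg g -> intg (fun x => f x + g x).
Proof. by move=> If Ig; exact: (integrableD _ If Ig). Qed.

Lemma intgZ c f : intg f -> intg (fun x => c * f x).
Proof. by move=> If; exact: (integrableZl _ c If). Qed.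

Lemma intgB f g : intg f -> intg g -> intg (fun x => f x - g x).
Proof. by move=> If Ig; exact: (integrableB _ If Ig). Qed.

Lemma intg_norm f : intg f -> intg (fun x => `|f x|).
Proof. by move=> If; exact: (integrable_norm If). Qed.

Lemma bmeas_cst c : bmeas (fun=> c).
Proof. by split; [exact: measurable_cst|exists `|c|]. Qed.

Lemma intg_cst c : intg (fun=> c).
Proof. exact/bmeas_intg/bmeas_cst. Qed.

Lemma bmeasD f g : bmeas f -> bmeas g -> bmeas (fun x => f x + g x).
Proof.
move=> [mf [M fM]] [mg [N gN]]; split; first exact: measurable_funD.
by exists (M + N) => x x01; rewrite (le_trans (ler_normD _ _))// lerD ?fM ?gN.
Qed.

Lemma bmeasM f g : bmeas f -> bmeas g -> bmeas (fun x => f x * g x).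
Proof.
move=> [mf [M fM]] [mg [N gN]]; split; first exact: measurable_funM.
by exists (M * N) => x x01; rewrite normrM ler_pM ?fM ?gN.
Qed.

Lemma bmeasZ c f : bmeas f -> bmeas (fun x => c * f x).
Proof. exact/bmeasM/bmeas_cst. Qed.

Lemma bmeasN f : bmeas f -> bmeas (fun x => - f x).
Proof.
move=> bf; have -> : (fun x => - f x) = (fun x => (-1) * f x).
  by apply/funext => x; rewrite mulN1r.
exact: bmeasZ.
Qed.

Lemma bmeasB f g : bmeas f -> bmeas g -> bmeas (fun x => f x - g x).
Proof. by move=> bf /bmeasN bg; exact: bmeasD. Qed.

Lemma within_bmeas f : {within D, continuous f} -> bmeas f.
Proof.
move=> cf; split; first exact: subspace_continuous_measurable_fun.
have := @compact_bounded _ _ _ (continuous_compact cf (@segment_compact R 0 1)).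
move=> [M [_ fM]]; exists (M + 1) => x x01; apply: (fM (M + 1)).
  by rewrite ltrDl.
by exists x => //=; rewrite in_itv.
Qed.

Lemma cont_bmeas f : continuous f -> bmeas f.
Proof. by move=> cf; apply/within_bmeas/continuous_subspaceT. Qed.

(** The integral of an integrable function is continuous in its upper bound. *)
Lemma ac_within f g : ac f g -> {within D, continuous f}.
Proof.
move=> [Ig fg].
have := parameterized_integral_continuous (@ler01 R) Ig.
rewrite /parameterized_integral => c1.
have c2 : {within D, continuous
   (fun x => f 0 + \int[mu]_(t in [set` `[0, x]]) g t)}.
  move=> x; apply: (@cvgD _ R^o); [exact: cvg_cst|exact: c1].
apply: subspace_eq_continuous c2 => x /set_mem /=; rewrite in_itv/= => x01.
by rewrite [RHS]fg.
Qed.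

Lemma ac_bmeas f g : ac f g -> bmeas f.
Proof. by move=> /ac_within; exact: within_bmeas. Qed.

Lemma eq_intg f g : (forall x, 0 <= x <= 1 -> f x = g x) -> intg f -> intg g.
Proof.
move=> fg; apply: eq_integrable => //= x /set_mem /=; rewrite in_itv/= => x01.
by rewrite fg.
Qed.

Lemma eq_bmeas f g : (forall x, 0 <= x <= 1 -> f x = g x) -> bmeas f -> bmeas g.
Proof.
move=> fg [mf [M fM]]; split; last by exists M => x x01; rewrite -fg// fM.
apply: eq_measurable_fun mf => x /set_mem /=; rewrite in_itv/= => x01.
by rewrite fg.
Qed.

Lemma eq_int x y f g : (forall z, x <= z <= y -> f z = g z) ->
  \int[mu]_(z in `[x, y]) f z = \int[mu]_(z in `[x, y]) g z.
Proof.
by move=> fg; apply: eq_Rintegral => z /set_mem /=; rewrite in_itv/=; exact: fg.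
Qed.

Lemma int_xx x f : \int[mu]_(z in `[x, x]) f z = 0.
Proof. by rewrite set_itv1 Rintegral_set1. Qed.

Lemma intD x y f g : intg f -> intg g -> 0 <= x -> y <= 1 ->
  \int[mu]_(z in `[x, y]) (f z + g z) =
  \int[mu]_(z in `[x, y]) f z + \int[mu]_(z in `[x, y]) g z.
Proof. by move=> If Ig x0 y1; rewrite RintegralD//; exact: intg_sub. Qed.

Lemma intB x y f g : intg f -> intg g -> 0 <= x -> y <= 1 ->
  \int[mu]_(z in `[x, y]) (f z - g z) =
  \int[mu]_(z in `[x, y]) f z - \int[mu]_(z in `[x, y]) g z.
Proof. by move=> If Ig x0 y1; rewrite RintegralB//; exact: intg_sub. Qed.

Lemma intZ x y c f : intg f -> 0 <= x -> y <= 1 ->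
  \int[mu]_(z in `[x, y]) (c * f z) = c * \int[mu]_(z in `[x, y]) f z.
Proof. by move=> If x0 y1; rewrite RintegralZl//; exact: intg_sub. Qed.

Lemma intN x y f : intg f -> 0 <= x -> y <= 1 ->
  \int[mu]_(z in `[x, y]) (- f z) = - \int[mu]_(z in `[x, y]) f z.
Proof.
move=> If x0 y1; rewrite -[RHS]mulN1r -intZ//.
by apply: eq_int => z _; rewrite mulN1r.
Qed.

Lemma int_le x y f g : intg f -> intg g -> 0 <= x -> y <= 1 ->
  (forall z, x <= z <= y -> f z <= g z) ->
  \int[mu]_(z in `[x, y]) f z <= \int[mu]_(z in `[x, y]) g z.
Proof.
move=> If Ig x0 y1 fg; apply: le_Rintegral; [by []|exact: intg_sub..|].
by move=> z /=; rewrite in_itv/=; exact: fg.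
Qed.

Lemma int_ge0 x y f : (forall z, x <= z <= y -> 0 <= f z) ->
  0 <= \int[mu]_(z in `[x, y]) f z.
Proof.
by move=> f0; apply: Rintegral_ge0 => z /=; rewrite in_itv/=; exact: f0.
Qed.

Lemma int_cst x y c : x <= y -> \int[mu]_(z in `[x, y]) c = c * (y - x).
Proof.
move=> xy; rewrite Rintegral_cst//= lebesgue_measure_itv/= lte_fin.
move: xy; rewrite le_eqVlt => /predU1P[->|->]; first by rewrite ltxx subrr.
by rewrite -EFinD.
Qed.

Lemma int_norm x y f : intg f -> 0 <= x -> y <= 1 ->
  `|\int[mu]_(z in `[x, y]) f z| <= \int[mu]_(z in `[x, y]) `|f z|.
Proof. by move=> If x0 y1; apply: le_normr_Rintegral => //; exact: intg_sub. Qed.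

Lemma int_cat f x y z : intg f -> 0 <= x -> x <= y -> y <= z -> z <= 1 ->
  \int[mu]_(t in `[x, z]) f t =
  \int[mu]_(t in `[x, y]) f t + \int[mu]_(t in `[y, z]) f t.
Proof.
move=> If x0 xy yz z1.
have := @Rintegral_itvB R f (BLeft x) (BRight z) y (intg_sub If x0 z1).
rewrite !bnd_simp => /(_ xy yz).
rewrite Rintegral_itv_obnd_cbnd; last first.
  apply: integrableS (intg_sub If (le_trans x0 xy) z1) => //.
  exact: subset_itv_oc_cc.
by move=> <-; rewrite addrC subrK.
Qed.

Lemma int_subset f x y : intg f -> (forall z, 0 <= z <= 1 -> 0 <= f z) ->
  0 <= x -> x <= y -> y <= 1 ->
  \int[mu]_(t in `[x, y]) f t <= \int[mu]_(t in D) f t.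
Proof.
move=> If f0 x0 xy y1.
have yx1 := le_trans xy y1.
rewrite (@int_cat f 0 x 1)// (@int_cat f x y 1)//.
have h a b : 0 <= a -> b <= 1 -> 0 <= \int[mu]_(t in `[a, b]) f t.
  move=> a0 b1; apply: int_ge0 => z /andP[az zb].
  by rewrite f0// (le_trans a0 az) (le_trans zb b1).
rewrite addrCA lerDl addr_ge0//; apply: h => //.
exact: le_trans xy.
Qed.

End AbsCont.

(** * Fubini on a triangle *)

Section Tri.
Context {R : realType}.
Implicit Types (f g h : R -> R) (x y : R).

Local Notation mu := (@lebesgue_measure R).
Local Notation D := (`[0%R, 1%R]%classic : set R).

Lemma intg_restrict f : intg f <-> mu.-integrable setT (EFin \o (f \_ D)).
Proof.
have := @integrable_restrict _ _ R mu D _ setT measurableT (EFin \o f).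
by rewrite setTI restrict_EFin; apply.
Qed.

Lemma patch0 f y : ~ D y -> (f \_ D) y = 0.
Proof. by move=> yD; rewrite patchC// inE. Qed.

Lemma measurable_slice1 (H : R * R -> R) y :
  measurable_fun setT H -> measurable_fun setT (fun s => H (y, s)).
Proof. by move=> mH; apply: measurableT_comp => //. Qed.

Lemma measurable_slice2 (H : R * R -> R) s :
  measurable_fun setT H -> measurable_fun setT (fun y => H (y, s)).
Proof. by move=> mH; apply: measurableT_comp => //. Qed.

Section tri_fubini.
Variables (f g : R -> R) (H : R * R -> R) (C : R).
Hypotheses (If : intg f) (Ig : intg g) (mH : measurable_fun setT H).
Hypothesis HC : forall y s, 0 <= s -> s <= y -> y <= 1 -> `|H (y, s)| <= C.

Let C0 : 0 <= C.
Proof. by rewrite (le_trans _ (@HC 0 0 _ _ _)). Qed.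

Let F (p : R * R) : R :=
  (f \_ D) p.1 * ((g \_ D) p.2 * (if p.2 <= p.1 then H p else 0)).

Let mF : measurable_fun setT F.
Proof.
have mf : measurable_fun setT (f \_ D).
  by apply: (measurable_restrictT _ _).1 => //; exact: intg_meas.
have mg : measurable_fun setT (g \_ D).
  by apply: (measurable_restrictT _ _).1 => //; exact: intg_meas.
apply: measurable_funM; first exact: measurableT_comp.
apply: measurable_funM; first exact: measurableT_comp.
apply: measurable_fun_ifT => //.
exact: measurable_fun_ler.
Qed.

Let F_le y s : `|F (y, s)| <= C * `|(f \_ D) y| * `|(g \_ D) s|.
Proof.
rewrite /F /= !normrM.
have [yD|yD] := pselect (D y); last first.
  by rewrite [(f \_ D) y]patch0// normr0 !(mul0r, mulr0).
have [sD|sD] := pselect (D s); last first.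
  by rewrite [(g \_ D) s]patch0// normr0 !(mul0r, mulr0).
rewrite [leRHS](_ : _ = `|(f \_ D) y| * (`|(g \_ D) s| * C)); last by ring.
rewrite ler_wpM2l// ler_wpM2l//.
case: ifPn => [sy|]; last by rewrite normr0.
move: yD sD; rewrite /= !in_itv/= => /andP[y0 y1] /andP[s0 s1].
exact: HC.
Qed.

Let intF : (mu \x mu)%E.-integrable setT (EFin \o F).
Proof.
apply/integrable12ltyP; first exact/measurable_EFinP.
have /integrableP nf := (intg_restrict f).1 If.
have /integrableP ng := (intg_restrict g).1 Ig.
set IG : \bar R := (\int[mu]_y `|(g \_ D) y|%:E)%E.
have IGoo : (IG < +oo)%E by case: ng.
have IG0 : (0 <= IG)%E by apply: integral_ge0 => *; rewrite lee_fin.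
have mgn : measurable_fun setT (fun y => `|(g \_ D) y|%:E).
  by apply/measurable_EFinP/measurableT_comp => //; case: ng => /measurable_EFinP.
have mfn : measurable_fun setT (fun y => `|(f \_ D) y|%:E).
  by apply/measurable_EFinP/measurableT_comp => //; case: nf => /measurable_EFinP.
apply: (@le_lt_trans _ _ (\int[mu]_y (`|(f \_ D) y|%:E * (C%:E * IG))))%E.
  apply: ge0_le_integral => //=.
  - by move=> y _; apply: integral_ge0 => s _; rewrite lee_fin.
  - apply: (@measurable_fun_fubini_tonelli_F _ _ _ _ _ mu (fun p => `|F p|%:E)).
      by apply/measurable_EFinP; exact: measurableT_comp.
    by move=> p; rewrite lee_fin.
  - apply: emeasurable_funM => //.
  - move=> y _; rewrite muleA -EFinM -ge0_integralZl//; last by rewrite lee_fin mulr_ge0.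
    apply: ge0_le_integral => //=.
    + apply/measurable_EFinP; apply: measurableT_comp => //.
      exact: measurable_slice1.
    + by apply: measurable_funeM.
    + by move=> s _; rewrite -EFinM lee_fin [_ * C]mulrC F_le.
rewrite ge0_integralZr//; last by rewrite mule_ge0.
by rewrite lte_mul_pinfty// ?integral_ge0 => //; rewrite ?ge0_fin_numE ?mule_ge0 ?integral_ge0 ?lte_mul_pinfty//; case: nf.
Qed.

Lemma tri_inner_int y : 0 <= y <= 1 ->
  mu.-integrable `[0, y] (EFin \o (fun s => H (y, s) * g s)).
Proof.
move=> /andP[y0 y1].
have -> : EFin \o (fun s => H (y, s) * g s) =
  ((EFin \o (fun s => H (y, s))) \* (EFin \o g))%E by [].
apply: integrableMr => //.
- by apply: measurable_funTS; exact: measurable_slice1.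
- rewrite /bounded_near; near=> M => s /=; rewrite in_itv/= => /andP[s0 sy].
  by rewrite (le_trans (HC _ _ _)).
- exact: intg_sub.
Unshelve. all: by end_near. Qed.

Lemma tri_outer_int s : 0 <= s <= 1 ->
  mu.-integrable `[s, 1] (EFin \o (fun y => H (y, s) * f y)).
Proof.
move=> /andP[s0 s1].
have -> : EFin \o (fun y => H (y, s) * f y) =
  ((EFin \o (fun y => H (y, s))) \* (EFin \o f))%E by [].
apply: integrableMr => //.
- by apply: measurable_funTS; exact: measurable_slice2.
- rewrite /bounded_near; near=> M => y /=; rewrite in_itv/= => /andP[sy y1].
  by rewrite (le_trans (HC _ _ _)).
- exact: intg_sub.
Unshelve. all: by end_near. Qed.

Let FE1 y : (\int[mu]_s (F (y, s))%:E =
  (((fun y => f y * \int[mu]_(s in `[0, y]) (H (y, s) * g s)) \_ D) y)%:E)%E.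
Proof.
have [yD|yD] := pselect (D y); last first.
  rewrite [in RHS]patch0//.
  by under eq_integral do rewrite /F /= patch0// mul0r; rewrite integral0.
rewrite [in RHS]patchE mem_set//.
move: (yD); rewrite /= in_itv/= => y01; have /andP[y0 y1] := y01.
rewrite EFinM fineK; last exact: integrable_fin_num (tri_inner_int y01).
rewrite -integralZl//; last exact: tri_inner_int.
rewrite [RHS]integral_mkcond; apply: eq_integral => s _.
rewrite /F /= [in LHS]patchE mem_set//= [in RHS]patchE.
have [sI|sI] := pselect (`[0, y]%classic s); [rewrite (mem_set sI)|rewrite (memNset sI)];
  move: sI; rewrite /= in_itv/=.
  move=> /andP[s0 sy]; rewrite sy patchE mem_set//=; last first.
    by rewrite in_itv/= s0 (le_trans sy y1).
  by rewrite -EFinM [H _ * _]mulrC.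
move=> nsy.
have [/andP[s0 s1]|s01] := boolP (0 <= s <= 1); last first.
  by rewrite [(g \_ D) s]patch0 ?mul0r ?mulr0//= in_itv/=; exact/negP.
by case: ifPn => [sy|_]; [rewrite s0 sy in nsy|rewrite !mulr0].
Qed.

Let FE2 s : (\int[mu]_y (F (y, s))%:E =
  (((fun s => (\int[mu]_(y in `[s, 1]) (H (y, s) * f y)) * g s) \_ D) s)%:E)%E.
Proof.
have [yD|yD] := pselect (D s); last first.
  rewrite [in RHS]patch0//.
  under eq_integral do rewrite /F /= [(g \_ D) s]patch0// mul0r mulr0.
  by rewrite integral0.
rewrite [in RHS]patchE mem_set//.
move: (yD); rewrite /= in_itv/= => y01; have /andP[y0 y1] := y01.
rewrite mulrC EFinM fineK; last exact: integrable_fin_num (tri_outer_int y01).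
rewrite -integralZl//; last exact: tri_outer_int.
rewrite [RHS]integral_mkcond; apply: eq_integral => y _.
rewrite /F /= [(g \_ D) s]patchE mem_set//= [in RHS]patchE.
have [yI|yI] := pselect (`[s, 1]%classic y); [rewrite (mem_set yI)|rewrite (memNset yI)];
  move: yI; rewrite /= in_itv/=.
  move=> /andP[sy yle1]; rewrite sy patchE mem_set//=; last first.
    by rewrite in_itv/= yle1 (le_trans y0 sy).
  by rewrite -EFinM; congr EFin; ring.
move=> nsy.
have [/andP[s0 s1]|s01] := boolP (0 <= y <= 1); last first.
  by rewrite [(f \_ D) y]patch0 ?mul0r ?mulr0//= in_itv/=; exact/negP.
by case: ifPn => [sy|_]; [rewrite s1 sy in nsy|rewrite !mulr0].
Qed.

(** Fubini applied to the integrand extended by zero outside the triangle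
    0 <= s <= y <= 1. *)
Lemma tri_intg1 : intg (fun y => f y * \int[mu]_(s in `[0, y]) (H (y, s) * g s)).
Proof.
apply/intg_restrict; have := integrable_fubini_F intF.
rewrite /fubini_F /=.
by under [X in _.-integrable _ X -> _]eq_fun do rewrite FE1.
Qed.

Lemma tri_fubini :
  \int[mu]_(y in D) (f y * \int[mu]_(s in `[0, y]) (H (y, s) * g s)) =
  \int[mu]_(s in D) ((\int[mu]_(y in `[s, 1]) (H (y, s) * f y)) * g s).
Proof.
rewrite Rintegral_mkcond [RHS]Rintegral_mkcond.
have := Fubini intF; rewrite /=.
under eq_integral do rewrite FE1.
under [in X in _ = X -> _]eq_integral do rewrite FE2.
by rewrite /Rintegral => ->.
Qed.

End tri_fubini.
End Tri.

(** * Calculus of absolutely continuous functions *)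

Section AcTheory.
Context {R : realType}.
Implicit Types (f g h : R -> R) (x y : R).

Local Notation mu := (@lebesgue_measure R).
Local Notation D := (`[0%R, 1%R]%classic : set R).

Lemma setI_itv x : x <= 1 -> D `&` `[0, x] = `[0, x]%classic.
Proof.
move=> x1; apply: setIidr => z /=; rewrite !in_itv/= => /andP[-> zx].
exact: le_trans x1.
Qed.

Lemma int_restrict x f : x <= 1 ->
  \int[mu]_(y in `[0, x]) f y = \int[mu]_(y in D) ((f \_ `[0, x]) y).
Proof. by move=> x1; rewrite -Rintegral_mkcondr setI_itv. Qed.

Lemma restrictE (P : set R) f y : (f \_ P) y = if y \in P then f y else 0.
Proof.
by have [yP|yP] := pselect (P y); rewrite patchE ?(mem_set yP) ?(memNset yP).
Qed.

Lemma intg_patch x f : x <= 1 -> intg f -> intg (f \_ `[0, x]).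
Proof.
move=> x1 If.
have := @integrable_restrict _ _ R mu `[0, x]%classic _ D.
rewrite /intg -restrict_EFin => /(_ _ _ (EFin \o f)) h; apply/h => //.
by rewrite setI_itv//; exact: intg_sub.
Qed.

(** Cutting f off at x reduces the triangle of side x to the unit one. *)
Lemma tri_fubini_x f g (H : R * R -> R) C x :
  intg f -> intg g -> measurable_fun setT H ->
  (forall y s, 0 <= s -> s <= y -> y <= 1 -> `|H (y, s)| <= C) ->
  0 <= x <= 1 ->
  \int[mu]_(y in `[0, x]) (f y * \int[mu]_(s in `[0, y]) (H (y, s) * g s)) =
  \int[mu]_(s in `[0, x]) ((\int[mu]_(y in `[s, x]) (H (y, s) * f y)) * g s).
Proof.
move=> If Ig mH HC /andP[x0 x1].
rewrite int_restrict// [RHS]int_restrict//.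
transitivity (\int[mu]_(y in D) ((f \_ `[0, x]) y *
     \int[mu]_(s in `[0, y]) (H (y, s) * g s))).
  apply: eq_Rintegral => y _.
  by rewrite !restrictE; case: ifP => //; rewrite mul0r.
rewrite (tri_fubini (intg_patch x1 If) Ig mH HC).
apply: eq_Rintegral => s /set_mem /=; rewrite in_itv/= => /andP[s0 s1].
rewrite [RHS]restrictE.
have [sx|sx] := leP s x; last first.
  rewrite memNset/=; last by rewrite in_itv/= s0/= leNgt sx.
  under eq_Rintegral => y.
    rewrite inE/= in_itv/= => /andP[sy _].
    rewrite restrictE memNset/=; last first.
      by rewrite in_itv/= (le_trans s0 sy)/= leNgt (lt_le_trans sx sy).
    rewrite mulr0; over.
  by rewrite Rintegral_cst// mul0r mul0r.
rewrite mem_set/=; last by rewrite in_itv/= s0.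
congr (_ * _).
have -> : `[s, x]%classic = `[s, 1]%classic `&` `[0, x]%classic.
  apply/seteqP; split => z /=; rewrite !in_itv/=.
    by move=> /andP[sz zx]; rewrite sz zx (le_trans zx x1) (le_trans s0 sz).
  by move=> [/andP[-> _] /andP[_ ->]].
rewrite Rintegral_mkcondr; apply: eq_Rintegral => y _.
by rewrite !restrictE; case: ifP; rewrite // mulr0.
Qed.

Lemma ac_intg f g : ac f g -> intg f.
Proof. by move=> /ac_bmeas/bmeas_intg. Qed.

Lemma ac_int f g x y : ac f g -> 0 <= x -> x <= y -> y <= 1 ->
  \int[mu]_(z in `[x, y]) g z = f y - f x.
Proof.
move=> [Ig fg] x0 xy y1.
rewrite (fg y) ?(le_trans x0 xy)// (fg x) ?x0 ?(le_trans xy y1)//.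
by rewrite (@int_cat _ g 0 x y)//; ring.
Qed.

Lemma eq_ac f1 g1 f2 g2 : (forall x, 0 <= x <= 1 -> f1 x = f2 x) ->
  (forall x, 0 <= x <= 1 -> g1 x = g2 x) -> ac f1 g1 -> ac f2 g2.
Proof.
move=> f12 g12 [Ig fg]; split; first exact: eq_intg Ig.
move=> x x01; rewrite -!f12 ?lexx ?ler01// fg//; congr (_ + _).
apply: eq_int => z /andP[z0 zx]; apply: g12.
by rewrite z0 (le_trans zx)//; case/andP: x01.
Qed.

Lemma ac_cst (c : R) : ac (fun=> c) (fun=> 0).
Proof.
split; first exact: intg_cst.
by move=> x /andP[x0 x1]; rewrite int_cst// mul0r addr0.
Qed.

Lemma acD f f1 g g1 : ac f f1 -> ac g g1 ->
  ac (fun x => f x + g x) (fun x => f1 x + g1 x).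
Proof.
move=> [If ff] [Ig gg]; split; first exact: intgD.
move=> x /[dup] x01 /andP[x0 x1]; rewrite intD// ff// gg//; ring.
Qed.

Lemma acZ c f f1 : ac f f1 -> ac (fun x => c * f x) (fun x => c * f1 x).
Proof.
move=> [If ff]; split; first exact: intgZ.
move=> x /[dup] x01 /andP[x0 x1]; rewrite intZ// ff//; ring.
Qed.

Lemma acN f f1 : ac f f1 -> ac (fun x => - f x) (fun x => - f1 x).
Proof.
move=> /(@acZ (-1)); apply: eq_ac => x _; exact: mulN1r.
Qed.

Lemma acB f f1 g g1 : ac f f1 -> ac g g1 ->
  ac (fun x => f x - g x) (fun x => f1 x - g1 x).
Proof. by move=> af /acN; exact: acD. Qed.

Lemma ac_sum (I : Type) (r : seq I) (P : pred I) (f f1 : I -> R -> R) :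
  (forall i, ac (f i) (f1 i)) ->
  ac (fun x => \sum_(i <- r | P i) f i x) (fun x => \sum_(i <- r | P i) f1 i x).
Proof.
move=> ff; elim: r => [|i r IH].
  by apply: eq_ac (ac_cst 0) => x _; rewrite big_nil.
have [Pi|Pi] := boolP (P i).
  by apply: eq_ac (acD (ff i) IH) => x _; rewrite big_cons Pi.
by apply: eq_ac IH => x _; rewrite big_cons (negbTE Pi).
Qed.

(** The product rule is Fubini on the triangle for f1 (x) g1: the two iterated
    integrals are the two halves of the integration by parts. *)
Lemma acM f f1 g g1 : ac f f1 -> ac g g1 ->
  ac (fun x => f x * g x) (fun x => f1 x * g x + f x * g1 x).
Proof.
move=> af ag; have [If ff] := af; have [Ig gg] := ag.
have bf := ac_bmeas af; have bg := ac_bmeas ag.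
have I1 : intg (fun x => f1 x * g x).
  by apply: eq_intg (intgM bg If) => x _; rewrite mulrC.
have I2 : intg (fun x => f x * g1 x) by exact: intgM.
split; first exact: intgD.
move=> x /[dup] x01 /andP[x0 x1]; rewrite intD//.
have cst1 : measurable_fun [set: R * R] (fun=> 1 : R) by exact: measurable_cst.
have := @tri_fubini_x g1 f1 (fun=> 1) 1 x Ig If cst1 _ x01.
rewrite (_ : (forall y s, _) <-> True); last first.
  by split => // _ y s _ _ _; rewrite normr1.
move=> /(_ I).
have -> : \int[mu]_(y in `[0, x]) (g1 y * \int[mu]_(s in `[0, y]) (1 * f1 s)) =
  \int[mu]_(y in `[0, x]) (f y * g1 y - f 0 * g1 y).
  apply: eq_int => y /andP[y0 yx].
  under eq_Rintegral do rewrite mul1r.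
  rewrite (ac_int af)// ?(le_trans yx x1)//; ring.
have -> : \int[mu]_(s in `[0, x]) (\int[mu]_(y in `[s, x]) (1 * g1 y) * f1 s) =
  \int[mu]_(s in `[0, x]) (g x * f1 s - f1 s * g s).
  apply: eq_int => y /andP[y0 yx].
  under eq_Rintegral do rewrite mul1r.
  rewrite (ac_int ag)//; ring.
rewrite !intB ?intZ//; [|exact: intgZ..].
rewrite (ac_int ag)// (ac_int af)// => E.
have -> : \int[mu]_(y in `[0, x]) (f y * g1 y) =
  g x * (f x - f 0) - \int[mu]_(y in `[0, x]) (f1 y * g y) + f 0 * (g x - g 0).
  by rewrite -E subrK.
ring.
Qed.

(** Kernels that are absolutely continuous in the first variable for x >= y:
    this is what differentiating a Volterra integral requires, and it covers both convolution kernels and the Bessel kernels. *)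
Definition skernel (K Kx : R -> R -> R) : Prop :=
  [/\ forall x y, 0 <= y -> y <= x -> x <= 1 ->
        K x y = K y y + \int[mu]_(s in `[y, x]) Kx s y,
      measurable_fun [set: R * R] (fun p => Kx p.1 p.2),
      exists C, forall x y, 0 <= y -> y <= x -> x <= 1 -> `|Kx x y| <= C,
      bmeas (fun x => K x x) &
      forall x, 0 <= x <= 1 -> bmeas (K x)].

(** Leibniz' rule, by writing the kernel as the integral of its derivative and
    exchanging the integrals on the triangle. *)
Lemma ac_volterra K Kx g : skernel K Kx -> intg g ->
  ac (fun x => \int[mu]_(y in `[0, x]) (K x y * g y))
     (fun x => K x x * g x + \int[mu]_(y in `[0, x]) (Kx x y * g y)).
Proof.
move=> [KE mKx [C KC] bK bKx] Ig.
have KC' y s : 0 <= s -> s <= y -> y <= 1 ->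
  `|(fun p : R * R => Kx p.1 p.2) (y, s)| <= C by exact: KC.
have I1 : intg (fun x => K x x * g x) by exact: intgM.
have I2 : intg (fun x => \int[mu]_(y in `[0, x]) (Kx x y * g y)).
  by apply: eq_intg (tri_intg1 (intg_cst 1) Ig mKx KC') => x _; rewrite mul1r.
split; first exact: intgD.
move=> x /[dup] x01 /andP[x0 x1]; rewrite int_xx add0r intD//.
have := tri_fubini_x (intg_cst 1) Ig mKx KC' x01.
under eq_Rintegral do rewrite mul1r.
move=> ->.
have -> : \int[mu]_(s in `[0, x])
    (\int[mu]_(y in `[s, x]) (Kx (y, s).1 (y, s).2 * 1) * g s) =
  \int[mu]_(y in `[0, x]) (K x y * g y - K y y * g y).
  apply: eq_int => y /andP[y0 yx].
  rewrite (KE x y)//.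
  under eq_Rintegral do rewrite mulr1 /=.
  ring.
rewrite intB//; last exact/intgM/Ig/bKx.
by rewrite addrC subrK.
Qed.

Lemma volterra_bmeas K Kx g : skernel K Kx -> intg g ->
  bmeas (fun x => \int[mu]_(y in `[0, x]) (K x y * g y)).
Proof. by move=> sK Ig; exact: ac_bmeas (ac_volterra sK Ig). Qed.

Lemma FTC2_C1 (F f : R -> R) x y : (forall z, is_derive z (1 : R) F (f z)) ->
  continuous f -> x <= y -> \int[mu]_(z in `[x, y]) f z = F y - F x.
Proof.
move=> dF cf; rewrite le_eqVlt => /predU1P[->|xy].
  by rewrite int_xx subrr.
have cF : continuous F.
  move=> z; apply: differentiable_continuous; apply/derivable1_diffP.
  exact: ex_derive.
rewrite /Rintegral (@continuous_FTC2 _ f F)//.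
- by move=> z; apply: continuous_subspaceT.
- split; first by move=> z _; exact: ex_derive.
  + by apply: cvg_at_right_filter; exact: cF.
  + by apply: cvg_at_left_filter; exact: cF.
- by move=> z _; rewrite derive1E; exact: derive_val.
Qed.

Lemma ac_C1 (F f : R -> R) : (forall z, is_derive z (1 : R) F (f z)) ->
  continuous f -> ac F f.
Proof.
move=> dF cf; split; first exact/bmeas_intg/cont_bmeas.
by move=> x /andP[x0 x1]; rewrite (FTC2_C1 dF)//; ring.
Qed.

End AcTheory.

(** * Inequalities in L^2 and H^1 *)

Section L2.
Context {R : realType}.
Implicit Types (f g h : R -> R) (x y : R).

Local Notation mu := (@lebesgue_measure R).
Local Notation D := (`[0%R, 1%R]%classic : set R).

Lemma L2_sqr f : in_L2 f -> intg (fun x => f x ^+ 2). Proof. by case. Qed.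

Lemma intg_le f g : measurable_fun D f ->
  (forall x, 0 <= x <= 1 -> `|f x| <= g x) -> intg g -> intg f.
Proof.
move=> mf fg Ig; apply: le_integrable Ig => //; first exact/measurable_EFinP.
move=> x /=; rewrite in_itv/= => x01; rewrite lee_fin (le_trans (fg _ x01))//.
exact: ler_norm.
Qed.

Lemma L2_mul f g : in_L2 f -> in_L2 g -> intg (fun x => f x * g x).
Proof.
move=> [mf If] [mg Ig]; apply: (intg_le _ _ (intgD If Ig)).
  exact: measurable_funM.
move=> x _; rewrite ler_norml; have := sqr_ge0 (f x - g x).
have := sqr_ge0 (f x + g x); have := sqr_ge0 (f x); have := sqr_ge0 (g x).
by move=> *; apply/andP; split; nra.
Qed.

Lemma bmeas_L2 f : bmeas f -> in_L2 f.
Proof.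
move=> bf; split; first by case: bf.
by apply: bmeas_intg; exact: bmeasM.
Qed.

Lemma ac_L2 f g : ac f g -> in_L2 f. Proof. by move=> /ac_bmeas/bmeas_L2. Qed.

Lemma L2_intg f : in_L2 f -> intg f.
Proof.
move=> Lf; apply: eq_intg (L2_mul Lf (bmeas_L2 (bmeas_cst 1))) => x _.
by rewrite mulr1.
Qed.

Lemma L2D f g : in_L2 f -> in_L2 g -> in_L2 (fun x => f x + g x).
Proof.
move=> Lf Lg; split; first by case: Lf Lg => mf _ [mg _]; exact: measurable_funD.
apply: eq_intg (intgD (L2_sqr Lf) (intgD (intgZ 2 (L2_mul Lf Lg)) (L2_sqr Lg))).
by move=> x _; ring.
Qed.

Lemma L2M f g : bmeas f -> in_L2 g -> in_L2 (fun x => f x * g x).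
Proof.
move=> bf Lg; split; first by apply: measurable_funM; [case: bf|case: Lg].
apply: eq_intg (intgM (bmeasM bf bf) (L2_sqr Lg)).
by move=> x _ /=; rewrite exprMn expr2.
Qed.

Lemma L2Z c f : in_L2 f -> in_L2 (fun x => c * f x).
Proof. by apply: L2M; exact: bmeas_cst. Qed.

Lemma eq_L2 f g : (forall x, 0 <= x <= 1 -> f x = g x) -> in_L2 f -> in_L2 g.
Proof.
move=> fg [mf If]; split.
  apply: eq_measurable_fun mf => x /set_mem /=; rewrite in_itv/= => x01.
  by rewrite fg.
by apply: eq_intg If => x x01; rewrite fg.
Qed.

Lemma L2N f : in_L2 f -> in_L2 (fun x => - f x).
Proof. by move=> /(@L2Z (-1)); apply: eq_L2 => x _; rewrite mulN1r. Qed.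

Lemma L2B f g : in_L2 f -> in_L2 g -> in_L2 (fun x => f x - g x).
Proof. by move=> Lf /L2N; exact: L2D. Qed.

Lemma L2normE f : L2norm f ^+ 2 = \int[mu]_(x in D) (f x ^+ 2).
Proof. by rewrite sqr_sqrtr// int_ge0// => x _; exact: sqr_ge0. Qed.

Lemma L2norm_ge0 f : 0 <= L2norm f. Proof. exact: sqrtr_ge0. Qed.
Hint Resolve L2norm_ge0 : core.

Lemma eq_L2norm f g : (forall x, 0 <= x <= 1 -> f x = g x) ->
  L2norm f = L2norm g.
Proof. by move=> fg; congr Num.sqrt; apply: eq_int => x /fg ->. Qed.

Lemma young_int f g (r : R) : in_L2 f -> in_L2 g -> 0 < r ->
  2 * \int[mu]_(x in D) (f x * g x) <= r * L2norm f ^+ 2 + r^-1 * L2norm g ^+ 2.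
Proof.
move=> Lf Lg r0; rewrite !L2normE -!intZ//; [|exact: L2_sqr|exact: L2_sqr|exact: L2_mul].
rewrite -intD//; [|exact/intgZ/L2_sqr..].
apply: int_le => //; [exact/intgZ/L2_mul|exact/intgD/intgZ/L2_sqr/Lg/intgZ/L2_sqr|].
move=> x _; have : 0 <= r^-1 * (r * f x - g x) ^+ 2.
  by apply: mulr_ge0; [rewrite invr_ge0 ltW|exact: sqr_ge0].
have -> : r^-1 * (r * f x - g x) ^+ 2 =
  r * f x ^+ 2 + r^-1 * g x ^+ 2 - 2 * (f x * g x) by field; rewrite gt_eqF.
by rewrite subr_ge0.
Qed.

(** Young's inequality with the optimal weight, approached by (b + d) / (a + d)
    so that no norm has to be nonzero. *)
Lemma CS_int f g : in_L2 f -> in_L2 g ->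
  \int[mu]_(x in D) (f x * g x) <= L2norm f * L2norm g.
Proof.
move=> Lf Lg; apply/ler_addgt0Pr => e e0.
have f0 := L2norm_ge0 f; have g0 := L2norm_ge0 g.
set a := L2norm f in f0 *; set b := L2norm g in g0 *.
(* the choice makes d * (a + b) <= e *)
pose d := e / (a + b + e + 1).
have s0 : 0 < a + b + e + 1 by lra.
have d0 : 0 < d by rewrite divr_gt0.
have ad : 0 < a + d by lra. have bd : 0 < b + d by lra.
have := young_int Lf Lg (divr_gt0 bd ad).
rewrite -/a -/b invf_div => h.
have h1 : (b + d) / (a + d) * a ^+ 2 <= (b + d) * a.
  rewrite mulrAC ler_pdivrMr// expr2 mulrA ler_wpM2l ?mulr_ge0//; lra.
have h2 : (a + d) / (b + d) * b ^+ 2 <= (a + d) * b.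
  rewrite mulrAC ler_pdivrMr// expr2 mulrA ler_wpM2l ?mulr_ge0//; lra.
have h3 : d * (a + b + e + 1) = e by rewrite divfK// gt_eqF.
have : d * (a + b) <= e by nra.
nra.
Qed.

Lemma CS_norm f g : in_L2 f -> in_L2 g ->
  `|\int[mu]_(x in D) (f x * g x)| <= L2norm f * L2norm g.
Proof.
move=> Lf Lg; rewrite ler_norml CS_int// andbT lerNl.
have -> : L2norm f = L2norm (fun x => - f x).
  by congr Num.sqrt; apply: eq_int => x _; rewrite sqrrN.
rewrite -intN//; last exact: L2_mul.
under eq_Rintegral do rewrite -mulNr.
by apply: CS_int => //; exact: L2N.
Qed.

Lemma L2norm_triangle f g : in_L2 f -> in_L2 g ->
  L2norm (fun x => f x + g x) <= L2norm f + L2norm g.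
Proof.
move=> Lf Lg; rewrite -(@ler_pXn2r _ 2)// ?nnegrE ?addr_ge0//.
have I2 := L2_mul Lf Lg; have If := L2_sqr Lf; have Ig := L2_sqr Lg.
have -> : L2norm (fun x => f x + g x) ^+ 2 =
    \int[mu]_(x in D) (f x ^+ 2 + (2 * (f x * g x) + g x ^+ 2)).
  by rewrite L2normE; apply: eq_int => x _; ring.
rewrite !intD ?intZ//; [|exact: intgZ|by apply: intgD => //; exact: intgZ].
have := CS_int Lf Lg; rewrite sqrrD !L2normE; lra.
Qed.

Lemma L2normZ c f : in_L2 f -> L2norm (fun x => c * f x) = `|c| * L2norm f.
Proof.
move=> Lf; apply/eqP; rewrite -(@eqrXn2 _ 2)// ?mulr_ge0//.
rewrite exprMn !L2normE real_normK ?num_real// -intZ//; last exact: L2_sqr.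
by apply/eqP/eq_int => x _; rewrite exprMn.
Qed.

Lemma L2normN f : L2norm (fun x => - f x) = L2norm f.
Proof. by congr Num.sqrt; apply: eq_int => x _; rewrite sqrrN. Qed.

Lemma L2norm_triangleB f g : in_L2 f -> in_L2 g ->
  L2norm (fun x => f x - g x) <= L2norm f + L2norm g.
Proof.
by move=> Lf Lg; rewrite -(L2normN g); apply: L2norm_triangle => //; exact: L2N.
Qed.

Lemma L2norm_le f g : in_L2 f -> in_L2 g ->
  (forall x, 0 <= x <= 1 -> `|f x| <= `|g x|) -> L2norm f <= L2norm g.
Proof.
move=> Lf Lg fg; rewrite ler_sqrt; last first.
  by apply: int_ge0 => x _; exact: sqr_ge0.
apply: int_le => //; [exact: L2_sqr..|].
move=> x /fg h; rewrite -[leLHS]real_normK ?num_real//.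
by rewrite -[leRHS]real_normK ?num_real// lerXn2r.
Qed.

Lemma L2norm_cst (c : R) : L2norm (fun=> c) = `|c|.
Proof. by rewrite /L2norm int_cst// subr0 mulr1 sqrtr_sqr. Qed.

Lemma L2norm_bound f (c : R) : in_L2 f -> (forall x, 0 <= x <= 1 -> `|f x| <= c) ->
  L2norm f <= c.
Proof.
move=> Lf fc; have c0 : 0 <= c by rewrite (le_trans _ (fc 0 _))// lexx ler01.
rewrite -[leRHS](ger0_norm c0) -L2norm_cst.
apply: L2norm_le => //; first exact/bmeas_L2/bmeas_cst.
by move=> x /fc h; rewrite [leRHS]ger0_norm.
Qed.

Lemma int_abs_L2 f x : in_L2 f -> x <= 1 -> 0 <= x ->
  \int[mu]_(y in `[0, x]) `|f y| <= L2norm f.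
Proof.
move=> Lf x1 x0; have Ia := intg_norm (L2_intg Lf).
apply: (@le_trans _ _ (\int[mu]_(y in D) `|f y|)); first exact: int_subset.
have La : in_L2 (fun x => `|f x|).
  split; first by apply: measurableT_comp => //; case: Lf.
  by apply: eq_intg (L2_sqr Lf) => z _; rewrite real_normK ?num_real.
have := CS_int La (bmeas_L2 (bmeas_cst 1)).
rewrite L2norm_cst normr1 mulr1.
under eq_Rintegral do rewrite mulr1.
move=> /le_trans; apply.
by apply: L2norm_le => // z _; rewrite normr_id.
Qed.

Lemma int_kernel_bound (k f : R -> R) C x : in_L2 f -> x <= 1 -> 0 <= x ->
  bmeas k -> (forall y, 0 <= y <= x -> `|k y| <= C) ->
  `|\int[mu]_(y in `[0, x]) (k y * f y)| <= C * L2norm f.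
Proof.
move=> Lf x1 x0 bk kC.
have C0 : 0 <= C by rewrite (le_trans _ (kC 0 _))// lexx.
apply: le_trans (int_norm _ _ _) _ => //; first exact/intgM/L2_intg.
apply: (@le_trans _ _ (C * \int[mu]_(y in `[0, x]) `|f y|)); last first.
  by rewrite ler_wpM2l// int_abs_L2.
rewrite -intZ//; last exact/intg_norm/L2_intg.
apply: int_le => //; [exact/intg_norm/intgM/L2_intg|exact/intgZ/intg_norm/L2_intg|].
by move=> y /kC h; rewrite normrM ler_wpM2r.
Qed.

Lemma ac_idfun : ac (fun x : R => x) (fun=> 1).
Proof. by apply: ac_C1 => z; exact: cvg_cst. Qed.

(** Integrate the derivative of x * f(x)^2 over [0, 1]. *)
Lemma agmon1 f f1 : ac f f1 -> in_L2 f1 ->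
  f 1 ^+ 2 <= L2norm f ^+ 2 + 2 * (L2norm f * L2norm f1).
Proof.
move=> af Lf1; have Lf := ac_L2 af; have bf := ac_bmeas af.
have a1 := acM ac_idfun (acM af af).
have := ac_int a1 (lexx 0) ler01 (lexx 1); rewrite mul1r mul0r subr0 -expr2 => <-.
have L1 : in_L2 (fun x => x * f1 x) by apply: L2M => //; exact: (ac_bmeas ac_idfun).
have -> : \int[mu]_(z in D) (1 * (f z * f z) + z * (f1 z * f z + f z * f1 z)) =
   \int[mu]_(z in D) (f z ^+ 2 + 2 * (f z * (z * f1 z))).
  by apply: eq_int => z _; ring.
rewrite intD//; [|exact: L2_sqr|exact/intgZ/L2_mul].
rewrite L2normE lerD2l intZ//; last exact: L2_mul.
rewrite ler_wpM2l// (le_trans (CS_int _ _))// ler_wpM2l//.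
apply: L2norm_le => // z /andP[z0 z1].
by rewrite normrM ger0_norm// ler_piMl.
Qed.

(** Integrate the derivative of (1 - x) * f(x)^2 over [0, 1]. *)
Lemma agmon0 f f1 : ac f f1 -> in_L2 f1 ->
  f 0 ^+ 2 <= L2norm f ^+ 2 + 2 * (L2norm f * L2norm f1).
Proof.
move=> af Lf1; have Lf := ac_L2 af; have bf := ac_bmeas af.
have ax : ac (fun x : R => 1 - x) (fun=> -1).
  by apply: eq_ac (acB (ac_cst 1) ac_idfun) => // x _; rewrite sub0r.
have a1 := acM ax (acM af af).
have := ac_int a1 (lexx 0) ler01 (lexx 1).
rewrite subrr subr0 mul0r mul1r sub0r -expr2 => /(congr1 (@GRing.opp R)).
rewrite opprK => <-; rewrite -intN//; last by case: a1.
have L1 : in_L2 (fun x => (x - 1) * f1 x).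
  by apply: L2M => //; apply: bmeasB; [exact: (ac_bmeas ac_idfun)|exact: bmeas_cst].
have -> : \int[mu]_(z in D) (- (-1 * (f z * f z) + (1 - z) * (f1 z * f z + f z * f1 z))) =
   \int[mu]_(z in D) (f z ^+ 2 + 2 * (f z * ((z - 1) * f1 z))).
  by apply: eq_int => z _; ring.
rewrite intD//; [|exact: L2_sqr|exact/intgZ/L2_mul].
rewrite L2normE lerD2l intZ//; last exact: L2_mul.
rewrite ler_wpM2l// (le_trans (CS_int _ _))// ler_wpM2l//.
apply: L2norm_le => // z /andP[z0 z1].
have h : `|z - 1| <= 1 by rewrite distrC ger0_norm ?subr_ge0// gerBl.
by rewrite normrM ler_piMl.
Qed.

Lemma FTC2_loc (F f : R -> R) x y : x < y ->
  (forall z : R, x <= z <= y -> is_derive z (1 : R) F (f z)) ->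
  (forall z, x <= z <= y -> {for z, continuous f}) ->
  \int[mu]_(z in `[x, y]) f z = F y - F x.
Proof.
move=> xy dF cf.
have cF z : x <= z <= y -> {for z, continuous F}.
  move=> xzy; apply: differentiable_continuous; apply/derivable1_diffP.
  by have := dF _ xzy => ?; exact: ex_derive.
rewrite /Rintegral (@continuous_FTC2 _ f F)//.
- apply: continuous_in_subspaceT => z /set_mem /=; rewrite in_itv/=; exact: cf.
- split.
  + move=> z; rewrite in_itv/= => /andP[xz zy]; have := dF z.
    by rewrite !ltW// => /(_ isT) ?; exact: ex_derive.
  + by apply: cvg_at_right_filter; apply: cF; rewrite lexx ltW.
  + by apply: cvg_at_left_filter; apply: cF; rewrite lexx ltW.
- move=> z; rewrite in_itv/= => /andP[xz zy]; have := dF z.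
  rewrite !ltW// => /(_ isT) ?; rewrite derive1E; exact: derive_val.
Qed.

Lemma ac_C1_loc (F f : R -> R) :
  (forall z : R, 0 <= z <= 1 -> is_derive z (1 : R) F (f z)) ->
  (forall z : R, 0 <= z <= 1 -> {for z, continuous f}) -> ac F f.
Proof.
move=> dF cf; split.
  apply/bmeas_intg/within_bmeas.
  by apply: continuous_in_subspaceT => z /set_mem /=; rewrite in_itv/=; exact: cf.
move=> x /andP[]; rewrite le_eqVlt => /predU1P[<- _|x0 x1].
  by rewrite int_xx addr0.
have dF' (z : R) : 0 <= z <= x -> is_derive z (1 : R) F (f z).
  by move=> /andP[z0 zx]; apply: dF; rewrite z0 (le_trans zx).
rewrite (FTC2_loc x0 dF'); first by ring.
by move=> z /andP[z0 zx]; apply: cf; rewrite z0 (le_trans zx).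
Qed.

Lemma is_derive_comp1 (f g : R -> R) (x a b : R) : is_derive (g x) (1 : R) f a ->
  is_derive x (1 : R) g b -> is_derive x (1 : R) (fun x => f (g x)) (a * b).
Proof. by move=> fa gb; exact: is_derive1_comp. Qed.

(** With c(x) = tan (om * (1 - x)) one has c' = - om * (1 + c^2), so that
    (f' - om * c * f)^2 = f'^2 - om^2 * f^2 - om * (c * f^2)'; the last term
    integrates to zero because f 0 = 0 and c 1 = 0. The Riccati solution c is
    bounded on [0, 1] only for om < pi / 2. *)
Lemma wirtinger_lt f f1 (om : R) : ac f f1 -> in_L2 f1 -> f 0 = 0 ->
  0 < om < pi / 2 -> om ^+ 2 * L2norm f ^+ 2 <= L2norm f1 ^+ 2.
Proof.
move=> af Lf1 f00 /andP[om0 ompi]; have Lf := ac_L2 af.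
have cos0 (z : R) : 0 <= z <= 1 -> cos (om * (1 - z)) != 0.
  move=> /andP[z0 z1]; rewrite gt_eqF// cos_gt0_pihalf//.
  by apply/andP; split; have := pi_gt0 R; nra.
pose c := fun x => tan (om * (1 - x)).
pose c1 := fun x => - om * (1 + c x ^+ 2).
have dc (z : R) : 0 <= z <= 1 -> is_derive z (1 : R) c (c1 z).
  move=> /cos0 cz.
  have d1 : is_derive z (1 : R) (fun x => om * (1 - x)) (- om).
    have -> : (fun x => om * (1 - x)) = (cst om \* (fun x => 1 - x)) by [].
    apply: is_derive_eq.
    by rewrite /GRing.scale/= /cst; ring.
  have d2 := is_derive_tan cz.
  have := @is_derive_comp1 tan (fun x => om * (1 - x)) z _ _ d2 d1.
  have -> : c1 z = cos (om * (1 - z)) ^- 2 * - om; last by [].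
  rewrite /c1 /c /tan.
  have -> : (cos (om * (1 - z))) ^- 2 =
    (cos (om * (1 - z)) ^+ 2 + sin (om * (1 - z)) ^+ 2) / cos (om * (1 - z)) ^+ 2.
    by rewrite cos2Dsin2 mul1r.
  by field.
have cc (z : R) : 0 <= z <= 1 -> {for z, continuous c}.
  move=> /dc dz; apply: differentiable_continuous; apply/derivable1_diffP.
  exact: ex_derive.
have ac_c : ac c c1.
  apply: ac_C1_loc => // z z01; have cz := cc z z01.
  rewrite /c1; apply: cvgM; first exact: cvg_cst.
  by apply: cvgD; [exact: cvg_cst|exact: cvgM].
have a1 := acM (acM af af) ac_c.
have := ac_int a1 (lexx 0) ler01 (lexx 1).
rewrite f00 {2}/c subrr mulr0 tan0 !(mulr0, mul0r) subr0.
have bc := ac_bmeas ac_c.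
have Lcf : in_L2 (fun x => om * (c x * f x)) by apply: L2Z; exact: L2M.
have L3 : in_L2 (fun x => f1 x - om * (c x * f x)) by exact: L2B.
have I1 := L2_sqr Lf1. have I2 := L2_sqr Lf. have I3 := L2_sqr Lcf.
have I4 := L2_mul Lf1 Lcf.
have -> : \int[mu]_(z in D) ((f1 z * f z + f z * f1 z) * c z + f z * f z * c1 z) =
  \int[mu]_(z in D) ((2 * om^-1) * (f1 z * (om * (c z * f z))) - (om * f z ^+ 2 +
     om^-1 * (om * (c z * f z)) ^+ 2)).
  by apply: eq_int => z _; rewrite /c1; field; rewrite gt_eqF.
rewrite intB ?intD ?intZ//; [|exact: intgZ|exact: intgZ|exact: intgZ|]; last first.
  by apply: intgD; exact: intgZ.
have : 0 <= \int[mu]_(z in D) (f1 z - om * (c z * f z)) ^+ 2.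
  by apply: int_ge0 => z _; exact: sqr_ge0.
have -> : \int[mu]_(z in D) ((f1 z - om * (c z * f z)) ^+ 2) =
  \int[mu]_(z in D) (f1 z ^+ 2 + ((om * (c z * f z)) ^+ 2 - 2 * (f1 z * (om * (c z * f z))))).
  by apply: eq_int => z _; ring.
rewrite intD ?intB ?intZ//; [|exact: intgZ|]; last first.
  by apply: intgB => //; exact: intgZ.
rewrite !L2normE.
set J1 := \int[_]_(_ in _) _; set J2 := \int[_]_(_ in _) _.
set J3 := \int[_]_(_ in _) _; set J4 := \int[_]_(_ in _) _.
move=> p q.
have : 2 * J3 = om * (om * J4 + om^-1 * J2).
  have : om * (2 / om * J3 - (om * J4 + om^-1 * J2)) = 0 by rewrite q mulr0.
  rewrite mulrBr => /eqP; rewrite subr_eq0 => /eqP <-.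
  by field; rewrite gt_eqF.
rewrite mulrDr mulrA -expr2 mulrA divff ?gt_eqF// mul1r => E.
lra.
Qed.

(** Let om tend to pi / 2 in the previous inequality. *)
Lemma wirtinger f f1 : ac f f1 -> in_L2 f1 -> f 0 = 0 ->
  pi ^+ 2 / 4 * L2norm f ^+ 2 <= L2norm f1 ^+ 2.
Proof.
move=> af Lf1 f00; apply/ler_addgt0Pr => e e0.
have pi0 := pi_gt0 R.
set A := L2norm f ^+ 2; have A0 : 0 <= A by rewrite exprn_ge0.
(* (pi / 2 - s)^2 * A is at least pi^2 / 4 * A - e if s * pi * A <= e *)
pose s := Num.min (pi / 4) (e / (pi * A + 1)).
have d0 : 0 < pi * A + 1 by nra.
have s0 : 0 < s by rewrite lt_min !divr_gt0.
have s1 : s <= pi / 4 by rewrite ge_min lexx.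
have s2 : s * (pi * A + 1) <= e.
  by rewrite -ler_pdivlMr// ge_min lexx orbT.
have om : 0 < pi / 2 - s < pi / 2 by apply/andP; split; lra.
have := wirtinger_lt af Lf1 f00 om; rewrite -/A.
nra.
Qed.

End L2.
#[export] Hint Resolve L2norm_ge0 : core.

(** * Entire series and the matrix exponential *)

Section Entire.
Context {R : realType}.
Implicit Types (c d : nat -> R) (x : R).

(** A growth condition under which a power series is entire and which is stable
    under termwise differentiation. *)
Definition expbounded c := exists A L : R,
  [/\ 0 <= A, 0 <= L & forall k, `|c k| <= A * (L ^+ k / k`!%:R)].

Definition pser c x : R := limn (pseries c x).

Lemma expbounded_cvg c x : expbounded c -> cvgn (pseries c x).
Proof.
move=> [A [L [A0 L0 cA]]]; apply: normed_cvg.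
apply: (@series_le_cvg _ _ (fun k => A * exp_coeff (L * `|x|) k)).
- by move=> n; exact: normr_ge0.
- by move=> n; rewrite mulr_ge0// exp_coeff_ge0// mulr_ge0.
- move=> n /=; rewrite normrM normrX /exp_coeff /= exprMn.
  rewrite [leRHS](_ : _ = A * (L ^+ n / n`!%:R) * `|x| ^+ n); last by ring.
  by rewrite ler_wpM2r ?exprn_ge0.
- by apply: is_cvg_seriesZ; exact: is_cvg_series_exp_coeff.
Qed.

Lemma expbounded_diffs c : expbounded c -> expbounded (pseries_diffs c).
Proof.
move=> [A [L [A0 L0 cA]]]; exists (A * L), L; split; rewrite ?mulr_ge0//.
move=> k; rewrite /pseries_diffs normrM ger0_norm//.
have k0 : k.+1%:R != 0 :> R by rewrite pnatr_eq0.
have f0 : k`!%:R != 0 :> R by rewrite pnatr_eq0 -lt0n fact_gt0.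
rewrite (le_trans (ler_wpM2l _ (cA _)))// factS natrM exprS.
by rewrite le_eqVlt; apply/orP; left; apply/eqP; field; apply/andP.
Qed.

Lemma is_derive_pser c x : expbounded c ->
  is_derive x (1 : R) (pser c) (pser (pseries_diffs c) x).
Proof.
move=> ec; apply: (@pseries_snd_diffs _ _ (`|x| + 1)).
- exact: expbounded_cvg.
- exact/expbounded_cvg/expbounded_diffs.
- exact/expbounded_cvg/expbounded_diffs/expbounded_diffs.
- by rewrite [ltRHS]ger0_norm ?addr_ge0// ltrDl.
Qed.

Lemma derive_cont (f f1 : R -> R) : (forall z, is_derive z (1 : R) f (f1 z)) ->
  continuous f.
Proof.
move=> df z; apply: differentiable_continuous; apply/derivable1_diffP.
exact: ex_derive.
Qed.

Lemma cont_pser c : expbounded c -> continuous (pser c).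
Proof. by move=> ec; apply: derive_cont => z; exact: is_derive_pser. Qed.

Lemma pser0 c : pser c 0 = c 0%N.
Proof.
rewrite /pser; apply: cvg_lim => //.
apply: cvg_near_cst; exists 1%N => // n /= n1.
rewrite /pseries /series /= big_ltn// big_nat_cond big1 ?addr0 ?expr0 ?mulr1//.
by move=> i /andP[/andP[i1 _] _]; rewrite expr0n gtn_eqF// mulr0.
Qed.

Lemma pserD c d x : expbounded c -> expbounded d ->
  pser (fun k => c k + d k) x = pser c x + pser d x.
Proof.
move=> ec ed; rewrite /pser /pseries.
rewrite -(lim_seriesD (@expbounded_cvg _ x ec) (@expbounded_cvg _ x ed)).
congr (limn (series _)); apply/funext => k /=.
by rewrite !fctE mulrDl.
Qed.

Lemma pserZ a c x : expbounded c -> pser (fun k => a * c k) x = a * pser c x.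
Proof.
move=> ec; rewrite /pser /pseries.
have := lim_seriesZ a (@expbounded_cvg _ x ec).
rewrite /GRing.scale /= => <-.
congr (limn (series _)); apply/funext => k /=.
by rewrite -[RHS]/(a * (c k * x ^+ k)) mulrA.
Qed.

Lemma expboundedD c d : expbounded c -> expbounded d ->
  expbounded (fun k => c k + d k).
Proof.
move=> [A [L [A0 L0 cA]]] [A' [L' [A'0 L'0 cA']]].
exists (A + A'), (Num.max L L'); split; rewrite ?addr_ge0 ?le_max ?L0//.
move=> k; rewrite (le_trans (ler_normD _ _))// mulrDl lerD//.
  rewrite (le_trans (cA k))// ler_wpM2l// ler_wpM2r//.
  by rewrite lerXn2r ?nnegrE ?le_max ?L0 ?lexx.
rewrite (le_trans (cA' k))// ler_wpM2l// ler_wpM2r//.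
by rewrite lerXn2r ?nnegrE ?le_max ?L'0 ?lexx ?orbT.
Qed.

Lemma expboundedZ a c : expbounded c -> expbounded (fun k => a * c k).
Proof.
move=> [A [L [A0 L0 cA]]]; exists (`|a| * A), L; split; rewrite ?mulr_ge0//.
by move=> k; rewrite normrM -mulrA ler_wpM2l.
Qed.

Lemma expbounded0 : expbounded (fun=> 0).
Proof.
by exists 0, 0; split => // k; rewrite normr0 mul0r.
Qed.

Lemma pser_sum (I : Type) (r : seq I) (a : I -> R) (c : I -> nat -> R) x :
  (forall i, expbounded (c i)) ->
  expbounded (fun k => \sum_(i <- r) a i * c i k) /\
  pser (fun k => \sum_(i <- r) a i * c i k) x = \sum_(i <- r) a i * pser (c i) x.
Proof.
move=> ec; elim: r => [|i r [IH1 IH2]].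
  rewrite big_nil (_ : (fun k => _) = (fun=> 0)); last first.
    by apply/funext => k; rewrite big_nil.
  split; first exact: expbounded0.
  rewrite /pser; apply: cvg_lim => //; apply: cvg_near_cst; exists 0%N => // n _.
  by rewrite /pseries /series /= big1// => j _; rewrite mul0r.
rewrite (_ : (fun k => _) =
  (fun k => a i * c i k + \sum_(j <- r) a j * c j k)); last first.
  by apply/funext => k; rewrite big_cons.
split; first by apply: expboundedD => //; exact: expboundedZ.
by rewrite pserD ?pserZ ?IH2 ?big_cons//; exact: expboundedZ.
Qed.

End Entire.

Section ExpMx.
Context {R : realType} (m : nat) (M : 'M[R]_m).

Let L := \sum_i \sum_j `|M i j|.

Lemma expmx_pow_bound k i j : `|(M ^+ k) i j| <= L ^+ k.
Proof.
have L0 : 0 <= L by apply: sumr_ge0 => ? _; exact: sumr_ge0.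
elim: k i j => [|k IH] i j.
  by rewrite !expr0 mxE; case: eqP => _; rewrite ?normr1// normr0.
rewrite !exprS mxE (le_trans (ler_norm_sum _ _ _))//.
apply: (@le_trans _ _ ((\sum_l `|M i l|) * L ^+ k)).
  rewrite mulr_suml; apply: ler_sum => l _.
  by rewrite normrM ler_wpM2l.
rewrite ler_wpM2r ?exprn_ge0// /L [leRHS](bigD1 i)//= lerDl.
by apply: sumr_ge0 => ? _; exact: sumr_ge0.
Qed.

Definition emx_coef (i j : 'I_m) (k : nat) : R := (M ^+ k) i j / k`!%:R.

Lemma emx_coef_bound i j : expbounded (emx_coef i j).
Proof.
exists 1, L; split; rewrite //.
  by apply: sumr_ge0 => ? _; exact: sumr_ge0.
move=> k; rewrite mul1r normrM [X in _ * X <= _]ger0_norm//.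
by rewrite ler_wpM2r// expmx_pow_bound.
Qed.

Definition emx (x : R) : 'M[R]_m := expmx (x *: M).

Lemma emxE x i j : emx x i j = pser (emx_coef i j) x.
Proof.
rewrite mxE; congr (limn (series _)); apply/funext => k /=.
have -> : (x *: M) ^+ k = x ^+ k *: M ^+ k.
  elim: k => [|k IH]; first by rewrite !expr0 scale1r.
  by rewrite !exprS IH -[LHS]/(_ *m _) -scalemxAl -scalemxAr scalerA.
by rewrite mxE /emx_coef; ring.
Qed.

(** Comparing this with emx_diffs2 shows that M commutes with its exponential;
    each gives one form of the differential equation of the exponential. *)
Lemma emx_diffs1 i j : pseries_diffs (emx_coef i j) =
  fun k => \sum_l M i l * emx_coef l j k.
Proof.
apply/funext => k; rewrite /pseries_diffs /emx_coef exprS mxE.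
have k0 : k.+1%:R != 0 :> R by rewrite pnatr_eq0.
have f0 : k`!%:R != 0 :> R by rewrite pnatr_eq0 -lt0n fact_gt0.
rewrite factS natrM mulr_suml mulr_sumr; apply: eq_bigr => l _.
by field; apply/andP.
Qed.

Lemma emx_diffs2 i j : pseries_diffs (emx_coef i j) =
  fun k => \sum_l M l j * emx_coef i l k.
Proof.
apply/funext => k; rewrite /pseries_diffs /emx_coef exprSr mxE.
have k0 : k.+1%:R != 0 :> R by rewrite pnatr_eq0.
have f0 : k`!%:R != 0 :> R by rewrite pnatr_eq0 -lt0n fact_gt0.
rewrite factS natrM mulr_suml mulr_sumr; apply: eq_bigr => l _.
by field; apply/andP.
Qed.

Lemma emx0 : emx 0 = 1%:M.
Proof.
apply/matrixP => i j; rewrite emxE pser0 /emx_coef expr0 fact0 divr1.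
by rewrite !mxE.
Qed.

Lemma is_derive_emx x i j :
  is_derive x (1 : R) (fun x => emx x i j) ((M *m emx x) i j).
Proof.
have -> : (fun x => emx x i j) = pser (emx_coef i j).
  by apply/funext => y; rewrite emxE.
have -> : (M *m emx x) i j = pser (pseries_diffs (emx_coef i j)) x.
  rewrite emx_diffs1 (pser_sum _ _ _ (fun l => emx_coef_bound l j)).2 mxE.
  by apply: eq_bigr => l _; rewrite emxE.
exact: (is_derive_pser _ (emx_coef_bound i j)).
Qed.

Lemma emx_comm x : M *m emx x = emx x *m M.
Proof.
apply/matrixP => i j; transitivity (pser (pseries_diffs (emx_coef i j)) x).
  rewrite emx_diffs1 (pser_sum _ _ _ (fun l => emx_coef_bound l j)).2 mxE.
  by apply: eq_bigr => l _; rewrite emxE.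
rewrite emx_diffs2 (pser_sum _ _ _ (fun l => emx_coef_bound i l)).2 mxE.
by apply: eq_bigr => l _; rewrite emxE mulrC.
Qed.

Lemma cont_emx i j : continuous (fun x => emx x i j).
Proof. exact: derive_cont (fun x => is_derive_emx x i j). Qed.

End ExpMx.

(** * Linear differential equations *)

Section Conv.
Context {R : realType}.

Lemma is_derive_shift (f f1 : R -> R) (a x : R) :
  (forall z, is_derive z (1 : R) f (f1 z)) ->
  is_derive x (1 : R) (fun s => f (s - a)) (f1 (x - a)).
Proof.
move=> df; have d1 : is_derive x (1 : R) (fun s => s - a) 1.
  by apply: is_derive_eq; rewrite subr0.
by have := @is_derive_comp1 R f (fun s => s - a) x _ _ (df _) d1; rewrite mulr1.
Qed.

Lemma is_derive_rev (f f1 : R -> R) (a x : R) :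
  (forall z, is_derive z (1 : R) f (f1 z)) ->
  is_derive x (1 : R) (fun s => f (a - s)) (- f1 (a - x)).
Proof.
move=> df; have d1 : is_derive x (1 : R) (fun s => a - s) (-1).
  by rewrite -[X in is_derive _ _ _ X]sub0r; exact: is_deriveB.
by have := @is_derive_comp1 R f (fun s => a - s) x _ _ (df _) d1; rewrite mulrN1.
Qed.

Lemma cont_rev (f : R -> R) (a : R) : continuous f -> continuous (fun s => f (a - s)).
Proof.
move=> cf z; apply: continuous_comp; last exact: cf.
by apply: cvgB; [exact: cvg_cst|exact: cvg_id].
Qed.

Lemma cont_shift (f : R -> R) (a : R) : continuous f -> continuous (fun s => f (s - a)).
Proof.
move=> cf z; apply: continuous_comp; last exact: cf.
by apply: cvgB; [exact: cvg_id|exact: cvg_cst].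
Qed.

Lemma skernel_conv (f f1 : R -> R) :
  (forall z, is_derive z (1 : R) f (f1 z)) -> continuous f1 ->
  skernel (fun x y => f (x - y)) (fun x y => f1 (x - y)).
Proof.
move=> df cf1; have cf := derive_cont df.
have [mf [C fC]] := cont_bmeas cf1.
split.
- move=> x y y0 yx x1.
  rewrite (FTC2_C1 (fun z => is_derive_shift y z df) (cont_shift cf1) yx).
  by ring.
- apply: (@measurableT_comp _ _ _ _ _ _ f1).
    exact: continuous_measurable_fun.
  exact: measurable_funB.
- exists C => x y y0 yx x1; apply: fC.
  by rewrite subr_ge0 yx/= lerBlDr (le_trans x1)// lerDl.
- by under eq_fun do rewrite subrr; exact: bmeas_cst.
- by move=> x _; apply: cont_bmeas; exact: cont_rev.
Qed.

End Conv.

Section LinODE.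
Context {R : realType} (m : nat) (M : 'M[R]_m).
Local Notation mu := (@lebesgue_measure R).
Implicit Types (a b e : 'cV[R]_m) (u : R -> R) (x y : R).

Lemma is_derive_mulmx_sum (I : Type) (r : seq I) (k : I -> R) (f f1 : I -> R -> R) x :
  (forall i, is_derive x (1 : R) (f i) (f1 i x)) ->
  is_derive x (1 : R) (fun x => \sum_(i <- r) k i * f i x) (\sum_(i <- r) k i * f1 i x).
Proof.
move=> df; elim: r => [|i r IH].
  rewrite big_nil (_ : (fun x => _) = cst 0); last by apply/funext => ?; rewrite big_nil.
  exact: is_derive_cst.
rewrite big_cons (_ : (fun x => _) =
  (k i *: f i) + (fun x => \sum_(j <- r) k j * f j x)); last first.
  by apply/funext => ?; rewrite big_cons.
exact: is_deriveD.
Qed.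

Lemma is_derive_emxv a i x :
  is_derive x (1 : R) (fun x => (emx M x *m a) i 0) ((M *m emx M x *m a) i 0).
Proof.
rewrite (_ : (fun x => _) = (fun x => \sum_(j <- index_enum 'I_m) a j 0 * emx M x i j)); last first.
  by apply/funext => y; rewrite mxE; apply: eq_bigr => j _; rewrite mulrC.
rewrite mxE.
have := @is_derive_mulmx_sum _ (index_enum 'I_m) (fun j => a j 0)
  (fun j x => emx M x i j) (fun j x => (M *m emx M x) i j) x
  (fun j => is_derive_emx M x i j).
by rewrite [X in is_derive _ _ _ X -> _](eq_bigr (fun j => (M *m emx M x) i j * a j 0)) // => j _; rewrite mulrC.
Qed.

Lemma cont_emxv a i : continuous (fun x => (emx M x *m a) i 0).
Proof. exact: derive_cont (is_derive_emxv a i). Qed.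

Lemma cont_Memxv a i : continuous (fun x => (M *m emx M x *m a) i 0).
Proof.
have -> : (fun x => (M *m emx M x *m a) i 0) = (fun x => (emx M x *m (M *m a)) i 0).
  by apply/funext => x; rewrite emx_comm mulmxA.
exact: cont_emxv.
Qed.

(** Duhamel's formula for s' = M s + u e, s 0 = a. *)
Definition sol a e u x : 'cV[R]_m :=
  emx M x *m a +
  \col_i \int[mu]_(y in `[0, x]) ((emx M (x - y) *m e) i 0 * u y).

Lemma sol_at0 a e u : sol a e u 0 = a.
Proof.
rewrite /sol emx0 mul1mx; apply/matrixP => i j.
by rewrite !mxE int_xx addr0.
Qed.

Lemma bmeas_emxv_rev e i x : bmeas (fun y => (emx M (x - y) *m e) i 0).
Proof.
apply: cont_bmeas.
exact: (@cont_rev R (fun z => (emx M z *m e) i 0) x (@cont_emxv e i)).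
Qed.

Lemma skernel_emxv e i : skernel (fun x y => (emx M (x - y) *m e) i 0)
  (fun x y => (M *m emx M (x - y) *m e) i 0).
Proof.
exact: (@skernel_conv R (fun x => (emx M x *m e) i 0) _
  (is_derive_emxv e i) (@cont_Memxv e i)).
Qed.

Lemma sol_ac a e u i : intg u ->
  ac (fun x => sol a e u x i 0) (fun x => (M *m sol a e u x + u x *: e) i 0).
Proof.
move=> Iu.
have a1 := ac_C1 (is_derive_emxv a i) (@cont_Memxv a i).
have a2 := ac_volterra (skernel_emxv e i) Iu.
apply: eq_ac (acD a1 a2) => x /andP[x0 x1].
  by rewrite /sol !mxE.
rewrite subrr emx0 mul1mx.
rewrite /sol mulmxDr [in RHS]mxE [X in _ = X + _]mxE mulmxA -addrA.
congr (_ + _).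
rewrite addrC [(u x *: e) i 0]mxE [e i 0 * u x]mulrC; congr (_ + _).
rewrite [RHS]mxE.
have bl l : bmeas (fun y => (emx M (x - y) *m e) l 0).
  exact: bmeas_emxv_rev.
transitivity (\sum_l M i l * \int[mu]_(y in `[0, x]) ((emx M (x - y) *m e) l 0 * u y)).
  have -> : \int[mu]_(y in `[0, x]) ((M *m emx M (x - y) *m e) i 0 * u y) =
    \int[mu]_(y in `[0, x]) (\sum_l M i l * ((emx M (x - y) *m e) l 0 * u y)).
    apply: eq_int => y _; rewrite -mulmxA mxE mulr_suml.
    by apply: eq_bigr => l _; rewrite mulrA.
  have h (r : seq 'I_m) : intg (fun y => \sum_(l <- r) M i l * ((emx M (x - y) *m e) l 0 * u y)) /\
     \int[mu]_(y in `[0, x]) (\sum_(l <- r) M i l * ((emx M (x - y) *m e) l 0 * u y)) =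
     \sum_(l <- r) M i l * \int[mu]_(y in `[0, x]) ((emx M (x - y) *m e) l 0 * u y).
    elim: r => [|l r [IH1 IH2]].
      rewrite big_nil; split.
        by apply: eq_intg (intg_cst 0) => y _; rewrite big_nil.
      by under eq_Rintegral do rewrite big_nil; rewrite int_cst// mul0r.
    have Il : intg (fun y => (emx M (x - y) *m e) l 0 * u y) by exact: intgM.
    split.
      by apply: eq_intg (intgD (intgZ (M i l) Il) IH1) => y _; rewrite big_cons.
    rewrite big_cons -IH2 -intZ// -intD//; last exact: intgZ.
    by apply: eq_int => y _; rewrite big_cons.
  exact: (h _).2.
by apply: eq_bigr => l _; rewrite !mxE.
Qed.

(** Variation of constants: differentiate emx M (x - y) *m s y in y. *)
Lemma sol_uniq (s : R -> 'cV[R]_m) e u : intg u ->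
  (forall i, ac (fun x => s x i 0) (fun x => (M *m s x + u x *: e) i 0)) ->
  forall x, 0 <= x <= 1 -> s x = sol (s 0) e u x.
Proof.
move=> Iu sM x /andP[x0 x1]; apply/matrixP => i j; rewrite !ord1 {j}.
have dE j z : is_derive z (1 : R) (fun y => emx M (x - y) i j) (- (M *m emx M (x - z)) i j).
  exact: (is_derive_rev x z (fun z => is_derive_emx M z i j)).
have cE j : continuous (fun z => - (M *m emx M (x - z)) i j).
  move=> z; apply: cvgN.
  have h : continuous (fun x => (M *m emx M x) i j).
    have -> : (fun x => (M *m emx M x) i j) = (fun x => (M *m emx M x *m delta_mx j (0 : 'I_1)) i 0).
      by apply/funext => w; rewrite -colE !mxE.
    exact: cont_Memxv.
  exact: (@cont_rev R (fun x => (M *m emx M x) i j) x h).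
have aE j := ac_C1 (dE j) (cE j).
have := @ac_sum R _ (index_enum 'I_m) xpredT _ _ (fun j => acM (aE j) (sM j)).
move=> /ac_int /(_ (lexx 0) x0 x1).
rewrite subrr subr0 emx0 => E.
have -> : s x i 0 = (1%:M *m s x) i 0 by rewrite mul1mx.
rewrite mxE; move/eqP: E; rewrite eq_sym subr_eq => /eqP ->.
rewrite /sol [RHS]mxE [RHS]addrC [X in _ = _ + X]mxE; congr (_ + _).
rewrite mxE; apply: eq_int => y _.
transitivity ((emx M (x - y) *m (M *m s y + u y *: e)) i 0 -
   (M *m emx M (x - y) *m s y) i 0).
  rewrite big_split /= addrC !mxE; congr (_ + _).
  rewrite -sumrN; apply: eq_bigr => l _; by rewrite mulNr.
rewrite emx_comm mulmxDr mulmxA -scalemxAr.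
move: (_ *m s y) (_ *m e) => V W; rewrite !mxE; ring.
Qed.

Lemma solD a b e u u' x : intg u -> intg u' -> 0 <= x <= 1 ->
  sol (a + b) e (fun y => u y + u' y) x = sol a e u x + sol b e u' x.
Proof.
move=> Iu Iu' /andP[x0 x1]; rewrite /sol mulmxDr addrACA; congr (_ + _).
apply/matrixP => i j; rewrite !mxE.
have bl : bmeas (fun y => (emx M (x - y) *m e) i 0).
  exact: bmeas_emxv_rev.
rewrite -intD//; [|exact: intgM..].
by apply: eq_int => y _; rewrite mulrDr.
Qed.

Lemma solZ c a e u x : intg u -> 0 <= x <= 1 ->
  sol (c *: a) e (fun y => c * u y) x = c *: sol a e u x.
Proof.
move=> Iu /andP[x0 x1]; rewrite /sol scalerDr -scalemxAr; congr (_ + _).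
apply/matrixP => i j; rewrite !mxE.
have bl : bmeas (fun y => (emx M (x - y) *m e) i 0).
  exact: bmeas_emxv_rev.
rewrite -intZ//; last exact: intgM.
by apply: eq_int => y _; rewrite mulrCA.
Qed.

(** The exponential is bounded on [0, 1], the Duhamel integral is bounded by
    Cauchy-Schwarz. *)
Lemma sol_bound e : exists C, forall a u x i, in_L2 u -> 0 <= x <= 1 ->
  `|sol a e u x i 0| <= C * (\sum_j `|a j 0| + L2norm u).
Proof.
have b1 i j : exists C, forall x, 0 <= x <= 1 -> `|emx M x i j| <= C.
  by have [_ ] := cont_bmeas (@cont_emx _ _ M i j).
have [C1 C1E] : exists C, 0 <= C /\ forall i j x, 0 <= x <= 1 -> `|emx M x i j| <= C.
  have /choice [f fE] : forall p : 'I_m * 'I_m, exists C,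
     forall x, 0 <= x <= 1 -> `|emx M x p.1 p.2| <= C by move=> [i j]; exact: b1.
  have f0 p : 0 <= f p by rewrite (le_trans _ (fE p 0 _))// lexx ler01.
  exists (\sum_p f p); split; first exact: sumr_ge0.
  move=> i j x x01; rewrite (le_trans (fE (i, j) x x01))// (bigD1 (i, j))//= lerDl.
  exact: sumr_ge0.
case: C1E => C10 C1E.
exists (C1 * (1 + \sum_j `|e j 0|)) => a u x i Lu /[dup] x01 /andP[x0 x1].
have bE (v : 'cV[R]_m) y : 0 <= y <= 1 -> `|(emx M y *m v) i 0| <= C1 * \sum_j `|v j 0| :> R.
  move=> y01; rewrite mxE (le_trans (ler_norm_sum _ _ _))// mulr_sumr.
  by apply: ler_sum => j _; rewrite normrM ler_wpM2r// C1E.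
rewrite /sol mxE (le_trans (ler_normD _ _))//.
have h1 := bE a x x01.
have bl : bmeas (fun y => (emx M (x - y) *m e) i 0).
  exact: bmeas_emxv_rev.
have h2 : `|\int[mu]_(y in `[0, x]) ((emx M (x - y) *m e) i 0 * u y)| <=
   C1 * (\sum_j `|e j 0|) * L2norm u.
  apply: int_kernel_bound => // y /andP[y0 yx]; apply: bE.
  by rewrite subr_ge0 yx lerBlDr (le_trans x1)// lerDl.
rewrite [X in _ + `|X| <= _]mxE.
have e0 : 0 <= \sum_j `|e j 0| :> R by exact: sumr_ge0.
have a0p : 0 <= \sum_j `|a j 0| :> R by exact: sumr_ge0.
have u0 := L2norm_ge0 u.
apply: le_trans (lerD h1 h2) _.
have p1 : 0 <= C1 * (\sum_j `|e j 0|) * (\sum_j `|a j 0|) by rewrite !mulr_ge0.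
have p2 : 0 <= C1 * L2norm u by rewrite mulr_ge0.
rewrite [leRHS](_ : _ = C1 * (\sum_j `|a j 0|) + C1 * (\sum_j `|e j 0|) * L2norm u +
  (C1 * (\sum_j `|e j 0|) * (\sum_j `|a j 0|) + C1 * L2norm u)); last by ring.
by rewrite lerDl addr_ge0.
Qed.

End LinODE.

(** * Bessel functions *)

Section Antiderivative.
Context {R : realType}.
Local Notation mu := (@lebesgue_measure R).

Lemma cont_antiderivative (h : R -> R) (b : R) : continuous h ->
  exists H : R -> R, forall z, b < z -> is_derive z (1 : R) H (h z).
Proof.
move=> ch; exists (fun z => \int[mu]_(t in `[b, z]) h t) => z bz.
have Ih : mu.-integrable `[b, z + 1] (EFin \o h).
  apply: continuous_compact_integrable; first exact: segment_compact.
  exact: (continuous_subspaceT ch).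
have zz : z < z + 1 by rewrite ltrDl.
have [d1 d2] := continuous_FTC1_closed zz Ih bz (ch z).
apply: DeriveDef.
exact: d1.
rewrite -derive1E.
exact: d2.
Qed.

(** Both sides are increments of an antiderivative; this one is taken from the
    base point -1 to be differentiable at 0. *)
Lemma int_rev (h : R -> R) (x : R) : continuous h -> 0 <= x ->
  \int[mu]_(y in `[0, x]) h (x - y) = \int[mu]_(y in `[0, x]) h y.
Proof.
move=> ch; rewrite le_eqVlt => /predU1P[<-|x0]; first by rewrite !int_xx.
have [H dH] := @cont_antiderivative h (-1) ch.
have N1 z : 0 <= z -> -1 < z :> R by move=> z0; rewrite (lt_le_trans _ z0)// ltrN10.
have dH0 (z : R) : 0 <= z <= x -> is_derive z (1 : R) H (h z).
  by move=> /andP[z0 _]; exact/dH/N1.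
have dHx (z : R) : 0 <= z <= x ->
  is_derive z (1 : R) (fun y => - H (x - y)) (h (x - z)).
  move=> /andP[z0 zx].
  have d1 : is_derive z (1 : R) (fun s => x - s) (-1).
    by rewrite -[X in is_derive _ _ _ X]sub0r; exact: is_deriveB.
  have d2 : is_derive (x - z) (1 : R) H (h (x - z)).
    by apply: dH; apply: N1; rewrite subr_ge0.
  have := is_deriveN (@is_derive_comp1 R H (fun s => x - s) z _ _ d2 d1).
  by rewrite mulrN1 opprK.
rewrite (FTC2_loc x0 dH0); last by move=> z _; exact: ch.
rewrite (FTC2_loc x0 dHx); last by move=> z _; exact: (@cont_rev R h x ch).
by rewrite subrr subr0; ring.
Qed.

Lemma conv_comm (f g : R -> R) (x : R) : continuous f -> continuous g -> 0 <= x ->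
  \int[mu]_(y in `[0, x]) (f (x - y) * g y) =
  \int[mu]_(y in `[0, x]) (g (x - y) * f y).
Proof.
move=> cf cg x0.
have ch : continuous (fun y => g (x - y) * f y).
  by move=> z; apply: cvgM; [exact: (@cont_rev R g x cg)|exact: cf].
rewrite -(int_rev ch x0); apply: eq_int => y _.
by rewrite subKr mulrC.
Qed.

End Antiderivative.

Section Bessel.
Context {R : realType}.
Local Notation mu := (@lebesgue_measure R).
Implicit Types (la v w x y : R).

(** Coefficients of I_1(s) / s as a series in s^2. *)
Definition bes_coef (m : nat) : R := (4 ^+ m * (2 * m`!%:R * m.+1`!%:R))^-1.

Lemma bes_coef_bound : expbounded bes_coef.
Proof.
exists 1, 1; split => // m; rewrite expr1n mul1r /bes_coef ger0_norm; last first.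
  by rewrite invr_ge0 !mulr_ge0// exprn_ge0.
rewrite mul1r lef_pV2 ?posrE ?mulr_gt0 ?exprn_gt0 ?ltr0n ?fact_gt0//.
have f1 : 1 <= m.+1`!%:R :> R by rewrite ler1n fact_gt0.
have f2 : 1 <= 4 ^+ m :> R by rewrite exprn_ege1// ler1n.
have f0 : 0 <= m`!%:R :> R by [].
apply: (@le_trans _ _ (1 * (2 * m`!%:R * 1))); first by lra.
by apply: ler_pM => //; apply: ler_wpM2l => //; lra.
Qed.

Definition bes0 := pser bes_coef.
Definition bes1 := pser (pseries_diffs bes_coef).
Definition bes2 := pser (pseries_diffs (pseries_diffs bes_coef)).

Lemma is_derive_bes0 v : is_derive v (1 : R) bes0 (bes1 v).
Proof. exact: is_derive_pser bes_coef_bound. Qed.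

Lemma is_derive_bes1 v : is_derive v (1 : R) bes1 (bes2 v).
Proof. exact: is_derive_pser (expbounded_diffs bes_coef_bound). Qed.

Lemma cont_bes2 : continuous bes2.
Proof. exact: cont_pser (expbounded_diffs (expbounded_diffs bes_coef_bound)). Qed.

Lemma bes0_0 : bes0 0 = 2^-1.
Proof.
rewrite /bes0 pser0 /bes_coef.
have -> : (0.+1)`! = 1%N by [].
by rewrite fact0 expr0; field.
Qed.

Lemma pser_shift (d : nat -> R) v : expbounded d ->
  pser (fun k => if k is k'.+1 then d k' else 0) v = v * pser d v.
Proof.
move=> ed; rewrite /pser; apply: cvg_lim => //.
rewrite -(cvg_shiftS _).
have -> : (fun n => (pseries (fun k => if k is k'.+1 then d k' else 0) v) n.+1) =
  (fun n => v * pseries d v n).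
  apply/funext => n; rewrite /pseries /series /= big_nat_recl// mul0r add0r.
  by rewrite mulr_sumr; apply: eq_bigr => i _; rewrite exprS; ring.
apply: cvgMr; exact: expbounded_cvg.
Qed.

(** Bessel's equation in the variable s^2: compare coefficients. *)
Lemma bes_ode v : v * bes2 v + 2 * bes1 v = bes0 v / 4.
Proof.
have e0 := bes_coef_bound; have e1 := expbounded_diffs e0.
have e2 := expbounded_diffs e1.
rewrite /bes2 -pser_shift//.
have -> : (fun k => if k is k'.+1 then pseries_diffs (pseries_diffs bes_coef) k' else 0) =
  (fun k => 4^-1 * bes_coef k + (-2) * pseries_diffs bes_coef k).
  apply/funext => -[|k].
    rewrite /pseries_diffs /bes_coef expr0 expr1 (_ : 0`! = 1)%N// (_ : 1`! = 1)%N//.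
    by rewrite (_ : 2`! = 2)%N//; field.
  rewrite /pseries_diffs /bes_coef !factS !natrM !exprS.
  have h i : i.+1%:R != 0 :> R by rewrite pnatr_eq0.
  have f0 : k`!%:R != 0 :> R by rewrite pnatr_eq0 -lt0n fact_gt0.
  have p0 : 4 ^+ k != 0 :> R by rewrite expf_neq0// pnatr_eq0.
  have E3 : k.+3%:R = k%:R + 3 :> R by rewrite -addn3 natrD.
  have E2 : k.+2%:R = k%:R + 2 :> R by rewrite -addn2 natrD.
  have E1 : k.+1%:R = k%:R + 1 :> R by rewrite -addn1 natrD.
  have := h k.+2; have := h k.+1; have := h k; rewrite E1 E2 E3 => h1 h2 h3.
  by field; rewrite f0 p0 h1 h2 h3.
rewrite pserD; [|exact: expboundedZ|exact: expboundedZ].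
by rewrite !pserZ// /bes0 /bes1; field.
Qed.

(** The kernels are q(x,y) = - x * phi (a + c) (x^2 - y^2) and
    l(x,y) = x * phi (- (a + c)) (x^2 - y^2); a change of sign of the parameter
    exchanges I_1 and J_1. *)
Definition phi la v := la * bes0 (la * v).
Definition dphi la v := la ^+ 2 * bes1 (la * v).
Definition ddphi la v := la ^+ 3 * bes2 (la * v).

Lemma is_derive_scal_arg (f f1 : R -> R) la v :
  (forall z, is_derive z (1 : R) f (f1 z)) ->
  is_derive v (1 : R) (fun v => f (la * v)) (la * f1 (la * v)).
Proof.
move=> df.
have d1 : is_derive v (1 : R) (fun s => la * s) la.
  rewrite -[X in is_derive _ _ _ X](mulr1 la).
  exact: (is_deriveZ la (is_derive_id v (1 : R))).
by have := @is_derive_comp1 R f (fun s => la * s) v _ _ (df _) d1; rewrite mulrC.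
Qed.

Lemma is_derive_phi la v : is_derive v (1 : R) (phi la) (dphi la v).
Proof.
have -> : dphi la v = la *: (la * bes1 (la * v)) by rewrite /dphi /GRing.scale/=; ring.
exact: (is_deriveZ la (is_derive_scal_arg la v is_derive_bes0)).
Qed.

Lemma is_derive_dphi la v : is_derive v (1 : R) (dphi la) (ddphi la v).
Proof.
have -> : ddphi la v = la ^+ 2 *: (la * bes2 (la * v)).
  by rewrite /ddphi /GRing.scale/=; ring.
exact: (is_deriveZ (la ^+ 2) (is_derive_scal_arg la v is_derive_bes1)).
Qed.

Lemma cont_ddphi la : continuous (ddphi la).
Proof.
move=> v; apply: cvgM; first exact: cvg_cst.
apply: continuous_comp; last exact: cont_bes2.
by apply: cvgM; [exact: cvg_cst|exact: cvg_id].
Qed.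

Lemma phi_ode la v : v * ddphi la v + 2 * dphi la v = la / 4 * phi la v.
Proof.
have := bes_ode (la * v); rewrite /phi /dphi /ddphi => E.
rewrite (_ : la / 4 * _ = la ^+ 2 * (bes0 (la * v) / 4)); last by ring.
by rewrite -E; ring.
Qed.

Lemma phi0 la : phi la 0 = la / 2.
Proof. by rewrite /phi mulr0 bes0_0. Qed.

Lemma cont_phi la : continuous (phi la).
Proof. exact: derive_cont (is_derive_phi la). Qed.

Lemma cont_dphi la : continuous (dphi la).
Proof. exact: derive_cont (is_derive_dphi la). Qed.

Let psi la v := v * phi la v.
Let dpsi la v := phi la v + v * dphi la v.

Let is_derive_psi la v : is_derive v (1 : R) (psi la) (dpsi la v).
Proof.
have := @is_deriveM _ _ id (phi la) v 1 _ _ (is_derive_id v 1) (is_derive_phi la v).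
by rewrite /GRing.scale/= mulr1 addrC.
Qed.

Let is_derive_dpsi la v : is_derive v (1 : R) (dpsi la) (la / 4 * phi la v).
Proof.
have := is_deriveD (is_derive_phi la v)
  (@is_deriveM _ _ id (dphi la) v 1 _ _ (is_derive_id v 1) (is_derive_dphi la v)).
rewrite /GRing.scale/= mulr1 -phi_ode.
by rewrite (_ : dphi la v + _ = v * ddphi la v + 2 * dphi la v)//; ring.
Qed.

Let cont_lphi la : continuous (fun v => la / 4 * phi la v).
Proof. by move=> v; apply: cvgM; [exact: cvg_cst|exact: cont_phi]. Qed.

Let conv_psi la m v : ac
  (fun x => \int[mu]_(y in `[0, x]) (psi la (x - y) * phi m y))
  (fun x => \int[mu]_(y in `[0, x]) (dpsi la (x - y) * phi m y)).
Proof.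
have sk := skernel_conv (is_derive_psi la) (derive_cont (is_derive_dpsi la)).
have := ac_volterra sk (bmeas_intg (cont_bmeas (@cont_phi m))).
apply: eq_ac => // x _.
by rewrite subrr {1}/psi mul0r mul0r add0r.
Qed.

Let conv_dpsi la m v : ac
  (fun x => \int[mu]_(y in `[0, x]) (dpsi la (x - y) * phi m y))
  (fun x => la / 2 * phi m x +
     la / 4 * \int[mu]_(y in `[0, x]) (phi la (x - y) * phi m y)).
Proof.
have sk := skernel_conv (is_derive_dpsi la) (@cont_lphi la).
have := ac_volterra sk (bmeas_intg (cont_bmeas (@cont_phi m))).
apply: eq_ac => // x /andP[x0 x1].
rewrite subrr {1}/dpsi mul0r addr0 phi0; congr (_ + _).
rewrite -intZ//; first by apply: eq_int => y _; rewrite mulrA.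
apply: intgM; last exact: (bmeas_intg (cont_bmeas (@cont_phi m))).
by apply: cont_bmeas; exact: (@cont_rev R (phi la) x (@cont_phi la)).
Qed.

(** The resolvent identity behind the inversion of the second transformation.
    Set f = phi la, g = phi (- la) and Z(v) = v * (f + g + (f * g) / 2), where
    f * g is the convolution. As (v f)'' = la / 4 * f and (v g)'' = - la / 4 * g,
    and as convolution commutes, Z'' = 0 and Z(0) = Z'(0) = 0. *)
Lemma phi_conv la v : 0 <= v <= 1 ->
  phi (- la) v + phi la v =
  - (2^-1 * \int[mu]_(y in `[0, v]) (phi la (v - y) * phi (- la) y)).
Proof.
move=> /andP[v0 v1].
move: v0; rewrite le_eqVlt => /predU1P[<-|v0].
  by rewrite int_xx mulr0 oppr0 !phi0; ring.
pose f := phi la; pose g := phi (- la).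
pose h x := \int[mu]_(y in `[0, x]) (f (x - y) * g y).
have hc x : 0 <= x -> \int[mu]_(y in `[0, x]) (g (x - y) * f y) = h x.
  by move=> x0; rewrite conv_comm//; exact: cont_phi.
(* Z1 is the derivative of Z *)
pose Z1 x := (dpsi (- la) x + dpsi la x) + 2^-1 *
  (\int[mu]_(y in `[0, x]) (dpsi la (x - y) * g y) +
   \int[mu]_(y in `[0, x]) (dpsi (- la) (x - y) * f y)).
have aZ1 : ac Z1 (fun=> 0).
  have := acD (acD (ac_C1 (is_derive_dpsi (- la)) (@cont_lphi (- la)))
                   (ac_C1 (is_derive_dpsi la) (@cont_lphi la)))
    (acZ 2^-1 (acD (conv_dpsi la (- la) v) (conv_dpsi (- la) la v))).
  apply: eq_ac => // x /andP[x0 x1].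
  by rewrite (hc x x0) /h /f /g; field.
have Z10 x : 0 <= x <= 1 -> Z1 x = 0.
  move=> /[dup] x01 /andP[x0 x1]; rewrite (aZ1.2 x x01) int_cst// mul0r addr0.
  by rewrite /Z1 !int_xx /dpsi !mul0r !phi0; field.
pose Z x := (psi (- la) x + psi la x) + 2^-1 *
  (\int[mu]_(y in `[0, x]) (psi la (x - y) * g y) +
   \int[mu]_(y in `[0, x]) (psi (- la) (x - y) * f y)).
have aZ : ac Z (fun=> 0).
  have := acD (acD (ac_C1 (is_derive_psi (- la)) (derive_cont (is_derive_dpsi (- la))))
                   (ac_C1 (is_derive_psi la) (derive_cont (is_derive_dpsi la))))
    (acZ 2^-1 (acD (conv_psi la (- la) v) (conv_psi (- la) la v))).
  by apply: eq_ac => // x x01; rewrite -[RHS](Z10 x x01).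
have : Z v = 0.
  rewrite (aZ.2 v); last by rewrite ltW.
  rewrite int_cst ?ltW// mul0r addr0.
  by rewrite /Z !int_xx /psi !mul0r; field.
have bfg : intg (fun y => f (v - y) * g y).
  apply: intgM; last exact: (bmeas_intg (cont_bmeas (@cont_phi (- la)))).
  by apply: cont_bmeas; exact: (@cont_rev R f v (@cont_phi la)).
have bpg : intg (fun y => psi la (v - y) * g y).
  apply: intgM; last exact: (bmeas_intg (cont_bmeas (@cont_phi (- la)))).
  apply: cont_bmeas; exact: (@cont_rev R (psi la) v (derive_cont (is_derive_psi la))).
have -> : Z v = v * (phi (- la) v + phi la v + 2^-1 * h v).
  rewrite /Z (@conv_comm _ (psi (- la)) f)//; last 3 first.
  - exact: derive_cont (is_derive_psi (- la)).
  - exact: cont_phi.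
  - exact: ltW.
  have bfp : intg (fun y => f (v - y) * psi (- la) y).
    apply: intgM; last exact: (bmeas_intg (cont_bmeas (derive_cont (is_derive_psi (- la))))).
    by apply: cont_bmeas; exact: (@cont_rev R f v (@cont_phi la)).
  rewrite -intD//.
  have -> : \int[mu]_(z in `[0, v]) (psi la (v - z) * g z + f (v - z) * psi (- la) z) =
     v * h v.
    rewrite -intZ//; apply: eq_int => y _; rewrite /psi /f /g; ring.
  by rewrite /psi; ring.
move=> /eqP; rewrite mulf_eq0 gt_eqF//= => /eqP.
move/(canRL (addrK _)) ->; rewrite sub0r /h; ring.
Qed.

End Bessel.

(** * The kernels of the second transformation *)

Section VolterraMeas.
Context {R : realType}.
Local Notation mu := (@lebesgue_measure R).
Local Notation D := (`[0%R, 1%R]%classic : set R).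

Lemma int_volterra_bmeas (H : R -> R -> R) (g : R -> R) C : intg g ->
  measurable_fun [set: R * R] (fun p => H p.1 p.2) ->
  (forall x y, 0 <= y -> y <= x -> x <= 1 -> `|H x y| <= C) ->
  bmeas (fun x => \int[mu]_(y in `[0, x]) (H x y * g y)).
Proof.
move=> Ig mH HC.
have I1 : intg (fun x => \int[mu]_(y in `[0, x]) (H x y * g y)).
  apply: eq_intg (@tri_intg1 _ _ _ (fun p => H p.1 p.2) C (intg_cst 1) Ig mH HC).
  by move=> x _; rewrite mul1r.
split; first exact: intg_meas.
exists (C * \int[mu]_(y in D) `|g y|) => x /andP[x0 x1].
have Ix : mu.-integrable `[0, x] (EFin \o (fun y => H x y * g y)).
  by apply: (@tri_inner_int R g (fun p => H p.1 p.2) C Ig mH HC x); rewrite x0.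
have Ia := intg_norm Ig.
apply: (le_trans (le_normr_Rintegral _ Ix)) => //.
have C0 : 0 <= C by rewrite (le_trans _ (HC 0 0 _ _ _)).
apply: (@le_trans _ _ (\int[mu]_(y in `[0, x]) (C * `|g y|))).
  apply: le_Rintegral => //.
  - exact: (integrable_norm Ix).
  - exact: (intg_sub (intgZ C Ia) (lexx 0) x1).
  - move=> y /=; rewrite in_itv/= => /andP[y0 yx].
    by rewrite normrM ler_wpM2r// HC.
by rewrite intZ// ler_wpM2l// int_subset.
Qed.

Lemma skernel_cont (K Kx : R -> R -> R) C :
  (forall x y, is_derive x (1 : R) (K ^~ y) (Kx x y)) ->
  (forall y, continuous (Kx ^~ y)) ->
  measurable_fun [set: R * R] (fun p => Kx p.1 p.2) ->
  (forall x y, 0 <= y -> y <= x -> x <= 1 -> `|Kx x y| <= C) ->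
  continuous (fun x => K x x) -> (forall x, continuous (K x)) ->
  skernel K Kx.
Proof.
move=> dK cKx mKx KC cd cK; split => //.
- move=> x y y0 yx x1; rewrite (FTC2_C1 (fun z => dK z y) (cKx y) yx); ring.
- by exists C.
- exact: cont_bmeas.
- by move=> x _; exact: cont_bmeas.
Qed.

Lemma is_deriveMr (f g : R -> R) (x a b : R) : is_derive x (1 : R) f a ->
  is_derive x (1 : R) g b ->
  is_derive x (1 : R) (fun x => f x * g x) (a * g x + f x * b).
Proof.
move=> df dg; have := is_deriveM df dg.
by rewrite /GRing.scale/= addrC [g x * a]mulrC.
Qed.

Lemma is_deriveDr (f g : R -> R) (x a b : R) : is_derive x (1 : R) f a ->
  is_derive x (1 : R) g b ->
  is_derive x (1 : R) (fun x => f x + g x) (a + b).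
Proof. by move=> df dg; exact: is_deriveD. Qed.

Lemma is_derive_sqr (x : R) : is_derive x (1 : R) (fun x => x ^+ 2) (2 * x).
Proof.
apply: (is_derive_eq (is_deriveMr (is_derive_id x 1) (is_derive_id x 1))).
by ring.
Qed.

End VolterraMeas.

Section QLKernels.
Context {R : realType}.
Local Notation mu := (@lebesgue_measure R).
Implicit Types (la x y s : R).

(** Minus the kernel q, at la = a + c, and the kernel l, at la = - (a + c). *)
Definition gk la x y := x * phi la (x ^+ 2 - y ^+ 2).
Definition gkx la x y :=
  phi la (x ^+ 2 - y ^+ 2) + 2 * x ^+ 2 * dphi la (x ^+ 2 - y ^+ 2).
Definition gkxx la x y :=
  6 * x * dphi la (x ^+ 2 - y ^+ 2) + 4 * x ^+ 3 * ddphi la (x ^+ 2 - y ^+ 2).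
Definition gky la x y := - (2 * x * y * dphi la (x ^+ 2 - y ^+ 2)).
Definition gkyy la x y :=
  - (2 * x * dphi la (x ^+ 2 - y ^+ 2)) + 4 * x * y ^+ 2 * ddphi la (x ^+ 2 - y ^+ 2).

(** The kernel equation, equivalent to the equation of phi. *)
Lemma gk_pde la x y : gkxx la x y - gkyy la x y = la * gk la x y.
Proof.
have := phi_ode la (x ^+ 2 - y ^+ 2); rewrite /gk /gkxx /gkyy => E.
rewrite (_ : la * _ = 4 * x * (la / 4 * phi la (x ^+ 2 - y ^+ 2))); last by field.
rewrite -E; ring.
Qed.

Lemma gk_diag la x : gk la x x = la / 2 * x.
Proof. by rewrite /gk subrr phi0 mulrC. Qed.

Lemma is_derive_sqrBx y x : is_derive x (1 : R) (fun x => x ^+ 2 - y ^+ 2) (2 * x).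
Proof.
by rewrite -[X in is_derive _ _ _ X]subr0; apply: is_deriveB; exact: is_derive_sqr.
Qed.

Lemma is_derive_sqrBy x y : is_derive y (1 : R) (fun y => x ^+ 2 - y ^+ 2) (- (2 * y)).
Proof.
rewrite -[X in is_derive _ _ _ X]sub0r; apply: is_deriveB; exact: is_derive_sqr.
Qed.

Section gen.
Variables (f f1 : R -> R).
Hypothesis df : forall z, is_derive z (1 : R) f (f1 z).

Lemma is_derive_compx y x :
  is_derive x (1 : R) (fun x => f (x ^+ 2 - y ^+ 2)) (2 * x * f1 (x ^+ 2 - y ^+ 2)).
Proof.
rewrite mulrC.
exact: (@is_derive_comp1 R f (fun x => x ^+ 2 - y ^+ 2) x _ _ (df _) (is_derive_sqrBx y x)).
Qed.

Lemma is_derive_compy x y :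
  is_derive y (1 : R) (fun y => f (x ^+ 2 - y ^+ 2)) (- (2 * y * f1 (x ^+ 2 - y ^+ 2))).
Proof.
have := @is_derive_comp1 R f (fun y => x ^+ 2 - y ^+ 2) y _ _ (df _) (is_derive_sqrBy x y).
by rewrite mulrN mulrC.
Qed.
End gen.

Lemma cont_compx (f : R -> R) y : continuous f -> continuous (fun x => f (x ^+ 2 - y ^+ 2)).
Proof.
move=> cf z; apply: (@continuous_comp _ _ _ (fun x => x ^+ 2 - y ^+ 2) f); last exact: cf.
exact: derive_cont (is_derive_sqrBx y) z.
Qed.

Lemma cont_compy (f : R -> R) x : continuous f -> continuous (fun y => f (x ^+ 2 - y ^+ 2)).
Proof.
move=> cf z; apply: (@continuous_comp _ _ _ (fun y => x ^+ 2 - y ^+ 2) f); last exact: cf.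
exact: derive_cont (is_derive_sqrBy x) z.
Qed.

Lemma int_subst_sqr (h : R -> R) (s x : R) : continuous h -> 0 <= s -> s <= x ->
  \int[mu]_(y in `[s, x]) (h (y ^+ 2 - s ^+ 2) * (2 * y)) =
  \int[mu]_(v in `[0, (x ^+ 2 - s ^+ 2)]) h v.
Proof.
move=> ch s0; rewrite le_eqVlt => /predU1P[<-|sx]; first by rewrite subrr !int_xx.
have [H dH] := @cont_antiderivative R h (-1) ch.
have N1 z : 0 <= z -> -1 < z :> R by move=> z0; rewrite (lt_le_trans _ z0)// ltrN10.
have V0 : 0 < x ^+ 2 - s ^+ 2 by rewrite subr_gt0 ltrXn2r// nnegrE// ltW// (le_lt_trans s0).
have dH0 (z : R) : 0 <= z <= x ^+ 2 - s ^+ 2 -> is_derive z (1 : R) H (h z).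
  by move=> /andP[z0 _]; exact/dH/N1.
have dsq (z : R) : is_derive z (1 : R) (fun y => y ^+ 2 - s ^+ 2) (2 * z).
  by rewrite -[X in is_derive _ _ _ X]subr0; apply: is_deriveB; exact: is_derive_sqr.
have dHx (z : R) : s <= z <= x ->
  is_derive z (1 : R) (fun y => H (y ^+ 2 - s ^+ 2)) (h (z ^+ 2 - s ^+ 2) * (2 * z)).
  move=> /andP[sz zx]; apply: is_derive_comp1 => //.
  by apply/dH/N1; rewrite subr_ge0 lerXn2r// nnegrE// (le_trans s0).
rewrite (FTC2_loc V0 dH0); last by move=> z _; exact: ch.
rewrite (FTC2_loc sx dHx); first by rewrite subrr.
have cc := @cont_compx h s ch.
move=> z _; apply: cvgM; first exact: cc.
by apply: cvgM; [exact: cvg_cst|exact: cvg_id].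
Qed.

Lemma is_derive_gk la x y : is_derive x (1 : R) (gk la ^~ y) (gkx la x y).
Proof.
apply: (is_derive_eq (is_deriveMr (is_derive_id x 1) (is_derive_compx (is_derive_phi la) y x))).
by rewrite /gkx; ring.
Qed.

Lemma is_derive_gkx la x y : is_derive x (1 : R) (gkx la ^~ y) (gkxx la x y).
Proof.
have d2 : is_derive x (1 : R) (fun x => 2 * x ^+ 2) (4 * x).
  apply: (is_derive_eq (is_deriveMr (is_derive_cst (2 : R) x 1) (is_derive_sqr x))).
  by rewrite /cst; ring.
apply: (is_derive_eq (is_deriveDr (is_derive_compx (is_derive_phi la) y x)
  (is_deriveMr d2 (is_derive_compx (is_derive_dphi la) y x)))).
by rewrite /gkxx; ring.
Qed.

Lemma is_derive_gky la x y : is_derive y (1 : R) (gk la x) (gky la x y).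
Proof.
apply: (is_derive_eq (is_deriveMr (is_derive_cst x y 1) (is_derive_compy (is_derive_phi la) x y))).
by rewrite /gky /cst; ring.
Qed.

Lemma is_derive_gkyy la x y : is_derive y (1 : R) (gky la x) (gkyy la x y).
Proof.
have d2 : is_derive y (1 : R) (fun y => - 2 * x * y) (- 2 * x).
  apply: (is_derive_eq (is_deriveMr (is_derive_cst (- 2 * x) y 1) (is_derive_id y 1))).
  by rewrite /cst; ring.
rewrite (_ : gky la x = (fun y => - 2 * x * y * dphi la (x ^+ 2 - y ^+ 2))); last first.
  by apply/funext => z; rewrite /gky; ring.
apply: (is_derive_eq (is_deriveMr d2 (is_derive_compy (is_derive_dphi la) x y))).
by rewrite /gkyy; ring.
Qed.

Let cid : continuous (fun x : R => x). Proof. by move=> x; exact: cvg_id. Qed.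
Let ccst (k : R) : continuous (fun _ : R => k).
Proof. by move=> x; exact: cvg_cst. Qed.
Let cM (f g : R -> R) : continuous f -> continuous g -> continuous (fun x => f x * g x).
Proof. by move=> cf cg x; apply: cvgM; [exact: cf|exact: cg]. Qed.
Let cD (f g : R -> R) : continuous f -> continuous g -> continuous (fun x => f x + g x).
Proof. by move=> cf cg x; apply: cvgD; [exact: cf|exact: cg]. Qed.
Let cX (f : R -> R) n : continuous f -> continuous (fun x => f x ^+ n).
Proof.
move=> cf; elim: n => [|n IH]; first by under eq_fun do rewrite expr0; exact: ccst.
by under eq_fun do rewrite exprS; exact: cM.
Qed.

Lemma cont_gkyy la x : continuous (gkyy la x).
Proof.
rewrite /gkyy.
have -> : (fun y => - (2 * x * dphi la (x ^+ 2 - y ^+ 2)) +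
    4 * x * y ^+ 2 * ddphi la (x ^+ 2 - y ^+ 2)) =
  (fun y => - (2 * x) * dphi la (x ^+ 2 - y ^+ 2) +
    4 * x * y ^+ 2 * ddphi la (x ^+ 2 - y ^+ 2)).
  by apply/funext => y; ring.
apply: cD; apply: cM.
- exact: ccst.
- apply: (@cont_compy (dphi la)); exact: cont_dphi.
- by apply: cM; [exact: ccst|exact: cX].
- apply: (@cont_compy (ddphi la)); exact: cont_ddphi.
Qed.

Lemma cont_gkxx la y : continuous (gkxx la ^~ y).
Proof.
apply: cD; apply: cM.
- by apply: cM; [exact: ccst|exact: cid].
- apply: (@cont_compx (dphi la)); exact: cont_dphi.
- by apply: cM; [exact: ccst|exact: cX].
- apply: (@cont_compx (ddphi la)); exact: cont_ddphi.
Qed.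

Lemma cont_gkx1 la x : continuous (gkx la x).
Proof.
apply: cD; first by apply: (@cont_compy (phi la)); exact: cont_phi.
apply: cM; first exact: ccst.
apply: (@cont_compy (dphi la)); exact: cont_dphi.
Qed.

Lemma measurable_diffsq (f : R -> R) : continuous f ->
  measurable_fun [set: R * R] (fun p => f (p.1 ^+ 2 - p.2 ^+ 2)).
Proof.
move=> cf; apply: (@measurableT_comp _ _ _ _ _ _ f).
  exact: continuous_measurable_fun.
by apply: measurable_funB; apply: measurable_funX.
Qed.

Lemma measurable_gkx la : measurable_fun [set: R * R] (fun p => gkx la p.1 p.2).
Proof.
apply: measurable_funD; first by apply: measurable_diffsq; exact: cont_phi.
apply: measurable_funM; last by apply: measurable_diffsq; exact: cont_dphi.
by apply: measurable_funM => //; exact: measurable_funX.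
Qed.

Lemma measurable_gk la : measurable_fun [set: R * R] (fun p => gk la p.1 p.2).
Proof.
by apply: measurable_funM => //; apply: measurable_diffsq; exact: cont_phi.
Qed.

Lemma measurable_gkxx la : measurable_fun [set: R * R] (fun p => gkxx la p.1 p.2).
Proof.
apply: measurable_funD.
  apply: measurable_funM; last by apply: measurable_diffsq; exact: cont_dphi.
  by apply: measurable_funM.
apply: measurable_funM; last by apply: measurable_diffsq; exact: cont_ddphi.
by apply: measurable_funM => //; exact: measurable_funX.
Qed.

Lemma tri_sq x y : 0 <= y -> y <= x -> x <= 1 -> 0 <= x ^+ 2 - y ^+ 2 <= 1.
Proof.
move=> y0 yx x1; have x0 := le_trans y0 yx.
rewrite subr_ge0 lerXn2r ?nnegrE//= lerBlDr (le_trans (exprn_ile1 _ x0 x1))//.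
by rewrite lerDl exprn_ge0.
Qed.

Lemma gk_bound la : exists C, forall x y, 0 <= y -> y <= x -> x <= 1 ->
  [/\ `|gk la x y| <= C, `|gkx la x y| <= C & `|gkxx la x y| <= C].
Proof.
have [_ [a aP]] := cont_bmeas (@cont_phi R la).
have [_ [b bP]] := cont_bmeas (@cont_dphi R la).
have [_ [d dP]] := cont_bmeas (@cont_ddphi R la).
exists (a + 6 * b + 4 * d) => x y y0 yx x1.
have t := tri_sq y0 yx x1; have x0 := le_trans y0 yx.
have := aP _ t; have := bP _ t; have := dP _ t.
rewrite /gk /gkx /gkxx.
move: (phi la _) (dphi la _) (ddphi la _) => p q r hr hq hp.
have p0 := normr_ge0 p; have q0 := normr_ge0 q; have r0 := normr_ge0 r.
have h2 : x ^+ 2 <= 1 by rewrite exprn_ile1.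
have h3 : x ^+ 3 <= 1 by rewrite exprn_ile1.
have h20 : 0 <= x ^+ 2 by rewrite exprn_ge0.
have h30 : 0 <= x ^+ 3 by rewrite exprn_ge0.
have key (t' u U : R) : 0 <= t' -> t' <= 1 -> 0 <= u -> u <= U -> t' * u <= U.
  by move=> t0 t1 u0 uU; rewrite -[U]mul1r ler_pM.
have k1 := key _ _ _ x0 x1 p0 hp.
have k2 := key _ _ _ h20 h2 q0 hq.
have k3 := key _ _ _ x0 x1 q0 hq.
have k4 := key _ _ _ h30 h3 r0 hr.
have b0 := le_trans q0 hq; have d0 := le_trans r0 hr.
split.
- by rewrite normrM (ger0_norm x0); lra.
- rewrite (le_trans (ler_normD _ _))// normrM (ger0_norm (mulr_ge0 (ler0n R 2) h20)).
  by rewrite -mulrA; lra.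
- rewrite (le_trans (ler_normD _ _))// normrM [X in _ + X]normrM.
  rewrite (ger0_norm (mulr_ge0 (ler0n R 4) h30)) (ger0_norm (mulr_ge0 (ler0n R 6) x0)).
  by rewrite -!mulrA; lra.
Qed.

Lemma cont_gkx_diag la : continuous (fun x => gkx la x x).
Proof.
have -> : (fun x => gkx la x x) = (fun x => phi la 0 + 2 * x ^+ 2 * dphi la 0).
  by apply/funext => x; rewrite /gkx subrr.
apply: cD; first exact: ccst.
by apply: cM; [apply: cM; [exact: ccst|exact: cX]|exact: ccst].
Qed.

Lemma skernel_gk la : skernel (gk la) (gkx la).
Proof.
have [C HC] := gk_bound la.
apply: (@skernel_cont _ _ _ C).
- exact: is_derive_gk.
- move=> y; exact: derive_cont (fun x => is_derive_gkx la x y).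
- exact: measurable_gkx.
- by move=> x y y0 yx x1; have [] := HC _ _ y0 yx x1.
- under eq_fun do rewrite gk_diag.
  by apply: cM; [exact: ccst|exact: cid].
- move=> x; exact: derive_cont (is_derive_gky la x).
Qed.

Lemma skernel_gkx la : skernel (gkx la) (gkxx la).
Proof.
have [C HC] := gk_bound la.
apply: (@skernel_cont _ _ _ C).
- exact: is_derive_gkx.
- exact: cont_gkxx.
- exact: measurable_gkxx.
- by move=> x y y0 yx x1; have [] := HC _ _ y0 yx x1.
- exact: cont_gkx_diag.
- exact: cont_gkx1.
Qed.

(** The substitution v = y^2 - s^2 turns the composition of the two kernels into
    the convolution of phi_conv. *)
Lemma gk_comp la x s : 0 <= s -> s <= x -> x <= 1 ->
  \int[mu]_(y in `[s, x]) (- gk la y s * gk (- la) x y) =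
  gk (- la) x s + gk la x s.
Proof.
move=> s0 sx x1; have t := tri_sq s0 sx x1.
pose h v := phi (- la) (x ^+ 2 - s ^+ 2 - v) * phi la v.
have ch : continuous h.
  apply: cM; last exact: cont_phi.
  exact: (@cont_rev R (phi (- la)) (x ^+ 2 - s ^+ 2) (@cont_phi R (- la))).
have := phi_conv (- la) t; rewrite opprK.
rewrite -(int_subst_sqr ch s0 sx) /gk -mulrDr [phi (- la) _ + _]addrC => ->.
have cu : continuous (fun y => h (y ^+ 2 - s ^+ 2) * (2 * y)).
  apply: cM; last by apply: cM; [exact: ccst|exact: cid].
  by apply: (@cont_compx h).
rewrite mulrN -mulNr mulrA -intZ//; last exact: bmeas_intg (cont_bmeas cu).
apply: eq_int => y _; rewrite /h.
rewrite (_ : x ^+ 2 - s ^+ 2 - (y ^+ 2 - s ^+ 2) = x ^+ 2 - y ^+ 2); last by ring.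
by field.
Qed.

(** With q = - gk la and l = gk (- la): since int l v = int q w, the function w is
    v + int l v, and the kernel l inverts the second transformation. Exchanging
    the integrals reduces the claim to gk_comp. *)
Lemma gk_inverse la (w v : R -> R) : intg w ->
  (forall x, 0 <= x <= 1 -> v x = w x - \int[mu]_(y in `[0, x]) (- gk la x y * w y)) ->
  forall x, 0 <= x <= 1 -> \int[mu]_(y in `[0, x]) (gk (- la) x y * v y) =
     \int[mu]_(y in `[0, x]) (- gk la x y * w y).
Proof.
move=> Iw vw x /andP[x0 x1].
have [C HC] := gk_bound la.
have bl : bmeas (gk (- la) x).
  by apply: cont_bmeas; exact: derive_cont (is_derive_gky (- la) x).
have bq : bmeas (gk la x).
  by apply: cont_bmeas; exact: derive_cont (is_derive_gky la x).
have mH : measurable_fun [set: R * R] (fun p => - gk la p.1 p.2).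
  by apply: measurableT_comp => //; exact: measurable_gk.
have HC' y s : 0 <= s -> s <= y -> y <= 1 ->
   `|(fun p : R * R => - gk la p.1 p.2) (y, s)| <= C.
  by move=> s0 sy y1; rewrite normrN; have [] := HC _ _ s0 sy y1.
have x01 : 0 <= x <= 1 by rewrite x0.
have := tri_fubini_x (bmeas_intg bl) Iw mH HC' x01.
have I1 := intgM bl Iw.
have I2 := @tri_intg1 R _ _ _ _ (bmeas_intg bl) Iw mH HC'.
have -> : \int[mu]_(y in `[0, x]) (gk (- la) x y * v y) =
   \int[mu]_(y in `[0, x]) (gk (- la) x y * w y) -
   \int[mu]_(y in `[0, x]) (gk (- la) x y *
       \int[mu]_(s in `[0, y]) ((- gk la (y, s).1 (y, s).2) * w s)).
  rewrite -intB//; apply: eq_int => y /andP[y0 yx].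
  by rewrite vw ?y0 ?(le_trans yx)//= mulrBr.
move=> ->.
have -> : \int[mu]_(s in `[0, x])
    (\int[mu]_(y in `[s, x]) (- gk la (y, s).1 (y, s).2 * gk (- la) x y) * w s) =
  \int[mu]_(s in `[0, x]) (gk (- la) x s * w s + gk la x s * w s).
  by apply: eq_int => s /andP[s0 sx]; rewrite /= gk_comp// mulrDl.
rewrite intD//; last exact: intgM.
rewrite opprD addNKr -intN//; last exact: intgM.
by apply: eq_int => y _; rewrite mulNr.
Qed.

(** The density is bounded, hence in L^2, so that the trace inequality applies
    to the derivative of the Volterra integral. *)
Lemma gk_deriv_bmeas la (w w1 : R -> R) : ac w w1 -> bmeas w1 ->
  exists2 d1 : R -> R, bmeas d1 &
  ac (fun x => gk la x x * w x + \int[mu]_(y in `[0, x]) (gkx la x y * w y)) d1.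
Proof.
move=> aw bw1; have bw := ac_bmeas aw.
have a1 : ac (fun x => gk la x x) (fun=> la / 2 * 1).
  by apply: eq_ac (acZ (la / 2) (@ac_idfun R)) => // x _; rewrite gk_diag.
have a2 := ac_volterra (skernel_gkx la) (bmeas_intg bw).
have [C HC] := gk_bound la.
eexists; last exact: (acD (acM a1 aw) a2).
have cd := @cont_gkx_diag la.
apply: bmeasD; first apply: bmeasD; first exact: bmeasZ.
  by apply: bmeasM => //; exact: ac_bmeas a1.
apply: bmeasD; first by apply: bmeasM => //; exact: cont_bmeas.
apply: (@int_volterra_bmeas _ _ _ C) => //.
- exact: bmeas_intg.
- exact: measurable_gkxx.
- by move=> x y y0 yx x1; have [] := HC _ _ y0 yx x1.
Qed.

(** The two sides are the derivatives at 1 of the equal functions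
    x |-> int q w and x |-> int l v. Both have absolutely continuous
    derivatives, whose difference therefore vanishes everywhere and not only
    almost everywhere. *)
Lemma gk_trace la (w w1 v : R -> R) : ac w w1 -> bmeas w1 ->
  (forall x, 0 <= x <= 1 -> v x = w x - \int[mu]_(y in `[0, x]) (- gk la x y * w y)) ->
  - gk la 1 1 * w 1 + \int[mu]_(y in `[0, 1]) (- gkx la 1 y * w y) =
  gk (- la) 1 1 * v 1 + \int[mu]_(y in `[0, 1]) (gkx (- la) 1 y * v y).
Proof.
move=> aw bw1 vw.
have bw := ac_bmeas aw; have Iw := bmeas_intg bw.
have aQ := ac_volterra (skernel_gk la) Iw.
have [q1 bq1 aq1] := gk_deriv_bmeas la aw bw1.
have bq x : bmeas (gk la x).
  by apply: cont_bmeas; exact: derive_cont (is_derive_gky la x).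
have bqx x : bmeas (gkx la x) by apply: cont_bmeas; exact: cont_gkx1.
have av : ac v (fun x => w1 x + (gk la x x * w x + \int[mu]_(y in `[0, x]) (gkx la x y * w y))).
  apply: eq_ac (acD aw aQ) => // x /[dup] x01 /andP[x0 x1]; rewrite vw//.
  rewrite -intN//; last by apply: intgM => //; exact: bmeasN.
  by congr (_ + _); apply: eq_int => y _; rewrite mulNr opprK.
have bv1 := bmeasD bw1 (ac_bmeas aq1).
have Iv := ac_intg av.
have aL := ac_volterra (skernel_gk (- la)) Iv.
have [l1 bl1 al1] := gk_deriv_bmeas (- la) av bv1.
pose d x := (gk (- la) x x * v x + \int[mu]_(y in `[0, x]) (gkx (- la) x y * v y)) +
   (gk la x x * w x + \int[mu]_(y in `[0, x]) (gkx la x y * w y)).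
have ad : ac d (fun x => l1 x + q1 x) by exact: acD.
have a0 : ac (fun=> 0) d.
  apply: eq_ac (acD aL aQ) => // x /[dup] x01 /andP[x0 x1].
  rewrite (gk_inverse Iw vw x01).
  have -> : \int[mu]_(y in `[0, x]) (- gk la x y * w y) =
     - \int[mu]_(y in `[0, x]) (gk la x y * w y).
    by rewrite -intN//; [apply: eq_int => y _; rewrite mulNr|exact: intgM].
  by rewrite addNr.
(* d is a density of the zero function: test it against itself *)
have : L2norm d = 0.
  apply/eqP; rewrite -sqrf_eq0 L2normE; apply/eqP.
  have E := ac_int (acM a0 ad) (lexx 0) ler01 (lexx 1).
  rewrite !mul0r subrr in E; rewrite -[RHS]E; apply: eq_int => x _.
  by rewrite mul0r addr0 expr2.
move=> d0; have := agmon1 ad (bmeas_L2 (bmeasD bl1 bq1)).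
rewrite d0 expr0n/= mul0r mulr0 addr0 => dle.
have /eqP : d 1 = 0 by apply/eqP; rewrite -sqrf_eq0 eq_le dle sqr_ge0.
rewrite /d addr_eq0 => /eqP ->; rewrite mulNr opprD; congr (_ + _).
by rewrite -intN//; [apply: eq_int => y _; rewrite mulNr|exact: intgM].
Qed.

Lemma I1_quotE (w : R) : I1_quot w = bes0 w.
Proof.
congr (limn (series _)); apply/funext => k /=.
rewrite /bes_coef exprMn exprVn.
have f0 : k`!%:R != 0 :> R by rewrite pnatr_eq0 -lt0n fact_gt0.
have f1 : k.+1`!%:R != 0 :> R by rewrite pnatr_eq0 -lt0n fact_gt0.
have p0 : 4 ^+ k != 0 :> R by rewrite expf_neq0// pnatr_eq0.
by field; rewrite f0 f1 p0.
Qed.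

Lemma J1_quotE (w : R) : J1_quot w = bes0 (- w).
Proof.
rewrite -I1_quotE; congr (limn (series _)); apply/funext => k.
by rewrite -exprMn; congr (_ ^+ _ / _); ring.
Qed.

Lemma q_kerE a c x y : q_ker a c x y = - gk (a + c) x y.
Proof. by rewrite /q_ker I1_quotE /gk /phi; ring. Qed.

Lemma l_kerE a c x y : l_ker a c x y = gk (- (a + c)) x y.
Proof. by rewrite /l_ker J1_quotE /gk /phi -mulNr; ring. Qed.

Lemma partial1_qE a c x y : partial1 (q_ker a c) x y = - gkx (a + c) x y.
Proof.
rewrite /partial1 derive1E.
rewrite (_ : (q_ker a c ^~ y) = (fun x => - gk (a + c) x y)); last first.
  by apply/funext => z; rewrite q_kerE.
by have := is_deriveN (is_derive_gk (a + c) x y) => d; exact: derive_val.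
Qed.

Lemma partial1_lE a c x y : partial1 (l_ker a c) x y = gkx (- (a + c)) x y.
Proof.
rewrite /partial1 derive1E.
rewrite (_ : (l_ker a c ^~ y) = (fun x => gk (- (a + c)) x y)); last first.
  by apply/funext => z; rewrite l_kerE.
by have := is_derive_gk (- (a + c)) x y => d; exact: derive_val.
Qed.

End QLKernels.

(** * The first transformation as a linear differential equation *)

Section RowFunctional.
Context {R : realType} (m : nat) (M : 'M[R]_m).
Local Notation mu := (@lebesgue_measure R).
Implicit Types (L : 'rV[R]_m) (b e : 'cV[R]_m) (u : R -> R) (x y : R).

Lemma row_emxE L b x : (L *m emx M x *m b) 0 0 =
  \sum_(l <- index_enum 'I_m) L 0 l * (emx M x *m b) l 0.
Proof. by rewrite -mulmxA mxE. Qed.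

Lemma is_derive_row_emx L b x : is_derive x (1 : R)
  (fun x => (L *m emx M x *m b) 0 0) ((L *m M *m emx M x *m b) 0 0).
Proof.
rewrite (_ : (fun x => _) =
  (fun x => \sum_(l <- index_enum 'I_m) L 0 l * (emx M x *m b) l 0)); last first.
  by apply/funext => y; exact: row_emxE.
apply: (is_derive_eq (@is_derive_mulmx_sum _ _ (index_enum 'I_m) (fun l => L 0 l)
  (fun l x => (emx M x *m b) l 0) (fun l x => (M *m emx M x *m b) l 0) x
  (fun l => is_derive_emxv M b l x))).
have -> : L *m M *m emx M x *m b = L *m (M *m emx M x *m b) by rewrite !mulmxA.
by rewrite [RHS]mxE.
Qed.

Lemma cont_row_emx L b : continuous (fun x => (L *m emx M x *m b) 0 0).
Proof. exact: derive_cont (is_derive_row_emx L b). Qed.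

Lemma row_sol L b e u x : intg u -> 0 <= x <= 1 ->
  (L *m sol M b e u x) 0 0 = (L *m emx M x *m b) 0 0 +
    \int[mu]_(y in `[0, x]) ((L *m emx M (x - y) *m e) 0 0 * u y).
Proof.
move=> Iu /andP[x0 x1]; rewrite /sol mulmxDr mxE mulmxA; congr (_ + _).
have h (r : seq 'I_m) :
   intg (fun y => (\sum_(l <- r) L 0 l * (emx M (x - y) *m e) l 0) * u y) /\
   \int[mu]_(y in `[0, x]) ((\sum_(l <- r) L 0 l * (emx M (x - y) *m e) l 0) * u y) =
   \sum_(l <- r) L 0 l * \int[mu]_(y in `[0, x]) ((emx M (x - y) *m e) l 0 * u y).
  elim: r => [|l r [IH1 IH2]].
    rewrite big_nil; split.
      by apply: eq_intg (intg_cst 0) => y _; rewrite big_nil mul0r.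
    by under eq_Rintegral do rewrite big_nil mul0r; rewrite int_cst// mul0r.
  have Il : intg (fun y => (emx M (x - y) *m e) l 0 * u y).
    by apply: intgM => //; exact: bmeas_emxv_rev.
  split.
    apply: eq_intg (intgD (intgZ (L 0 l) Il) IH1) => y _.
    by rewrite big_cons mulrDl mulrA.
  rewrite big_cons -IH2 -intZ// -intD//; last exact: intgZ.
  by apply: eq_int => y _; rewrite big_cons mulrDl mulrA.
rewrite mxE; transitivity (\sum_(l <- index_enum 'I_m) L 0 l *
    \int[mu]_(y in `[0, x]) ((emx M (x - y) *m e) l 0 * u y)).
  by apply: eq_bigr => l _; rewrite mxE.
rewrite -(h _).2; apply: eq_int => y _; by rewrite row_emxE.
Qed.

Lemma ac_mulmx p (s s1 : R -> 'cV[R]_m) (L : 'M[R]_(p, m)) (i : 'I_p) :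
  (forall l, ac (fun x => s x l 0) (fun x => s1 x l 0)) ->
  ac (fun x => (L *m s x) i 0) (fun x => (L *m s1 x) i 0).
Proof.
move=> ss; have := @ac_sum R _ (index_enum 'I_m) xpredT _ _ (fun l => acZ (L i l) (ss l)).
by apply: eq_ac => x _; rewrite mxE.
Qed.

Lemma row_sol_ac L b e u : intg u -> ac (fun x => (L *m sol M b e u x) 0 0)
  (fun x => (L *m (M *m sol M b e u x + u x *: e)) 0 0).
Proof. by move=> Iu; apply: ac_mulmx => l; exact: sol_ac. Qed.

End RowFunctional.

Section Stage1.
Context {R : realType} {n : nat}.
Local Notation mu := (@lebesgue_measure R).
Variables (B : 'cV[R]_n) (a : R) (K : 'rV[R]_n).
Implicit Types (N : 'M[R]_n) (X : 'cV[R]_n) (u : R -> R) (x y : R).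

(** The companion matrix of the second-order equation p'' = (N - a) p. *)
Definition cmx N : 'M[R]_(n + n) := block_mx 0 (N - a%:M) 1%:M 0.

(** The solution s = (p', p) of p'' = (N - a) p + B u, p(0) = X, p'(0) = 0. The
    first transformation is u - K p, so that its kernels need not be
    manipulated: linear differential equations replace kernel equations. *)
Definition St N X u x : 'cV[R]_(n + n) :=
  sol (cmx N) (col_mx 0 X) (col_mx B 0) u x.

(** K0 reads K p' and K1 reads K p off the state (p', p). *)
Definition K0 : 'rV[R]_(n + n) := row_mx K 0.
Definition K1 : 'rV[R]_(n + n) := row_mx 0 K.

Lemma K1_cmx N : K1 *m cmx N = K0.
Proof. by rewrite mul_row_block !mul0mx mulmx0 mulmx1 !add0r. Qed.

Lemma K0_cmx N : K0 *m cmx N = row_mx 0 (K *m (N - a%:M)).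
Proof. by rewrite mul_row_block !mul0mx mulmx0 !addr0. Qed.

Lemma K1_B : K1 *m col_mx B 0 = 0.
Proof. by rewrite mul_row_col mul0mx mulmx0 addr0. Qed.

Lemma row_kernelE N x : row_kernel a K N x = K1 *m emx (cmx N) x *m col_mx 0 1%:M.
Proof.
rewrite /row_kernel -/(emx (cmx N) x) -/K0 -(K1_cmx N) -[K1 *m _ *m _]mulmxA.
rewrite emx_comm mulmxA -mulmxA; congr (_ *m _).
by rewrite mul_block_col !mulmx0 !mul0mx mulmx1 !addr0.
Qed.

(** The kernels k and n, as functions of x - y. *)
Definition kap N x : R := (K1 *m emx (cmx N) x *m col_mx B 0) 0 0.

Lemma row_kernel_B N x :
  (row_kernel a K N x *m B) 0 0 = (K0 *m emx (cmx N) x *m col_mx B 0) 0 0.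
Proof.
rewrite /row_kernel -/(emx (cmx N) x) -mulmxA; congr ((_ *m _) _ _).
by rewrite mul_col_mx mul1mx mul0mx.
Qed.

Lemma is_derive_kap N x :
  is_derive x (1 : R) (kap N) ((row_kernel a K N x *m B) 0 0).
Proof.
rewrite row_kernel_B -(K1_cmx N).
exact: (is_derive_row_emx (cmx N) K1 (col_mx B 0)).
Qed.

Lemma cont_row_kernel_B N : continuous (fun x => (row_kernel a K N x *m B) 0 0).
Proof.
rewrite (_ : (fun x => _) = (fun x => (K0 *m emx (cmx N) x *m col_mx B 0) 0 0)).
  exact: cont_row_emx.
by apply/funext => x; exact: row_kernel_B.
Qed.

Lemma oriented_intE N s :
  oriented_int (fun s => (row_kernel a K N s *m B) 0 0) s = kap N s.
Proof.
have kap0 : kap N 0 = 0 by rewrite /kap emx0 mulmx1 K1_B mxE.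
rewrite /oriented_int; case: ifPn => [s0|].
  by rewrite (FTC2_C1 (is_derive_kap N) (@cont_row_kernel_B N) s0) kap0 subr0.
rewrite -ltNge => /ltW s0.
by rewrite (FTC2_C1 (is_derive_kap N) (@cont_row_kernel_B N) s0) kap0 sub0r opprK.
Qed.

Lemma is_derive_oriented N x y : is_derive x (1 : R)
  (fun x => oriented_int (fun s => (row_kernel a K N s *m B) 0 0) (x - y))
  ((row_kernel a K N (x - y) *m B) 0 0).
Proof.
rewrite (_ : (fun x => _) = (fun x => kap N (x - y))); last first.
  by apply/funext => z; rewrite oriented_intE.
exact: (@is_derive_shift R (kap N) (fun x => (row_kernel a K N x *m B) 0 0) y x
  (is_derive_kap N)).
Qed.

Lemma drow_kernelE N x j : derive1 (fun s => row_kernel a K N s 0 j) x =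
  (K0 *m emx (cmx N) x *m col_mx 0 1%:M) 0 j.
Proof.
rewrite derive1E.
have E (L : 'rV_(n + n)) s : (L *m emx (cmx N) s *m col_mx 0 1%:M) 0 j =
   (L *m emx (cmx N) s *m col j (col_mx 0 1%:M)) 0 0.
  by rewrite colE mulmxA -colE [RHS]mxE.
rewrite (_ : (fun s => _) =
  (fun s => (K1 *m emx (cmx N) s *m col j (col_mx 0 1%:M)) 0 0)); last first.
  by apply/funext => s; rewrite row_kernelE E.
have d := is_derive_row_emx (cmx N) K1 (col j (col_mx 0 1%:M)) x.
by rewrite K1_cmx -E in d; exact: derive_val.
Qed.

Lemma K1_St N X u x : intg u -> 0 <= x <= 1 ->
  (K1 *m St N X u x) 0 0 = (row_kernel a K N x *m X) 0 0 +
  \int[mu]_(y in `[0, x]) (oriented_int (fun s => (row_kernel a K N s *m B) 0 0) (x - y) * u y).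
Proof.
move=> Iu x01; rewrite row_sol//; congr (_ + _).
  by rewrite row_kernelE -[_ *m X]mulmxA mul_col_mx mul0mx mul1mx.
by apply: eq_int => y _; rewrite oriented_intE.
Qed.

Lemma K0_St N X u x : intg u -> 0 <= x <= 1 ->
  (K0 *m St N X u x) 0 0 =
  ((\row_j derive1 (fun s => row_kernel a K N s 0 j) x) *m X) 0 0 +
  \int[mu]_(y in `[0, x]) ((row_kernel a K N (x - y) *m B) 0 0 * u y).
Proof.
move=> Iu x01; rewrite row_sol//; congr (_ + _).
  rewrite (_ : \row_j _ = K0 *m emx (cmx N) x *m col_mx 0 1%:M).
    by rewrite -[_ *m X]mulmxA mul_col_mx mul0mx mul1mx.
  by apply/rowP => j; rewrite mxE drow_kernelE.
by apply: eq_int => y _; rewrite row_kernel_B.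
Qed.

Lemma K1_St_ac N X u : intg u ->
  ac (fun x => (K1 *m St N X u x) 0 0) (fun x => (K0 *m St N X u x) 0 0).
Proof.
move=> Iu; apply: eq_ac (row_sol_ac (cmx N) K1 (col_mx 0 X) (col_mx B 0) Iu) => // x _.
by rewrite mulmxDr mulmxA K1_cmx -scalemxAr K1_B scaler0 addr0.
Qed.

Lemma K0_St_ac N X u : intg u ->
  ac (fun x => (K0 *m St N X u x) 0 0)
     (fun x => (row_mx 0 (K *m (N - a%:M)) *m St N X u x) 0 0 + u x * (K *m B) 0 0).
Proof.
move=> Iu; apply: eq_ac (row_sol_ac (cmx N) K0 (col_mx 0 X) (col_mx B 0) Iu) => // x _.
rewrite mulmxDr mulmxA K0_cmx -scalemxAr mxE; congr (_ + _).
by rewrite mul_row_col mul0mx addr0 mxE.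
Qed.

Lemma St0 N X u : St N X u 0 = col_mx 0 X.
Proof. exact: sol_at0. Qed.

Lemma St_ac N X u i : intg u ->
  ac (fun x => St N X u x i 0) (fun x => (cmx N *m St N X u x + u x *: col_mx B 0) i 0).
Proof. exact: sol_ac. Qed.

(** The lower half p of the state solves p'' = (A - a) p + B u; closing the
    loop u = w + K p turns A into A + B K without changing p. This inverts the
    first transformation. *)
Lemma St_closed_loop (A : 'M[R]_n) X u x : intg u -> 0 <= x <= 1 ->
  St A X u x = St (A + B *m K) X (fun x => u x - (K1 *m St A X u x) 0 0) x.
Proof.
move=> Iu x01.
have Iw : intg (fun x => u x - (K1 *m St A X u x) 0 0).
  by apply: intgB => //; exact: ac_intg (K1_St_ac A X Iu).
have := @sol_uniq R _ (cmx (A + B *m K)) (St A X u) (col_mx B 0) _ Iw.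
rewrite St0; apply => // i; apply: eq_ac (St_ac A X i Iu) => // y _.
congr (fun_of_matrix _ i 0).
rewrite -[St A X u y]vsubmxK; set p := usubmx _; set q := dsubmx _.
rewrite !mul_block_col !scale_col_mx !add_col_mx !mul0mx !add0r !scaler0 !addr0.
congr col_mx; rewrite mul_row_col mul0mx add0r.
rewrite !mulmxDl -mulmxA scalerBl.
have -> : B *m (K *m q) = (K *m q) 0 0 *: B.
  by rewrite {1}[K *m q]mx11_scalar mul_mx_scalar.
move: (A *m q) (- a%:M *m q) ((K *m q) 0 0) => V W k.
by apply/matrixP => i' j'; rewrite !mxE; ring.
Qed.

(** Along the plant X' = A X + B u(0), u_t = u'' + a u, the solution p moves with
    velocity A p + B u: that function solves the differential equation with the
    velocities as data, by u'(0) = 0, and the solution is unique. *)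
Lemma St_pde (A : 'M[R]_n) X u u1 u2 x : ac u u1 -> ac u1 u2 -> u1 0 = 0 ->
  0 <= x <= 1 ->
  St A (A *m X + u 0 *: B) (fun x => u2 x + a * u x) x =
  col_mx (A *m usubmx (St A X u x) + u1 x *: B)
         (A *m dsubmx (St A X u x) + u x *: B).
Proof.
move=> au au1 u10 x01; have Iu := ac_intg au.
have If : intg (fun x => u2 x + a * u x) by apply: intgD; [case: au1|exact: intgZ].
pose s x : 'cV[R]_(n + n) := col_mx (A *m usubmx (St A X u x) + u1 x *: B)
         (A *m dsubmx (St A X u x) + u x *: B).
have s0 : s 0 = col_mx 0 (A *m X + u 0 *: B).
  by rewrite /s St0 col_mxKu col_mxKd u10 mulmx0 scale0r addr0.
rewrite -/(s x) /St -s0; apply/esym; apply: sol_uniq => // i.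
have aS i' := St_ac A X i' Iu.
have aU (l : 'I_n) : ac (fun x => usubmx (St A X u x) l 0)
   (fun x => usubmx (cmx A *m St A X u x + u x *: col_mx B 0) l 0).
  by apply: eq_ac (aS (lshift n l)) => y _; rewrite [RHS]mxE.
have aD (l : 'I_n) : ac (fun x => dsubmx (St A X u x) l 0)
   (fun x => dsubmx (cmx A *m St A X u x + u x *: col_mx B 0) l 0).
  by apply: eq_ac (aS (rshift n l)) => y _; rewrite [RHS]mxE.
have E y : cmx A *m St A X u y + u y *: col_mx B 0 =
   col_mx ((A - a%:M) *m dsubmx (St A X u y) + u y *: B) (usubmx (St A X u y)).
  rewrite -{1}[St A X u y]vsubmxK mul_block_col scale_col_mx add_col_mx.
  by rewrite !mul0mx mul1mx add0r scaler0 !addr0.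
have [k ->|k ->] := split_ordP i.
  have := acD (ac_mulmx A k aU) (acZ (B k 0) au1).
  apply: eq_ac => y _.
    by rewrite /s col_mxEu [RHS]mxE; congr (_ + _); rewrite mxE mulrC.
  rewrite E col_mxKu /s mul_block_col scale_col_mx add_col_mx col_mxEu.
  rewrite mul0mx add0r.
  have -> : A *m ((A - a%:M) *m dsubmx (St A X u y) + u y *: B) =
     A *m (A *m dsubmx (St A X u y)) - a *: (A *m dsubmx (St A X u y)) + u y *: (A *m B).
    by rewrite mulmxDr mulmxBl mulmxBr mul_scalar_mx -!scalemxAr.
  have -> : (A - a%:M) *m (A *m dsubmx (St A X u y) + u y *: B) =
     A *m (A *m dsubmx (St A X u y)) - a *: (A *m dsubmx (St A X u y)) +
     (u y *: (A *m B) - (a * u y) *: B).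
    by rewrite mulmxDr !mulmxBl !mul_scalar_mx -scalemxAr scalerA addrACA.
  move: (dsubmx (St A X u y)) => q; move: (A *m q) (A *m B) => W U.
  move: (A *m W) => V.
  by rewrite !mxE; ring.
have := acD (ac_mulmx A k aD) (acZ (B k 0) au).
apply: eq_ac => y _.
  by rewrite /s col_mxEd [RHS]mxE; congr (_ + _); rewrite mxE mulrC.
rewrite E col_mxKd /s mul_block_col scale_col_mx add_col_mx col_mxEd.
by rewrite scaler0 addr0 mul0mx addr0 mul1mx [RHS]mxE; congr (_ + _); rewrite mxE mulrC.
Qed.

End Stage1.

(** * Euclidean norms and quadratic forms *)

Section Euclid.
Context {R : realType}.

Lemma enorm_ge0 m n (M : 'M[R]_(m, n)) : 0 <= enorm M.
Proof. exact: sqrtr_ge0. Qed.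
Hint Resolve enorm_ge0 : core.

Lemma sqr_enorm m n (M : 'M[R]_(m, n)) :
  enorm M ^+ 2 = \sum_i \sum_j M i j ^+ 2.
Proof.
rewrite sqr_sqrtr// sumr_ge0// => i _; rewrite sumr_ge0// => j _; exact: sqr_ge0.
Qed.

Lemma sqr_enorm_cV n (v : 'cV[R]_n) : enorm v ^+ 2 = \sum_i v i 0 ^+ 2.
Proof. by rewrite sqr_enorm; apply: eq_bigr => i _; rewrite big_ord1. Qed.

Lemma sqr_enorm_rV n (v : 'rV[R]_n) : enorm v ^+ 2 = \sum_i v 0 i ^+ 2.
Proof. by rewrite sqr_enorm big_ord1. Qed.

Lemma sqr_enorm_dot n (v : 'cV[R]_n) : enorm v ^+ 2 = (v^T *m v) 0 0.
Proof.
by rewrite sqr_enorm_cV mxE; apply: eq_bigr => i _; rewrite mxE expr2.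
Qed.

Lemma sum_CS (I : finType) (f g : I -> R) :
  (\sum_i f i * g i) ^+ 2 <= (\sum_i f i ^+ 2) * (\sum_i g i ^+ 2).
Proof.
set A := \sum_i f i ^+ 2; set B := \sum_i g i ^+ 2; set S := \sum_i f i * g i.
have A0 : 0 <= A by apply: sumr_ge0 => i _; exact: sqr_ge0.
have : 0 <= \sum_i (A * g i - S * f i) ^+ 2 by apply: sumr_ge0 => i _; exact: sqr_ge0.
have -> : \sum_i (A * g i - S * f i) ^+ 2 = A * (A * B - S ^+ 2).
  transitivity (\sum_i (A ^+ 2 * g i ^+ 2 + ((- 2 * A * S) * (f i * g i) +
      S ^+ 2 * f i ^+ 2))); first by apply: eq_bigr => i _; ring.
  rewrite !big_split /= -!mulr_sumr -/A -/B -/S; ring.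
move: A0; rewrite le_eqVlt => /predU1P[A0 _|A0]; last by rewrite pmulr_rge0// subr_ge0.
have f0 i : f i = 0.
  have /psumr_eq0P h : \sum_i f i ^+ 2 = 0 by [].
  by apply/eqP; rewrite -sqrf_eq0; apply/eqP; apply: h => // j _; exact: sqr_ge0.
have -> : S = 0 by rewrite /S big1// => i _; rewrite f0 mul0r.
by rewrite expr0n/= -A0 mul0r.
Qed.

Lemma enorm_dot n (r : 'rV[R]_n) (v : 'cV[R]_n) : `|(r *m v) 0 0| <= enorm r * enorm v.
Proof.
rewrite -(@ler_pXn2r _ 2)// ?nnegrE ?mulr_ge0// exprMn real_normK ?num_real//.
by rewrite sqr_enorm_cV sqr_enorm_rV mxE; exact: sum_CS.
Qed.

Lemma enormZ m n c (M : 'M[R]_(m, n)) : enorm (c *: M) = `|c| * enorm M.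
Proof.
apply/eqP; rewrite -(@eqrXn2 _ 2)// ?mulr_ge0//; apply/eqP.
rewrite exprMn !sqr_enorm real_normK ?num_real// mulr_sumr; apply: eq_bigr => i _.
by rewrite mulr_sumr; apply: eq_bigr => j _; rewrite mxE exprMn.
Qed.

Lemma enorm_trD n (u v : 'cV[R]_n) : enorm (u + v) <= enorm u + enorm v.
Proof.
rewrite -(@ler_pXn2r _ 2)// ?nnegrE ?addr_ge0//.
have -> : enorm (u + v) ^+ 2 = enorm u ^+ 2 + 2 * (u^T *m v) 0 0 + enorm v ^+ 2.
  rewrite !sqr_enorm_cV mxE mulr_sumr -!big_split /=; apply: eq_bigr => i _.
  by rewrite !mxE; ring.
have hT : enorm u^T = enorm u.
  by rewrite /enorm exchange_big /=; congr Num.sqrt; apply: eq_bigr => i _;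
    apply: eq_bigr => j _; rewrite mxE.
have := le_trans (ler_norm _) (enorm_dot u^T v); rewrite hT => h.
rewrite sqrrD; lra.
Qed.

Lemma enorm_coord n (v : 'cV[R]_n) i : `|v i 0| <= enorm v.
Proof.
rewrite -(@ler_pXn2r _ 2)// ?nnegrE// real_normK ?num_real// sqr_enorm_cV.
by rewrite (bigD1 i)//= lerDl sumr_ge0// => j _; exact: sqr_ge0.
Qed.

Lemma sum_coord_le n (v : 'cV[R]_n) : \sum_j `|v j 0| <= n%:R * enorm v.
Proof.
apply: (@le_trans _ _ (\sum_(j < n) enorm v)).
  by apply: ler_sum => j _; exact: enorm_coord.
by rewrite sumr_const card_ord mulr_natl.
Qed.

Lemma enorm_mulmx_bound m n (M : 'M[R]_(m, n)) : exists2 C, 0 <= C &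
  forall v : 'cV_n, enorm (M *m v) <= C * enorm v.
Proof.
exists (enorm M) => // v.
rewrite -(@ler_pXn2r _ 2)// ?nnegrE ?mulr_ge0// exprMn.
rewrite [X in _ <= X * _]sqr_enorm sqr_enorm_cV mulr_suml; apply: ler_sum => i _.
by rewrite mxE sqr_enorm_cV; exact: sum_CS.
Qed.

Lemma quad_expand n (Q : 'M[R]_n) (v : 'cV[R]_n) :
  (v^T *m Q *m v) 0 0 = \sum_i \sum_j v i 0 * Q i j * v j 0.
Proof.
rewrite mxE exchange_big /=; apply: eq_bigr => i _.
by rewrite mxE mulr_suml; apply: eq_bigr => j _; rewrite mxE.
Qed.

(** Compactness of the unit sphere makes positive definiteness uniform. *)
Lemma pd_coercive n (Q : 'M[R]_n) : mx_gt0 Q ->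
  exists2 e : R, 0 < e & forall v : 'cV_n, e * enorm v ^+ 2 <= (v^T *m Q *m v) 0 0.
Proof.
move=> [_ Qpos].
pose sq (v : 'rV[R]_n) : R := \sum_i v 0 i ^+ 2.
pose f (v : 'rV[R]_n) : R := \sum_i \sum_j v 0 i * Q i j * v 0 j.
have csum (F : 'I_n -> 'rV[R]_n -> R) :
    (forall i, continuous (F i)) -> continuous (fun v => \sum_i F i v).
  move=> cF; have h (r : seq 'I_n) : continuous (fun v => \sum_(i <- r) F i v).
    elim: r => [|i r IH].
      have -> : (fun v => \sum_(i <- [::]) F i v) = (fun=> 0).
        by apply/funext => x; rewrite big_nil.
      exact: cst_continuous.
    have -> : (fun v => \sum_(k <- i :: r) F k v) =
        (fun x => F i x + \sum_(i <- r) F i x).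
      by apply/funext => x; rewrite big_cons.
    by move=> v; apply: cvgD; [exact: nbhs_filter|exact: cF|exact: IH].
  exact: h.
have cc i : continuous (fun v : 'rV[R]_n => v 0 i) by exact: coord_continuous.
have csq : continuous sq.
  by apply: (csum) => i v; apply: cvgM; [exact: nbhs_filter|exact: cc|exact: cc].
have cf : continuous f.
  apply: (csum) => i; apply: (csum) => j v.
  apply: cvgM; [exact: nbhs_filter| |exact: cc].
  by apply: cvgM; [exact: nbhs_filter|exact: cc|exact: cst_continuous].
pose A := [set v : 'rV[R]_n | sq v = 1].
have cA : compact A.
  apply: (@subclosed_compact _ _ [set v : 'rV[R]_n | forall i, `[(-1 : R), 1]%classic (v ord0 i)]).
  - rewrite (_ : A = sq @^-1` [set 1])//.
    have /continuous_closedP csq' : continuous (sq : 'rV[R]_n -> R) by exact: csq.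
    apply: csq'; exact: closed_eq.
  - exact: (@rV_compact R n (fun=> `[(-1 : R), 1]%classic) (fun=> @segment_compact R (-1) 1)).
  - move=> v /= sv i; rewrite in_itv/= -ler_norml.
    rewrite -(@ler_pXn2r _ 2)// ?nnegrE// real_normK ?num_real// expr1n -sv.
    by rewrite /sq (bigD1 i)//= lerDl sumr_ge0// => j _; exact: sqr_ge0.
have fE (v : 'cV[R]_n) : (v^T *m Q *m v) 0 0 = f v^T.
  rewrite quad_expand; apply: eq_bigr => i _; apply: eq_bigr => j _.
  by rewrite !mxE.
have sqE (v : 'cV[R]_n) : enorm v ^+ 2 = sq v^T.
  by rewrite sqr_enorm_cV; apply: eq_bigr => i _; rewrite mxE.
have homf c (v : 'rV[R]_n) : f (c *: v) = c ^+ 2 * f v.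
  rewrite /f mulr_sumr; apply: eq_bigr => i _; rewrite mulr_sumr.
  by apply: eq_bigr => j _; rewrite !mxE; ring.
have homsq c (v : 'rV[R]_n) : sq (c *: v) = c ^+ 2 * sq v.
  rewrite /sq mulr_sumr; apply: eq_bigr => i _; rewrite !mxE; ring.
have sq0 v : 0 <= sq v by apply: sumr_ge0 => i _; exact: sqr_ge0.
(* homogeneity reduces the claim to the unit sphere A *)
have red e : 0 < e -> (forall v, A v -> e <= f v) -> forall v : 'cV[R]_n, e * enorm v ^+ 2 <= f v^T.
  move=> e0 he v; rewrite sqE.
  have [s0|s0] := eqVneq (sq v^T) 0.
    rewrite s0 mulr0 -fE.
    have -> : v = 0.
      apply/matrixP => i j; rewrite !ord1 mxE.
      have /psumr_eq0P h : \sum_i (v^T) 0 i ^+ 2 = 0 by exact: s0.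
      have /eqP := h (fun i _ => sqr_ge0 _) i isT.
      by rewrite sqrf_eq0 mxE => /eqP.
    by rewrite mulmx0 mxE.
  have sp : 0 < sq v^T by rewrite lt_neqAle eq_sym s0 sq0.
  pose k := (Num.sqrt (sq v^T))^-1.
  have k2 : k ^+ 2 = (sq v^T)^-1 by rewrite exprVn sqr_sqrtr// ltW.
  have := he (k *: v^T).
  rewrite /A /= homf homsq k2 mulVf// => /(_ erefl).
  by rewrite mulrC ler_pdivlMr.
have [A0|A0] := pselect (A !=set0); last first.
  exists 1 => // v; rewrite fE; apply: red => // u Au.
  by exfalso; apply: A0; exists u.
have [c /set_mem cinA cmin] := compact_EVT_min A0 cA (continuous_subspaceT cf).
have fc : 0 < f c.
  have := Qpos c^T; rewrite fE trmxK; apply.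
  apply/eqP => c0; have : sq c = 0.
    by rewrite -[c]trmxK c0 /sq big1// => i _; rewrite !mxE expr0n.
  by rewrite cinA => /eqP; rewrite oner_eq0.
exists (f c) => // v; rewrite fE; apply: red => // u Au.
by apply: cmin; exact/mem_set.
Qed.

Lemma quad_scalar n (b : R) (v : 'cV[R]_n) : (v^T *m b%:M *m v) 0 0 = b * enorm v ^+ 2.
Proof. by rewrite mul_mx_scalar -scalemxAl mxE sqr_enorm_dot. Qed.

Lemma quadZ n (b : R) (Q : 'M[R]_n) (v : 'cV[R]_n) :
  (v^T *m (b *: Q) *m v) 0 0 = b * (v^T *m Q *m v) 0 0.
Proof. by rewrite -scalemxAr -scalemxAl mxE. Qed.

Lemma mx_ge0_scalar n (P : 'M[R]_n) (b : R) : mx_ge0 (b%:M - P) ->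
  forall v : 'cV_n, (v^T *m P *m v) 0 0 <= b * enorm v ^+ 2.
Proof.
move=> [_ h] v; have := h v; rewrite mulmxBr mulmxBl mxE [X in _ + X]mxE subr_ge0.
by rewrite quad_scalar.
Qed.

Lemma mx_ge0_scalar2 n (P : 'M[R]_n) (k b : R) : mx_ge0 (k *: P - b%:M) ->
  forall v : 'cV_n, b * enorm v ^+ 2 <= k * (v^T *m P *m v) 0 0.
Proof.
move=> [_ h] v; have := h v; rewrite mulmxBr mulmxBl mxE [X in _ + X]mxE subr_ge0.
by rewrite quad_scalar quadZ.
Qed.

End Euclid.
#[export] Hint Resolve enorm_ge0 : core.

(** * The matrix inequalities *)

Section LMI.
Context {R : realType} {n : nat}.

Lemma block_quad n1 n2 (A : 'M[R]_n1) (B : 'M[R]_(n1, n2)) (C : 'M[R]_(n2, n1))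
    (D : 'M[R]_n2) (u : 'cV_n1) (v : 'cV_n2) :
  ((col_mx u v)^T *m block_mx A B C D *m col_mx u v) 0 0 =
  (u^T *m A *m u) 0 0 + (u^T *m B *m v) 0 0 + (v^T *m C *m u) 0 0 + (v^T *m D *m v) 0 0.
Proof.
rewrite tr_col_mx mul_row_block mul_row_col !mulmxDl.
by move: (u^T *m A *m u) (v^T *m C *m u) (u^T *m B *m v) (v^T *m D *m v)
  => E F G H; rewrite !mxE; ring.
Qed.

Lemma tr00 (M : 'M[R]_1) : M^T 0 0 = M 0 0. Proof. by rewrite mxE. Qed.

Variable P : 'M[R]_n.
Hypothesis PT : P^T = P.

Definition bilin (X Y : 'cV[R]_n) : R := (X^T *m P *m Y) 0 0.

Lemma bilinC X Y : bilin X Y = bilin Y X.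
Proof. by rewrite /bilin -tr00 !trmx_mul trmxK PT mulmxA. Qed.

Lemma bilinDr X Y Z : bilin X (Y + Z) = bilin X Y + bilin X Z.
Proof. by rewrite /bilin mulmxDr mxE. Qed.

Lemma bilinZr X c Y : bilin X (c *: Y) = c * bilin X Y.
Proof. by rewrite /bilin -scalemxAr mxE. Qed.

Variables (A A1 : 'M[R]_n) (B : 'cV[R]_n) (a a2 : R) (K : 'rV[R]_n) (c : R).
Variables (d0 d1 lam kp : R).

Lemma Xi_quad (X Y : 'cV[R]_n) (s : R) :
  let v := col_mx (col_mx X Y) s%:M : 'cV_(n + n + 1) in
  (v^T *m (Xi_mx A A1 B K d0 d1 P lam + kp *: R_mx A A1 B a a2 K c) *m v) 0 0 =
  2 * bilin X ((A + B *m K) *m X) + 2 * d0 * bilin X X + 2 * bilin X (A1 *m Y)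
  - 2 * d1 * bilin Y Y + 2 * s * bilin X B - lam * s ^+ 2
  + kp * (zeta A a K c * enorm ((A1 - a2%:M) *m Y) ^+ 2).
Proof.
rewrite /= mulmxDr mulmxDl mxE quadZ.
congr (_ + kp * _).
  rewrite /Xi_mx block_quad block_quad.
  have -> : (X^T *m (P *m (A + B *m K) + (A + B *m K)^T *m P + (2 * d0) *: P) *m X) 0 0 =
     2 * bilin X ((A + B *m K) *m X) + 2 * d0 * bilin X X.
    rewrite mulmxDr mulmxDl [LHS]mxE quadZ mulmxDr mulmxDl [X in X + _]mxE.
    congr (_ + _).
    have -> : (X^T *m ((A + B *m K)^T *m P) *m X) 0 0 = bilin ((A + B *m K) *m X) X.
      by rewrite /bilin trmx_mul !mulmxA.
    have -> : (X^T *m (P *m (A + B *m K)) *m X) 0 0 = bilin X ((A + B *m K) *m X).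
      by rewrite /bilin !mulmxA.
    by rewrite [bilin _ X]bilinC; ring.
  have -> : (X^T *m (P *m A1) *m Y) 0 0 = bilin X (A1 *m Y) by rewrite /bilin !mulmxA.
  have -> : (Y^T *m (A1^T *m P) *m X) 0 0 = bilin X (A1 *m Y).
    by rewrite bilinC /bilin trmx_mul !mulmxA.
  rewrite quadZ -/(bilin Y Y).
  have -> : ((col_mx X Y)^T *m col_mx (P *m B) 0 *m s%:M) 0 0 = s * bilin X B.
    by rewrite tr_col_mx mul_row_col mulmx0 addr0 mul_mx_scalar mxE /bilin mulmxA.
  have -> : ((s%:M : 'M[R]_1)^T *m row_mx (B^T *m P) 0 *m col_mx X Y) 0 0 = s * bilin X B.
    rewrite tr_scalar_mx -mulmxA mul_row_col mul0mx addr0 mul_scalar_mx mxE.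
    by rewrite bilinC.
  have -> : ((s%:M : 'M[R]_1)^T *m (- lam)%:M *m s%:M) 0 0 = - lam * s ^+ 2.
    by rewrite tr_scalar_mx -!scalar_mxM mxE eqxx mulr1n; ring.
  ring.
rewrite /R_mx block_quad block_quad !mulmx0 !mul0mx quadZ.
rewrite [(0 : 'M[R]_1) 0 0]mxE !addr0 !add0r; congr (_ * _).
by rewrite sqr_enorm_dot trmx_mul !mulmxA.
Qed.

End LMI.

Section LMIstrict.
Context {R : realType} {n : nat}.
Variables (A A1 : 'M[R]_n) (B : 'cV[R]_n) (a a2 : R) (K : 'rV[R]_n) (c : R).
Variables (P : 'M[R]_n) (d0 d1 lam kp : R).

(** Strictness of the first matrix inequality leaves a multiple of |Y|^2, the
    square of the delayed state, to spare. *)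
Lemma Xi_coercive : P^T = P ->
  mx_lt0 (Xi_mx A A1 B K d0 d1 P lam + kp *: R_mx A A1 B a a2 K c) ->
  exists2 e : R, 0 < e & forall (X Y : 'cV[R]_n) (s : R),
  2 * bilin P X ((A + B *m K) *m X) + 2 * d0 * bilin P X X + 2 * bilin P X (A1 *m Y)
  - 2 * d1 * bilin P Y Y + 2 * s * bilin P X B - lam * s ^+ 2
  + kp * (zeta A a K c * enorm ((A1 - a2%:M) *m Y) ^+ 2) <= - e * enorm Y ^+ 2.
Proof.
move=> PT /pd_coercive[e e0 he]; exists e => // X Y s.
have := he (col_mx (col_mx X Y) s%:M).
rewrite mulmxN mulNmx [leRHS]mxE Xi_quad//.
have -> : enorm (col_mx (col_mx X Y) (s%:M : 'M[R]_1)) ^+ 2 =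
    enorm X ^+ 2 + enorm Y ^+ 2 + s ^+ 2.
  rewrite !sqr_enorm_cV !big_split_ord /= big_ord1; congr (_ + _ + _).
  - by apply: eq_bigr => i _; rewrite !col_mxEu.
  - by apply: eq_bigr => i _; rewrite col_mxEu col_mxEd.
  - by rewrite col_mxEd mxE eqxx.
have : 0 <= e * enorm X ^+ 2 by rewrite mulr_ge0 ?sqr_ge0// ltW.
have : 0 <= e * s ^+ 2 by rewrite mulr_ge0 ?sqr_ge0// ltW.
rewrite (_ : e * (_ + _ + _) = e * enorm X ^+ 2 + e * enorm Y ^+ 2 + e * s ^+ 2); last by ring.
by rewrite mulNr; lra.
Qed.

(** Likewise for the second matrix inequality, y standing for the delayed state
    of the heat equation. *)
Lemma heat_coercive (r r1 p1 p2 lam1 : R) :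
  mx_lt0 (heat_mx a2 c r r1 d0 d1 p1 p2 lam lam1) ->
  exists2 e : R, 0 < e & forall x y z : R,
  ((- 2 * c + 2 * d0 + r) * p1 + 2 * lam) * x ^+ 2 + 2 * (a2 * p1) * (x * y)
  - 2 * d1 * p1 * y ^+ 2 - 2 * (a2 * p2) * (y * z)
  + (- (2 - r1) * p2 + lam1) * z ^+ 2 <= - e * y ^+ 2.
Proof.
move=> /pd_coercive[e e0 he]; exists e => // x y z.
have := he (\col_(i < 3) nth 0 [:: x; y; z] i).
rewrite mulmxN mulNmx [leRHS]mxE quad_expand sqr_enorm_cV.
rewrite !big_ord_recl !big_ord0 !mxE /=.
have : 0 <= e * x ^+ 2 by rewrite mulr_ge0 ?sqr_ge0// ltW.
have : 0 <= e * z ^+ 2 by rewrite mulr_ge0 ?sqr_ge0// ltW.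
rewrite !mulrDr mulr0 !addr0 => h1 h2 h3.
rewrite -subr_ge0 in h3; rewrite -subr_ge0.
apply: le_trans h3 _; rewrite -subr_ge0.
apply: le_trans (addr_ge0 h1 h2) _.
by rewrite le_eqVlt; apply/orP; left; apply/eqP; ring.
Qed.

End LMIstrict.

(** * A delay inequality *)

Section Halanay.
Context {R : realType}.

Definition continuous_half_line (V : R -> R) := forall t e : R, 0 <= t -> 0 < e ->
  exists2 d : R, 0 < d & forall s, 0 <= s -> `|s - t| < d -> `|V s - V t| < e.

(** Otherwise the supremum of the times up to which W <= 0 would be one of
    these times, by continuity, and could be exceeded. *)
Lemma continuous_induction (W : R -> R) : continuous_half_line W -> W 0 <= 0 ->
  (forall t, 0 <= t -> (forall s, 0 <= s <= t -> W s <= 0) ->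
     exists2 d : R, 0 < d & forall s, t < s < t + d -> W s <= 0) ->
  forall t, 0 <= t -> W t <= 0.
Proof.
move=> cW W0 ext T T0; rewrite leNgt; apply/negP => WT.
pose S := [set t | 0 <= t <= T /\ forall s, 0 <= s <= t -> W s <= 0].
have S0 : S 0.
  split; first by rewrite lexx T0.
  by move=> s /andP[s0 s1]; have -> : s = 0 by apply/eqP; rewrite eq_le s0 s1.
have hS : has_sup S.
  by split; [exists 0|exists T => t [/andP[]]].
pose m := sup S.
have m0 : 0 <= m by apply: ub_le_sup => //; case: hS.
have mT : m <= T by apply: ge_sup => //; [exists 0|move=> t [/andP[]]].
have Wlt s : 0 <= s -> s < m -> W s <= 0.
  move=> s0 sm; have [t St st] := sup_adherent (eps := m - s) (ltac:(by rewrite subr_gt0)) hS.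
  case: St => _; apply; rewrite s0 ltW//.
  by move: st; rewrite -/m subKr.
have Wm : W m <= 0.
  rewrite leNgt; apply/negP => Wm.
  have [d d0 hd] := cW m (W m) m0 Wm.
  have [m00|mpos] := leP m 0.
    by move: Wm; rewrite (_ : m = 0) ?ltNge ?W0//; apply/eqP; rewrite eq_le m00 m0.
  pose s := Num.max 0 (m - d / 2).
  have s0 : 0 <= s by rewrite le_max lexx.
  have sm : s < m by rewrite gt_max mpos ltrBlDr ltrDl divr_gt0.
  have sd : `|s - m| < d.
    rewrite distrC ger0_norm ?subr_ge0 ?ltW// ltrBlDr -ltrBlDl.
    rewrite lt_max; apply/orP; right; rewrite ltrD2l ltrN2.
    by rewrite ltr_pdivrMr// ltr_pMr// ltr1n.
  have := hd s s0 sd; rewrite ltNge => /negP; apply.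
  rewrite distrC ger0_norm; have := Wlt s s0 sm; lra.
have Wle s : 0 <= s <= m -> W s <= 0.
  move=> /andP[s0]; rewrite le_eqVlt => /predU1P[->//|sm]; exact: Wlt.
have [d d0 hd] := ext m m0 Wle.
have mT' : m < T by rewrite lt_neqAle mT andbT; apply/eqP => mE; move: WT; rewrite -mE ltNge Wm.
pose t := Num.min T (m + d / 2).
have tT : t <= T by rewrite ge_min lexx.
have mt : m < t by rewrite lt_min mT' ltrDl divr_gt0.
have td : t < m + d.
  rewrite gt_min; apply/orP; right; rewrite ltrD2l.
  by rewrite ltr_pdivrMr// ltr_pMr// ltr1n.
have : S t.
  split; first by rewrite tT (le_trans m0)// ltW.
  move=> s /andP[s0 st]; have [sm|ms] := leP s m; first by apply: Wle; rewrite s0.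
  by apply: hd; rewrite ms (le_lt_trans st td).
move/(ub_le_sup hS.2); rewrite -/m leNgt mt; exact/negP.
Qed.

(** The strict inequality d1 < d0 survives a factor expR (al * h) with a small
    al > 0. *)
Lemma halanay_rate (d0 d1 h : R) : 0 <= d1 -> d1 < d0 -> 0 < h ->
  exists2 al : R, 0 < al & - (2 * d0) + 2 * d1 * expR (al * h) + al < 0.
Proof.
move=> d10 dd h0.
pose k := d0 - d1; have k0 : 0 < k by rewrite subr_gt0.
have D0 : 0 < d0 by lra.
(* expR x <= (1 - x)^-1 for x < 1 *)
pose x := Num.min (2^-1) (k / (2 * d0)).
have x0 : 0 < x by rewrite lt_min invr_gt0 ltr0n divr_gt0// mulr_gt0.
have x1 : x <= 2^-1 by rewrite ge_min lexx.
have x2 : x * (2 * d0) <= k by rewrite -ler_pdivlMr ?mulr_gt0// ge_min lexx orbT.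
have hx : expR x * (1 - x) <= 1.
  have := expR_ge1Dx (- x); rewrite expRN => e1.
  have : expR x * (1 + - x) <= expR x * (expR x)^-1 by rewrite ler_wpM2l// expR_ge0.
  by rewrite divff ?gt_eqF ?expR_gt0.
pose al := Num.min (x / h) (k / 2).
have al0 : 0 < al by rewrite lt_min !divr_gt0.
exists al => //.
have a1 : al * h <= x by rewrite -ler_pdivlMr// ge_min lexx.
have a2 : al <= k / 2 by rewrite ge_min lexx orbT.
have e1 : expR (al * h) <= expR x by rewrite ler_expR.
have e0 := expR_gt0 x.
have : d1 * expR (al * h) <= d1 * expR x by rewrite ler_wpM2l.
(* d1 * expR x <= d1 / (1 - x) <= d0 - k / 2 *)
have b1 : d1 * expR x * (1 - x) <= d1 by rewrite -mulrA; exact: ler_piMr.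
have : d1 * expR x <= d0 - k / 2.
  have x10 : 0 < 1 - x by lra.
  rewrite -(ler_pM2r x10) (le_trans b1)//.
  rewrite /k in x2 k0 *; nra.
rewrite /k in a2 k0 *; lra.
Qed.

(** Halanay's inequality, where the estimate of the growth of V is available only
    while V <= 1. Continuous induction on V t <= expR (- (al * t)) keeps V below
    1 and yields the decay at the same time. *)
Lemma halanay (V tau : R -> R) (h d0 d1 : R) :
  0 < h -> 0 <= d1 -> d1 < d0 -> (forall t, 0 <= t -> 0 <= tau t <= h) ->
  (forall t, - h <= t <= 0 -> V t <= 1) -> continuous_half_line V ->
  (forall t e, 0 <= t -> V t <= 1 -> 0 < e -> exists2 d : R, 0 < d &
     forall s, t < s < t + d ->
     V s <= V t + (- (2 * d0) * V t + 2 * d1 * V (t - tau t) + e) * (s - t)) ->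
  exists2 al : R, 0 < al & forall t, 0 <= t -> V t <= expR (- (al * t)).
Proof.
move=> h0 d10 dd htau V1 cV dV.
have [al al0 rate] := halanay_rate d10 dd h0.
exists al => // t0 t00; rewrite -subr_le0.
pose W t := V t - expR (- (al * t)).
rewrite -/(W t0); apply: continuous_induction t0 t00.
- move=> t e t0 e0.
  have e20 : 0 < e / 2 by rewrite divr_gt0.
  have [d dp hd] := cV t (e / 2) t0 e20.
  have cE : continuous (fun t => expR (- (al * t))).
    move=> z; apply: continuous_comp; last exact: continuous_expR.
    by apply: cvgN; apply: cvgM; [exact: cvg_cst|exact: cvg_id].
  have /cvgrPdist_lt/(_ _ e20) := cE t.
  move=> /nbhs_ballP[d' /= d'0 hd'].
  exists (Num.min d d'); first by rewrite lt_min dp.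
  move=> s s0; rewrite lt_min => /andP[sd sd'].
  have := hd' s; rewrite /ball /= distrC => /(_ sd') h2.
  have := hd s s0 sd => h1.
  rewrite /W (_ : _ - _ - _ = (V s - V t) + (expR (- (al * t)) - expR (- (al * s)))); last by ring.
  by rewrite (le_lt_trans (ler_normD _ _))// [e]splitr ltrD.
- by rewrite /W mulr0 oppr0 expR0 subr_le0 V1// lexx andbT oppr_le0 ltW.
- move=> t t0 Wle.
  have := Wle t; rewrite lexx t0 => /(_ isT); rewrite /W subr_le0.
  set E := expR (- (al * t)) => VE.
  have E1 : E <= 1 by rewrite -[leRHS]expR0 ler_expR oppr_le0 mulr_ge0// ltW.
  have E0 : 0 < E by exact: expR_gt0.
  pose e := - (- (2 * d0) + 2 * d1 * expR (al * h) + al) * E.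
  have e0 : 0 < e by rewrite mulr_gt0// oppr_gt0.
  have Vtau : V (t - tau t) <= expR (al * h) * E.
    have /andP[ta0 tah] := htau t t0.
    apply: (@le_trans _ _ (expR (- (al * (t - tau t))))); last first.
      rewrite /E -expRD ler_expR; nra.
    have [s0|s0] := leP 0 (t - tau t).
      have := Wle (t - tau t); rewrite s0 gerBl ta0 => /(_ isT).
      by rewrite /W subr_le0.
    apply: (@le_trans _ _ 1).
      by apply: V1; rewrite (ltW s0) andbT; lra.
    rewrite -[leLHS]expR0 ler_expR; nra.
  move: VE; rewrite le_eqVlt => /predU1P[VE|VE].
    have [d dp hd] := dV t e t0 (ltac:(by rewrite VE)) e0.
    exists d => // s /andP[ts sd].
    have := hd s; rewrite ts sd => /(_ isT) Vs.
    rewrite subr_le0; apply: (le_trans Vs).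
    have : E * (1 - al * (s - t)) <= expR (- (al * s)).
      have -> : - (al * s) = - (al * t) + - (al * (s - t)) by ring.
      by rewrite expRD -/E; apply: ler_wpM2l; [exact: ltW|exact: (expR_ge1Dx (- (al * (s - t))))].
    apply: le_trans; rewrite VE.
    have : 2 * d1 * V (t - tau t) <= 2 * d1 * (expR (al * h) * E).
      by rewrite ler_wpM2l// mulr_ge0.
    rewrite /e => hV.
    have st0 : 0 <= s - t by rewrite subr_ge0 ltW.
    have : - (2 * d0) * E + 2 * d1 * V (t - tau t) +
       - (- (2 * d0) + 2 * d1 * expR (al * h) + al) * E <= - al * E.
      by rewrite -subr_ge0; rewrite -subr_ge0 in hV; apply: le_trans hV _;
        rewrite le_eqVlt; apply/orP; left; apply/eqP; ring.
    move=> /(ler_wpM2r st0); lra.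
  have gap : 0 < (E - V t) / 2 by rewrite divr_gt0// subr_gt0.
  have [d dp hd] := cV t _ t0 gap.
  pose d' := Num.min d ((E - V t) / 2 / (al * E)).
  have aE : 0 < al * E by rewrite mulr_gt0.
  have d'0 : 0 < d' by rewrite lt_min dp divr_gt0.
  exists d' => // s /andP[ts sd].
  have sd1 : s - t < d.
    by rewrite ltrBlDl (lt_le_trans sd)// lerD2l ge_min lexx.
  have sd2 : (s - t) * (al * E) < (E - V t) / 2.
    rewrite -ltr_pdivlMr// ltrBlDl (lt_le_trans sd)// lerD2l.
    by rewrite ge_min lexx orbT.
  have s0 : 0 <= s by rewrite (le_trans t0)// ltW.
  have := hd s s0; rewrite ger0_norm ?subr_ge0 ?(ltW ts)// => /(_ sd1).
  move=> /(le_lt_trans (ler_norm _)) h1.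
  have : E * (1 - al * (s - t)) <= expR (- (al * s)).
    have -> : - (al * s) = - (al * t) + - (al * (s - t)) by ring.
    by rewrite expRD -/E; apply: ler_wpM2l; [exact: ltW|exact: (expR_ge1Dx (- (al * (s - t))))].
  have : E * (1 - al * (s - t)) = E - (s - t) * (al * E) by ring.
  move=> -> h2; rewrite subr_le0; lra.
Qed.

End Halanay.

(** * The backstepping transformation *)

Section Transform.
Context {R : realType} {n : nat}.
Local Notation mu := (@lebesgue_measure R).
Variables (A : 'M[R]_n) (B : 'cV[R]_n) (a : R) (K : 'rV[R]_n) (c : R).
Implicit Types (X Y : 'cV[R]_n) (u : R -> R) (x y : R).
Local Notation la := (a + c).
Local Notation S := (St B a A).

(** The first transformation w = u - int k u - gamma X and, below, its first and
    second derivatives in terms of u, u' and u''. *)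
Definition wtr X u x := u x - (K1 K *m S X u x) 0 0.
Definition wtr1 X u (u1 : R -> R) x := u1 x - (K0 K *m S X u x) 0 0.
Definition wtr2 X u (u2 : R -> R) x :=
  u2 x - ((row_mx 0 (K *m (A - a%:M)) *m S X u x) 0 0 + u x * (K *m B) 0 0).

(** The second transformation v = w - int q w and its derivative. *)
Definition qtr (w : R -> R) x := w x - \int[mu]_(y in `[0, x]) (- gk la x y * w y).
Definition qtr1 (w w1 : R -> R) x :=
  w1 x + (gk la x x * w x + \int[mu]_(y in `[0, x]) (gkx la x y * w y)).
Definition vtr X u := qtr (wtr X u).
Definition vtr1 X u u1 := qtr1 (wtr X u) (wtr1 X u u1).

Lemma wtr_ac X u u1 : ac u u1 -> ac (wtr X u) (wtr1 X u u1).
Proof. by move=> au; apply: acB => //; exact: K1_St_ac (ac_intg au). Qed.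

Lemma wtr1_ac X u u1 u2 : ac u u1 -> ac u1 u2 -> ac (wtr1 X u u1) (wtr2 X u u2).
Proof. by move=> au au1; apply: acB => //; exact: K0_St_ac (ac_intg au). Qed.

Lemma wtr_intg X u : intg u -> intg (wtr X u).
Proof. by move=> Iu; apply: intgB => //; exact: ac_intg (K1_St_ac _ _ _ _ _ Iu). Qed.

Lemma bmeas_gk1 x : bmeas (fun y => gk la x y).
Proof. by apply: cont_bmeas; exact: derive_cont (is_derive_gky la x). Qed.

Lemma qtrE w x : intg w -> 0 <= x <= 1 ->
  qtr w x = w x + \int[mu]_(y in `[0, x]) (gk la x y * w y).
Proof.
move=> Iw /andP[x0 x1]; rewrite /qtr; congr (_ + _).
rewrite -intN//; last by apply: intgM => //; apply: bmeasN; exact: bmeas_gk1.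
by apply: eq_int => y _; rewrite mulNr opprK.
Qed.

Lemma qtr_ac w w1 : ac w w1 -> ac (qtr w) (qtr1 w w1).
Proof.
move=> aw; have Iw := ac_intg aw.
apply: eq_ac (acD aw (ac_volterra (skernel_gk la) Iw)) => // x x01.
by rewrite qtrE.
Qed.

Lemma qtr1_ac w w1 w2 : ac w w1 -> ac w1 w2 -> ac (qtr1 w w1) (fun x =>
  w2 x + ((la / 2 * w x + gk la x x * w1 x) +
    (gkx la x x * w x + \int[mu]_(y in `[0, x]) (gkxx la x y * w y)))).
Proof.
move=> aw aw1; have Iw := ac_intg aw.
apply: acD => //; apply: acD; last exact: ac_volterra (skernel_gkx la) Iw.
apply: eq_ac (acM (acZ (la / 2) (ac_idfun)) aw) => x _.
  by rewrite gk_diag.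
by rewrite gk_diag mulr1.
Qed.

Lemma vtr_ac X u u1 : ac u u1 -> ac (vtr X u) (vtr1 X u u1).
Proof. by move=> au; exact/qtr_ac/wtr_ac. Qed.

(** Two integrations by parts move the derivatives from w onto the kernel, where
    gk_pde turns a into - c. The boundary terms at 0 vanish because w'(0) = 0
    and because the kernel is even in y; those at x are absorbed by the
    values of the kernel on the diagonal. *)
Lemma qtr_pde w w1 w2 x : ac w w1 -> ac w1 w2 -> w1 0 = 0 -> 0 <= x <= 1 ->
  w2 x + ((la / 2 * w x + gk la x x * w1 x) +
    (gkx la x x * w x + \int[mu]_(y in `[0, x]) (gkxx la x y * w y))) =
  qtr (fun x => w2 x + a * w x) x + c * qtr w x.
Proof.
move=> aw aw1 w10 x01; have Iw := ac_intg aw; have Iw1 := ac_intg aw1.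
have Iw2 : intg w2 by case: aw1.
have /andP[x0 x1] := x01.
have bgk := bmeas_gk1 x.
have bgky : bmeas (fun y => gky la x y).
  by apply: cont_bmeas; exact: derive_cont (is_derive_gkyy la x).
have bgkyy : bmeas (fun y => gkyy la x y) by apply: cont_bmeas; exact: cont_gkyy.
have agk : ac (fun y => gk la x y) (fun y => gky la x y).
  by apply: ac_C1 (is_derive_gky la x) _; exact: derive_cont (is_derive_gkyy la x).
have agky : ac (fun y => gky la x y) (fun y => gkyy la x y).
  exact: ac_C1 (is_derive_gkyy la x) (@cont_gkyy R la x).
have p1 := ac_int (acM agk aw1) (lexx 0) x0 x1.
have p2 := ac_int (acM agky aw) (lexx 0) x0 x1.
rewrite w10 mulr0 subr0 (intD (intgM bgky Iw1) (intgM bgk Iw2) (lexx 0) x1) in p1.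
have gky0 : gky la x 0 = 0 by rewrite /gky mulr0 mul0r oppr0.
rewrite gky0 mul0r subr0 (intD (intgM bgkyy Iw) (intgM bgky Iw1) (lexx 0) x1) in p2.
rewrite !qtrE//; last by apply: intgD => //; exact: intgZ.
have -> : \int[mu]_(y in `[0, x]) (gk la x y * (w2 y + a * w y)) =
   \int[mu]_(y in `[0, x]) (gk la x y * w2 y) + a * \int[mu]_(y in `[0, x]) (gk la x y * w y).
  rewrite -(intZ a (intgM bgk Iw) (lexx 0) x1).
  rewrite -(intD (intgM bgk Iw2) (intgZ a (intgM bgk Iw)) (lexx 0) x1).
  by apply: eq_int => y _; ring.
have -> : \int[mu]_(y in `[0, x]) (gkxx la x y * w y) =
   \int[mu]_(y in `[0, x]) (gkyy la x y * w y) + la * \int[mu]_(y in `[0, x]) (gk la x y * w y).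
  rewrite -(intZ la (intgM bgk Iw) (lexx 0) x1).
  rewrite -(intD (intgM bgkyy Iw) (intgZ la (intgM bgk Iw)) (lexx 0) x1).
  by apply: eq_int => y _; rewrite mulrA -mulrDl -gk_pde; congr (_ * _); ring.
have gd : gkx la x x = la / 2 - gky la x x.
  by rewrite /gkx /gky subrr phi0; ring.
move: p1 p2.
set i1 := \int[mu]_(y in _) (gky _ _ _ * w1 _).
set i2 := \int[mu]_(y in _) (gk _ _ _ * w2 _).
set i3 := \int[mu]_(y in _) (gkyy _ _ _ * w _).
set i4 := \int[mu]_(y in _) (gk _ _ _ * w _) => p1 p2.
have -> : i2 = gk la x x * w1 x - (gky la x x * w x - i3) by rewrite -p1 -p2; ring.
by rewrite gd; field.
Qed.

Lemma wtr_pde X u u1 u2 x : ac u u1 -> ac u1 u2 -> u1 0 = 0 -> 0 <= x <= 1 ->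
  wtr (A *m X + u 0 *: B) (fun x => u2 x + a * u x) x = wtr2 X u u2 x + a * wtr X u x.
Proof.
move=> au au1 u10 x01; rewrite /wtr /wtr2 (St_pde B a A X au au1)//.
rewrite -{3 4}[S X u x]vsubmxK !mul_row_col !mul0mx !add0r.
have -> : (K *m (A *m dsubmx (S X u x) + u x *: B)) 0 0 =
  (K *m (A - a%:M) *m dsubmx (S X u x)) 0 0 + a * (K *m dsubmx (S X u x)) 0 0
  + u x * (K *m B) 0 0.
  rewrite mulmxDr -scalemxAr mulmxBr mulmxBl mul_mx_scalar -scalemxAl -mulmxA.
  by move: (K *m (A *m _)) (K *m dsubmx _) (K *m B) => V W U; rewrite !mxE; ring.
by ring.
Qed.

Lemma eq_qtr w w' x : (forall x, 0 <= x <= 1 -> w x = w' x) -> 0 <= x <= 1 ->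
  qtr w x = qtr w' x.
Proof.
move=> ww /andP[x0 x1]; rewrite /qtr ww ?x0//; congr (_ - _); apply: eq_int => y /andP[y0 yx].
by rewrite ww// y0 (le_trans yx).
Qed.

Lemma wtr1_at0 X u u1 : u1 0 = 0 -> wtr1 X u u1 0 = 0.
Proof. by move=> u10; rewrite /wtr1 u10 St0 mul_row_col mul0mx mulmx0 addr0 mxE subr0. Qed.

(** The image of a velocity (A X + B u(0), u'' + a u) is v'' - c v: the
    transformation conjugates the plant to a damped heat equation. *)
Lemma vtr1_ac X u u1 u2 : ac u u1 -> ac u1 u2 -> u1 0 = 0 ->
  ac (vtr1 X u u1) (fun x =>
    vtr (A *m X + u 0 *: B) (fun x => u2 x + a * u x) x + c * vtr X u x).
Proof.
move=> au au1 u10; have aw := wtr_ac X au; have aw1 := wtr1_ac X au au1.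
apply: eq_ac (qtr1_ac aw aw1) => // x x01.
rewrite (qtr_pde aw aw1 _ x01); last exact: wtr1_at0.
congr (_ + _); apply: eq_qtr => // y y01.
by rewrite (wtr_pde _ au au1).
Qed.

Lemma vtr_at0 X u : vtr X u 0 = u 0 - (K *m X) 0 0.
Proof. by rewrite /vtr /qtr int_xx subr0 /wtr St0 mul_row_col mulmx0 add0r. Qed.

Lemma vtr1_at0 X u u1 : u1 0 = 0 -> vtr1 X u u1 0 = 0.
Proof. by move=> u10; rewrite /vtr1 /qtr1 int_xx wtr1_at0// gk_diag mulr0 mul0r !addr0. Qed.

Lemma w_transfE X u x : intg u -> 0 <= x <= 1 ->
  w_transf A B a K (X, u) x = wtr X u x.
Proof.
move=> Iu x01; rewrite /w_transf /wtr K1_St//= opprD addrA.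
by rewrite addrAC.
Qed.

Lemma partial1_kE x y : partial1 (k_ker A B a K) x y = (gamma_ker A a K (x - y) *m B) 0 0.
Proof. by rewrite /partial1 derive1E; have d := is_derive_oriented B a K A x y; exact: derive_val. Qed.

Lemma partial1_nE x y : partial1 (n_ker A B a K) x y = (psi_ker A B a K (x - y) *m B) 0 0.
Proof. by rewrite /partial1 derive1E; have d := is_derive_oriented B a K (A + B *m K) x y; exact: derive_val. Qed.

Lemma K0_St1 X u : intg u -> (K0 K *m S X u 1) 0 0 =
  (dgamma_ker A a K 1 *m X) 0 0 +
  \int[mu]_(y in `[0, 1]) (partial1 (k_ker A B a K) 1 y * u y).
Proof.
move=> Iu; rewrite K0_St ?ler01 ?lexx//; congr (_ + _).
by apply: eq_int => y _; rewrite partial1_kE.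
Qed.

Lemma feedbackE X u : intg u -> feedback A B a K c (X, u) =
  (K0 K *m S X u 1) 0 0 + (- gk la 1 1 * wtr X u 1 +
  \int[mu]_(y in `[0, 1]) (- gkx la 1 y * wtr X u y)).
Proof.
move=> Iu; rewrite /feedback K0_St1//= q_kerE w_transfE ?ler01 ?lexx//.
rewrite -!addrA [RHS]addrCA; congr (_ + (_ + (_ + _))).
by apply: eq_int => y y01; rewrite partial1_qE w_transfE.
Qed.

Lemma bmeas_gkx1 x : bmeas (fun y => gkx la x y).
Proof. by apply: cont_bmeas; exact: cont_gkx1. Qed.

(** The feedback is exactly what makes the target Neumann datum vanish at 1. *)
Lemma vtr1_at1 X u u1 : intg u ->
  vtr1 X u u1 1 = u1 1 - feedback A B a K c (X, u).
Proof.
move=> Iu; rewrite feedbackE// /vtr1 /qtr1 {1}/wtr1.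
have -> : \int[mu]_(y in `[0, 1]) (- gkx la 1 y * wtr X u y) =
  - \int[mu]_(y in `[0, 1]) (gkx la 1 y * wtr X u y).
  rewrite -intN//; last by apply: intgM; [exact: bmeas_gkx1|exact: wtr_intg].
  by apply: eq_int => y _; rewrite mulNr.
by rewrite mulNr; ring.
Qed.

Lemma wtr1_bmeas X u u1 : intg u -> bmeas u1 -> bmeas (wtr1 X u u1).
Proof.
by move=> Iu bu; apply: bmeasB => //; exact: ac_bmeas (K0_St_ac _ _ _ _ _ Iu).
Qed.

(** The kernel terms in u are derivatives at 1 of K p, and p can be computed from
    w by the closed-loop equation; those in w are converted by gk_trace. *)
Lemma feedback_target X u u1 : ac u u1 -> bmeas u1 ->
  feedback A B a K c (X, u) =
  (dpsi_ker A B a K 1 *m X) 0 0 +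
  \int[mu]_(y in `[0, 1]) (partial1 (n_ker A B a K) 1 y * wtr X u y) +
  (l_ker a c 1 1 * vtr X u 1 +
   \int[mu]_(y in `[0, 1]) (partial1 (l_ker a c) 1 y * vtr X u y)).
Proof.
move=> au bu1; have Iu := ac_intg au.
rewrite feedbackE// (gk_trace (wtr_ac X au) (wtr1_bmeas X Iu bu1) (v := vtr X u))//.
congr (_ + (_ + _)).
- rewrite (St_closed_loop B a K) ?ler01 ?lexx// K0_St ?ler01 ?lexx//; last exact: wtr_intg.
  by congr (_ + _); apply: eq_int => y _; rewrite partial1_nE.
- by rewrite l_kerE.
- by apply: eq_int => y _; rewrite partial1_lE.
Qed.

Lemma wtr_inverse X u x : intg u -> 0 <= x <= 1 ->
  wtr X u x = vtr X u x + \int[mu]_(y in `[0, x]) (gk (- la) x y * vtr X u y).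
Proof.
move=> Iu x01.
by rewrite (gk_inverse (wtr_intg X Iu) (v := vtr X u))// /vtr /qtr addrNK.
Qed.

Lemma u_inverse X u x : intg u -> 0 <= x <= 1 ->
  u x = wtr X u x + (K1 K *m St B a (A + B *m K) X (wtr X u) x) 0 0.
Proof. by move=> Iu x01; rewrite -St_closed_loop// /wtr subrK. Qed.

Lemma u1_inverse X u u1 x : intg u -> 0 <= x <= 1 ->
  u1 x = wtr1 X u u1 x + (K0 K *m St B a (A + B *m K) X (wtr X u) x) 0 0.
Proof. by move=> Iu x01; rewrite -St_closed_loop// /wtr1 subrK. Qed.

Lemma St_lin X u Y v (b : R) x : intg u -> intg v -> 0 <= x <= 1 ->
  S (X + b *: Y) (fun y => u y + b * v y) x = S X u x + b *: S Y v x.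
Proof.
move=> Iu Iv x01; rewrite /St.
have -> : col_mx 0 (X + b *: Y) = col_mx 0 X + b *: col_mx 0 Y :> 'cV[R]_(n + n).
  by rewrite scale_col_mx add_col_mx scaler0 addr0.
by rewrite solD// ?solZ//; exact: intgZ.
Qed.

Lemma wtr_lin X u Y v b x : intg u -> intg v -> 0 <= x <= 1 ->
  wtr (X + b *: Y) (fun y => u y + b * v y) x = wtr X u x + b * wtr Y v x.
Proof.
move=> Iu Iv x01; rewrite /wtr St_lin// mulmxDr -scalemxAr.
by move: (K1 K *m _) (K1 K *m _) => W V; rewrite !mxE; ring.
Qed.

Lemma wtr1_lin X u u1 Y v v1 b x : intg u -> intg v -> 0 <= x <= 1 ->
  wtr1 (X + b *: Y) (fun y => u y + b * v y) (fun y => u1 y + b * v1 y) x =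
  wtr1 X u u1 x + b * wtr1 Y v v1 x.
Proof.
move=> Iu Iv x01; rewrite /wtr1 St_lin// mulmxDr -scalemxAr.
by move: (K0 K *m _) (K0 K *m _) => W V; rewrite !mxE; ring.
Qed.

Lemma int_lin (k f g h : R -> R) b x : bmeas k -> intg f -> intg g ->
  0 <= x <= 1 -> (forall y, 0 <= y <= 1 -> h y = f y + b * g y) ->
  \int[mu]_(y in `[0, x]) (k y * h y) =
  \int[mu]_(y in `[0, x]) (k y * f y) + b * \int[mu]_(y in `[0, x]) (k y * g y).
Proof.
move=> bk If Ig /andP[x0 x1] hE.
rewrite -(intZ b (intgM bk Ig) (lexx 0) x1).
rewrite -(intD (intgM bk If) (intgZ b (intgM bk Ig)) (lexx 0) x1).
by apply: eq_int => y /andP[y0 yx]; rewrite hE ?y0 ?(le_trans yx)//; ring.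
Qed.

Lemma vtr_lin X u Y v b x : intg u -> intg v -> 0 <= x <= 1 ->
  vtr (X + b *: Y) (fun y => u y + b * v y) x = vtr X u x + b * vtr Y v x.
Proof.
move=> Iu Iv x01; rewrite /vtr /qtr.
rewrite (int_lin (f := wtr X u) (g := wtr Y v) (b := b)) ?wtr_lin//.
- move: (wtr X u x) (wtr Y v x) (\int[mu]_(y in _) (_ * wtr X u y)) (\int[mu]_(y in _) (_ * wtr Y v y)).
  by move=> *; ring.
- by apply: bmeasN; exact: bmeas_gk1.
- exact: wtr_intg.
- exact: wtr_intg.
- by move=> y y01; exact: wtr_lin.
Qed.

Lemma vtr1_lin X u u1 Y v v1 b x : intg u -> intg v -> 0 <= x <= 1 ->
  vtr1 (X + b *: Y) (fun y => u y + b * v y) (fun y => u1 y + b * v1 y) x =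
  vtr1 X u u1 x + b * vtr1 Y v v1 x.
Proof.
move=> Iu Iv x01; rewrite /vtr1 /qtr1.
rewrite (int_lin (f := wtr X u) (g := wtr Y v) (b := b)) ?wtr_lin ?wtr1_lin//.
- move: (wtr1 X u u1 x) (wtr1 Y v v1 x) (wtr X u x) (wtr Y v x) (gk la x x).
  move: (\int[mu]_(y in _) (_ * wtr X u y)) (\int[mu]_(y in _) (_ * wtr Y v y)).
  by move=> *; ring.
- exact: bmeas_gkx1.
- exact: wtr_intg.
- exact: wtr_intg.
- by move=> y y01; exact: wtr_lin.
Qed.

End Transform.

(** * Bounds on the transformation *)

Section Maxima.
Context {R : realType}.

(** Maxima are suprema, hence bounds only for functions known to be bounded. *)
Lemma le_max_on (T : Type) (S : set T) (f : T -> R) C :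
  (forall p, S p -> f p <= C) -> forall p, S p -> f p <= max_on S f.
Proof.
move=> fC p Sp; apply: ub_le_sup; last by exists p.
by exists C => _ [q Sq <-]; exact: fC.
Qed.

Lemma le_sqrtr (p m : R) : 0 <= p -> p ^+ 2 <= m -> p <= Num.sqrt m.
Proof. by move=> p0 pm; rewrite -(ger0_norm p0) -sqrtr_sqr ler_wsqrtr. Qed.

Lemma normr_sum4 (p q r s P Q S : R) : `|p| <= P -> `|q| <= Q -> `|s| <= S ->
  `|p + q + (r + s)| <= P + Q + (`|r| + S).
Proof.
move=> hp hq hs; apply: le_trans (ler_normD _ _) _; apply: lerD.
  by apply: le_trans (ler_normD _ _) _; exact: lerD.
by apply: le_trans (ler_normD _ _) _; exact: lerD.
Qed.

Lemma bmeas_sum (I : Type) (r : seq I) (f : I -> R -> R) :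
  (forall i, bmeas (f i)) -> bmeas (fun x => \sum_(i <- r) f i x).
Proof.
move=> bf; elim: r => [|i r IH].
  by apply: eq_bmeas (bmeas_cst 0) => x _; rewrite big_nil.
by apply: eq_bmeas (bmeasD (bf i) IH) => x _; rewrite big_cons.
Qed.

Lemma enorm_row_bounded n (g : R -> 'rV[R]_n) : (forall j, bmeas (fun x => g x 0 j)) ->
  exists C, forall x, 0 <= x <= 1 -> enorm (g x) <= C.
Proof.
move=> bg; have [_ [C hC]] := bmeas_sum (index_enum 'I_n) (fun j => bmeasM (bg j) (bg j)).
exists (Num.sqrt C) => x x01.
rewrite -(ger0_norm (enorm_ge0 (g x))) -sqrtr_sqr ler_wsqrtr// sqr_enorm_rV.
apply: (le_trans _ (hC x x01)); rewrite (le_trans _ (ler_norm _))//.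
Qed.

End Maxima.

Section Bounds.
Context {R : realType} {n : nat}.
Local Notation mu := (@lebesgue_measure R).
Variables (A : 'M[R]_n) (B : 'cV[R]_n) (a : R) (K : 'rV[R]_n) (c : R).
Implicit Types (X Y : 'cV[R]_n) (u : R -> R) (x y : R).
Local Notation la := (a + c).
Local Notation wT := (wtr A B a K).
Local Notation w1T := (wtr1 A B a K).
Local Notation vT := (vtr A B a K c).
Local Notation v1T := (vtr1 A B a K c).
Local Notation qT := (qtr a c).
Local Notation q1T := (qtr1 a c).

Let mq := max_on triangle (fun p : R * R => `|q_ker a c p.1 p.2|).
Let ml := max_on triangle (fun p : R * R => `|l_ker a c p.1 p.2|).
Let mqd := max_on `[0, 1] (fun x : R => `|q_ker a c x x|).
Let mqx := max_on triangle (fun p : R * R => `|partial1 (q_ker a c) p.1 p.2|).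
Let mlx := max_on `[0, 1] (fun y : R => `|partial1 (l_ker a c) 1 y|).
Let mk := max_on triangle (fun p : R * R => `|k_ker A B a K p.1 p.2|).
Let mkx := max_on triangle (fun p : R * R => `|partial1 (k_ker A B a K) p.1 p.2| ^+ 2).
Let mnx := max_on `[0, 1] (fun y : R => `|partial1 (n_ker A B a K) 1 y|).
Let mg := max_on `[0, 1] (fun x : R => enorm (gamma_ker A a K x)).
Let mgx := max_on `[0, 1] (fun x : R => enorm (dgamma_ker A a K x) ^+ 2).

Lemma q_le x y : 0 <= y -> y <= x -> x <= 1 -> `|gk la x y| <= mq.
Proof.
move=> y0 yx x1; rewrite -normrN -q_kerE.
have [C hC] := gk_bound la.
apply: (@le_max_on _ _ triangle (fun p : R * R => `|q_ker a c p.1 p.2|) C _ (x, y)) => //.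
by move=> [p q] /= [] q0 qp p1; rewrite q_kerE normrN; case: (hC p q q0 qp p1).
Qed.

Lemma l_le x y : 0 <= y -> y <= x -> x <= 1 -> `|gk (- la) x y| <= ml.
Proof.
move=> y0 yx x1; rewrite -l_kerE.
have [C hC] := gk_bound (- la).
apply: (@le_max_on _ _ triangle (fun p : R * R => `|l_ker a c p.1 p.2|) C _ (x, y)) => //.
by move=> [p q] /= [] q0 qp p1; rewrite l_kerE; case: (hC p q q0 qp p1).
Qed.

Lemma qx_le x y : 0 <= y -> y <= x -> x <= 1 -> `|gkx la x y| <= mqx.
Proof.
move=> y0 yx x1; rewrite -normrN -partial1_qE.
have [C hC] := gk_bound la.
apply: (@le_max_on _ _ triangle (fun p : R * R => `|partial1 (q_ker a c) p.1 p.2|) C _ (x, y)) => //.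
by move=> [p q] /= [] q0 qp p1; rewrite partial1_qE normrN; case: (hC p q q0 qp p1).
Qed.

Lemma qd_le x : 0 <= x <= 1 -> `|gk la x x| <= mqd.
Proof.
move=> x01; rewrite -normrN -q_kerE.
have [C hC] := gk_bound la.
apply: (@le_max_on _ _ `[0, 1] (fun x : R => `|q_ker a c x x|) C _ x) => //.
  move=> p /=; rewrite in_itv/= => /andP[p0 p1].
  by rewrite q_kerE normrN; case: (hC p p p0 (lexx p) p1).
Qed.

Lemma lx_le y : 0 <= y <= 1 -> `|partial1 (l_ker a c) 1 y| <= mlx.
Proof.
move=> y01; have [C hC] := gk_bound (- la).
apply: (@le_max_on _ _ `[0, 1] (fun y : R => `|partial1 (l_ker a c) 1 y|) C _ y) => //.
  move=> p /=; rewrite in_itv/= => /andP[p0 p1].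
  by rewrite partial1_lE; case: (hC 1 p p0 p1 (lexx 1)).
Qed.

Lemma cont_kap N : continuous (kap B a K N).
Proof. exact: derive_cont (is_derive_kap B a K N). Qed.

Lemma bounded_cont (f : R -> R) : continuous f ->
  exists C, forall x, 0 <= x <= 1 -> `|f x| <= C.
Proof. by move=> /cont_bmeas[]. Qed.

Lemma tri_diff x y : 0 <= y -> y <= x -> x <= 1 -> 0 <= x - y <= 1.
Proof. by move=> *; rewrite subr_ge0; apply/andP; split => //; lra. Qed.

Lemma k_le x y : 0 <= y -> y <= x -> x <= 1 -> `|k_ker A B a K x y| <= mk.
Proof.
move=> y0 yx x1; have [C hC] := bounded_cont (@cont_kap A).
apply: (@le_max_on _ _ triangle (fun p : R * R => `|k_ker A B a K p.1 p.2|) C _ (x, y)) => //.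
by move=> [p q] /= [] q0 qp p1; rewrite /k_ker oriented_intE hC// tri_diff.
Qed.

Lemma kx_le x y : 0 <= y -> y <= x -> x <= 1 ->
  `|(row_kernel a K A (x - y) *m B) 0 0| ^+ 2 <= mkx.
Proof.
move=> y0 yx x1; have [C hC] := bounded_cont (@cont_row_kernel_B R n B a K A).
rewrite -/(gamma_ker A a K (x - y)) -partial1_kE.
apply: (@le_max_on _ _ triangle (fun p : R * R => `|partial1 (k_ker A B a K) p.1 p.2| ^+ 2) (C ^+ 2) _ (x, y)) => //.
move=> [p q] /= [] q0 qp p1; rewrite partial1_kE.
have := hC (p - q) (tri_diff q0 qp p1) => h.
by rewrite lerXn2r ?nnegrE// (le_trans _ h).
Qed.

Lemma nx_le y : 0 <= y <= 1 -> `|partial1 (n_ker A B a K) 1 y| <= mnx.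
Proof.
move=> y01; have [C hC] := bounded_cont (@cont_row_kernel_B R n B a K (A + B *m K)).
apply: (@le_max_on _ _ `[0, 1] (fun y : R => `|partial1 (n_ker A B a K) 1 y|) C _ y) => //.
  move=> p /=; rewrite in_itv/= => /andP[p0 p1].
  by rewrite partial1_nE hC// tri_diff.
Qed.

Lemma row_kernel_col N x j : row_kernel a K N x 0 j =
  (K1 K *m emx (cmx a N) x *m col j (col_mx 0 1%:M)) 0 0.
Proof. by rewrite row_kernelE colE mulmxA -colE [RHS]mxE. Qed.

Lemma g_le x : 0 <= x <= 1 -> enorm (gamma_ker A a K x) <= mg.
Proof.
move=> x01.
have [C hC] : exists C, forall x, 0 <= x <= 1 -> enorm (gamma_ker A a K x) <= C.
  apply: enorm_row_bounded => j; apply: eq_bmeas (cont_bmeas (@cont_row_emx R _ (cmx a A) (K1 K) (col j (col_mx 0 1%:M)))).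
  by move=> y _; rewrite -row_kernel_col.
apply: (@le_max_on _ _ `[0, 1] (fun x : R => enorm (gamma_ker A a K x)) C _ x) => //.
Qed.

Lemma gx_le x : 0 <= x <= 1 -> enorm (dgamma_ker A a K x) ^+ 2 <= mgx.
Proof.
move=> x01.
have [C hC] : exists C, forall x, 0 <= x <= 1 -> enorm (dgamma_ker A a K x) <= C.
  apply: enorm_row_bounded => j; apply: eq_bmeas (cont_bmeas (@cont_row_emx R _ (cmx a A) (K0 K) (col j (col_mx 0 1%:M)))).
  by move=> y _; rewrite [RHS]mxE drow_kernelE [in LHS]colE mulmxA -colE [LHS]mxE.
apply: (@le_max_on _ _ `[0, 1] (fun x : R => enorm (dgamma_ker A a K x) ^+ 2) (C ^+ 2) _ x) => //.
  move=> p /=; rewrite in_itv/= => /hC h.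
  by rewrite lerXn2r ?nnegrE ?enorm_ge0// (le_trans (enorm_ge0 _) h).
Qed.

Let i0 : 0 <= (0 : R) <= 1. Proof. by rewrite lexx ler01. Qed.
Let mq0 : 0 <= mq. Proof. exact: le_trans (normr_ge0 _) (q_le (lexx 0) (lexx 0) ler01). Qed.
Let ml0 : 0 <= ml. Proof. exact: le_trans (normr_ge0 _) (l_le (lexx 0) (lexx 0) ler01). Qed.
Let mqx0 : 0 <= mqx. Proof. exact: le_trans (normr_ge0 _) (qx_le (lexx 0) (lexx 0) ler01). Qed.
Let mqd0 : 0 <= mqd. Proof. exact: le_trans (normr_ge0 _) (qd_le i0). Qed.
Let mlx0 : 0 <= mlx. Proof. exact: le_trans (normr_ge0 _) (lx_le i0). Qed.
Let mnx0 : 0 <= mnx. Proof. exact: le_trans (normr_ge0 _) (nx_le i0). Qed.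
Let mk0 : 0 <= mk. Proof. exact: le_trans (normr_ge0 _) (k_le (lexx 0) (lexx 0) ler01). Qed.
Let mkx0 : 0 <= mkx. Proof. exact: le_trans (exprn_ge0 _ (normr_ge0 _)) (kx_le (lexx 0) (lexx 0) ler01). Qed.
Let mg0 : 0 <= mg. Proof. exact: le_trans (enorm_ge0 _) (g_le i0). Qed.
Let mgx0 : 0 <= mgx. Proof. exact: le_trans (sqr_ge0 _) (gx_le i0). Qed.

Lemma wtr_norm X u : in_L2 u -> L2norm (wT X u) <= (1 + mk) * L2norm u + mg * enorm X.
Proof.
move=> Lu; have Iu := L2_intg Lu.
have aK := K1_St_ac B a K A X Iu.
apply: le_trans (L2norm_triangleB Lu (ac_L2 aK)) _.
rewrite mulrDl mul1r -addrA lerD2l; apply: L2norm_bound (ac_L2 aK) _ => x x01.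
have /andP[x0 x1] := x01.
rewrite K1_St// [leRHS]addrC; apply: le_trans (ler_normD _ _) (lerD _ _).
  by apply: le_trans (enorm_dot _ _) _; apply: ler_wpM2r; [exact: enorm_ge0|exact: g_le].
apply: int_kernel_bound => //.
  apply: eq_bmeas (cont_bmeas (@cont_rev R _ x (@cont_kap A))) => y _.
  by rewrite oriented_intE.
by move=> y /andP[y0 yx]; exact: k_le.
Qed.

Lemma wtr1_norm X u u1 : in_L2 u -> in_L2 u1 ->
  L2norm (w1T X u u1) <= L2norm u1 + (Num.sqrt mkx * L2norm u + Num.sqrt mgx * enorm X).
Proof.
move=> Lu Lu1; have Iu := L2_intg Lu.
have aK := K0_St_ac B a K A X Iu.
apply: le_trans (L2norm_triangleB Lu1 (ac_L2 aK)) _.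
rewrite lerD2l; apply: L2norm_bound (ac_L2 aK) _ => x x01.
have /andP[x0 x1] := x01.
rewrite K0_St// [leRHS]addrC; apply: le_trans (ler_normD _ _) (lerD _ _).
  apply: le_trans (enorm_dot _ _) _; apply: ler_wpM2r; first exact: enorm_ge0.
  by apply: le_sqrtr; [exact: enorm_ge0|exact: gx_le].
apply: int_kernel_bound => //.
  exact: cont_bmeas (@cont_rev R _ x (@cont_row_kernel_B R n B a K A)).
move=> y /andP[y0 yx]; apply: le_sqrtr => //.
exact: kx_le.
Qed.

Let volt_L2 (w : R -> R) : intg w ->
  in_L2 (fun x => \int[mu]_(y in `[0, x]) (gk la x y * w y)).
Proof. by move=> Iw; apply: bmeas_L2; exact: volterra_bmeas (skernel_gk la) Iw. Qed.

Lemma qtr_norm w : in_L2 w -> L2norm (qT w) <= (1 + mq) * L2norm w.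
Proof.
move=> Lw; have Iw := L2_intg Lw.
rewrite (eq_L2norm (g := fun x => w x + \int[mu]_(y in `[0, x]) (gk la x y * w y))); last first.
  by move=> x x01; exact: qtrE.
apply: le_trans (L2norm_triangle Lw (volt_L2 Iw)) _.
rewrite mulrDl mul1r lerD2l; apply: L2norm_bound (volt_L2 Iw) _ => x /andP[x0 x1].
apply: int_kernel_bound => //; first exact: bmeas_gk1.
by move=> y /andP[y0 yx]; exact: q_le.
Qed.

Lemma qtr1_norm w w1 : bmeas w -> in_L2 w1 ->
  L2norm (q1T w w1) <= L2norm w1 + (mqd + mqx) * L2norm w.
Proof.
move=> bw Lw1; have Lw := bmeas_L2 bw; have Iw := L2_intg Lw.
have Lgw : in_L2 (fun x => gk la x x * w x).
  apply: L2M => //; apply: eq_bmeas (bmeasZ (la / 2) (ac_bmeas ac_idfun)) => x _.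
  by rewrite gk_diag.
have Lv : in_L2 (fun x => \int[mu]_(y in `[0, x]) (gkx la x y * w y)).
  by apply: bmeas_L2; exact: volterra_bmeas (skernel_gkx la) Iw.
apply: le_trans (L2norm_triangle Lw1 (L2D Lgw Lv)) _.
rewrite lerD2l; apply: le_trans (L2norm_triangle Lgw Lv) _.
rewrite mulrDl lerD//.
  rewrite -{1}(ger0_norm mqd0) -L2normZ//; apply: L2norm_le => //; first exact: L2Z.
  by move=> x x01; rewrite normrM [leRHS]normrM; apply: ler_wpM2r => //; apply: le_trans (qd_le x01) (ler_norm _).
apply: L2norm_bound => // x /andP[x0 x1].
apply: int_kernel_bound => //; first exact: bmeas_gkx1.
by move=> y /andP[y0 yx]; exact: qx_le.
Qed.

Lemma vtr_zeta Y : L2norm (vT Y (fun=> 0)) ^+ 2 <= zeta A a K c * enorm Y ^+ 2.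
Proof.
have L0 : in_L2 (fun=> 0 : R) by apply: bmeas_L2; exact: bmeas_cst.
have Lw : in_L2 (wT Y (fun=> 0)) by apply: ac_L2 (wtr_ac _ _ _ _ _ (ac_cst 0)).
rewrite /zeta -/mq -/mg -!exprMn ler_sqr ?nnegrE ?mulr_ge0 ?addr_ge0 ?L2norm_ge0 ?enorm_ge0//.
apply: (le_trans (qtr_norm Lw)); rewrite -mulrA ler_wpM2l ?addr_ge0//.
by apply: le_trans (wtr_norm _ L0) _; rewrite L2norm_cst normr0 mulr0 add0r.
Qed.

(** The constants M1 and M2 come from (p + q)^2 <= 2 * (p^2 + q^2) for w and
    from its analogue with four terms for the derivative of v. *)
Lemma transform_bound X u u1 : ac u u1 -> in_L2 u1 ->
  enorm X ^+ 2 + L2norm (vT X u) ^+ 2 + L2norm (v1T X u u1) ^+ 2 <=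
  M1 A a K c * enorm X ^+ 2 + M2 A B a K c * L2norm u ^+ 2 + 4 * L2norm u1 ^+ 2.
Proof.
move=> au Lu1; have Lu := ac_L2 au.
have aw := wtr_ac A B a K X au.
have bw := ac_bmeas aw; have Lw := ac_L2 aw.
have Lw1 : in_L2 (w1T X u u1).
  by apply: L2B => //; exact: ac_L2 (K0_St_ac B a K A X (ac_intg au)).
have hv := qtr_norm Lw; have hv1 := qtr1_norm bw Lw1.
have hw := wtr_norm X Lu; have hw1 := wtr1_norm X Lu Lu1.
rewrite /M1 /M2 -/mq -/mg -/mk -/mkx -/mqd -/mqx -/mgx.
rewrite -/(vT X u) in hv; rewrite -/(v1T X u u1) in hv1.
set W := L2norm (wT X u) in hw hv hv1 *.
set v := L2norm (vT X u) in hv *; set v1 := L2norm (v1T X u u1) in hv1 *.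
set w1 := L2norm (w1T X u u1) in hw1 hv1.
have W0 : 0 <= W by exact: L2norm_ge0.
have U0 : 0 <= L2norm u by exact: L2norm_ge0.
have V0 : 0 <= L2norm u1 by exact: L2norm_ge0.
have X0 : 0 <= enorm X by exact: enorm_ge0.
have v0 : 0 <= v by exact: L2norm_ge0.
have v10 : 0 <= v1 by exact: L2norm_ge0.
set T := 2 * ((1 + mk) ^+ 2 * L2norm u ^+ 2 + mg ^+ 2 * enorm X ^+ 2).
have WT : W ^+ 2 <= T.
  apply: (@le_trans _ _ (((1 + mk) * L2norm u + mg * enorm X) ^+ 2)).
    by rewrite lerXn2r// nnegrE addr_ge0 ?mulr_ge0 ?addr_ge0.
  rewrite /T -!exprMn; move: (_ * L2norm u) (_ * enorm X) => p q.
  by have := sqr_ge0 (p - q); rewrite !expr2; lra.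
have hv2 : v ^+ 2 <= (1 + mq) ^+ 2 * T.
  apply: (@le_trans _ _ (((1 + mq) * W) ^+ 2)).
    by rewrite lerXn2r// nnegrE mulr_ge0 ?addr_ge0.
  by rewrite exprMn ler_wpM2l ?sqr_ge0.
have hv12 : v1 ^+ 2 <= 4 * (L2norm u1 ^+ 2 + mkx * L2norm u ^+ 2 + mgx * enorm X ^+ 2 + (mqd + mqx) ^+ 2 * T).
  apply: (@le_trans _ _ ((L2norm u1 + Num.sqrt mkx * L2norm u + Num.sqrt mgx * enorm X + (mqd + mqx) * W) ^+ 2)).
    rewrite lerXn2r// ?nnegrE; first by rewrite !addr_ge0 ?mulr_ge0 ?sqrtr_ge0 ?addr_ge0.
    by apply: (le_trans hv1); rewrite lerD2r (le_trans hw1)// addrA.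
  apply: (@le_trans _ _ (4 * (L2norm u1 ^+ 2 + (Num.sqrt mkx * L2norm u) ^+ 2 + (Num.sqrt mgx * enorm X) ^+ 2 + ((mqd + mqx) * W) ^+ 2))).
    move: (L2norm u1) (_ * L2norm u) (_ * enorm X) (_ * W) => p q r s.
    have := sqr_ge0 (p - q); have := sqr_ge0 (p - r); have := sqr_ge0 (p - s).
    have := sqr_ge0 (q - r); have := sqr_ge0 (q - s); have := sqr_ge0 (r - s).
    by rewrite !expr2; lra.
  have {}WT := ler_wpM2l (sqr_ge0 (mqd + mqx)) WT.
  by rewrite !exprMn !(sqr_sqrtr mkx0, sqr_sqrtr mgx0); lra.
move: hv2 hv12; rewrite /T; move: (v ^+ 2) (v1 ^+ 2) (L2norm u ^+ 2) (L2norm u1 ^+ 2) (enorm X ^+ 2).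
by move=> V V1 U U1 X2; lra.
Qed.

Lemma wtr_vtr_norm X u u1 : ac u u1 ->
  L2norm (wT X u) <= (1 + ml) * L2norm (vT X u).
Proof.
move=> au; have av : ac (vT X u) (v1T X u u1) by exact: vtr_ac.
have Lv := ac_L2 av.
have LI : in_L2 (fun x => \int[mu]_(y in `[0, x]) (gk (- la) x y * vT X u y)).
  by apply: bmeas_L2; exact: volterra_bmeas (skernel_gk (- la)) (ac_intg av).
rewrite (eq_L2norm (g := fun x => vT X u x + \int[mu]_(y in `[0, x]) (gk (- la) x y * vT X u y))); last first.
  by move=> x x01; apply: wtr_inverse => //; exact: ac_intg au.
apply: le_trans (L2norm_triangle Lv LI) _.
rewrite mulrDl mul1r lerD2l; apply: L2norm_bound LI _ => x /andP[x0 x1].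
apply: int_kernel_bound => //.
  by apply: cont_bmeas; exact: derive_cont (is_derive_gky (- la) x).
by move=> y /andP[y0 yx]; exact: l_le.
Qed.

(** Keeping the boundary value of v apart matters for increments: the
    increment of v is of order s - t, that of its derivative is only small. *)
Lemma feedback_trace_bound X u u1 : ac u u1 -> bmeas u1 ->
  `|feedback A B a K c (X, u)| <=
  c1 A B a K * enorm X + xi A B a K c * L2norm (vT X u) + c3 a c * `|vT X u 1|.
Proof.
move=> au bu1; rewrite (feedback_target A B a K c X au bu1).
have av : ac (vT X u) (v1T X u u1) by exact: vtr_ac.
have Lv := ac_L2 av; have Lw := ac_L2 (wtr_ac A B a K X au).
have hw := wtr_vtr_norm X au.
have hI1 : `|\int[mu]_(y in `[0, 1]) (partial1 (n_ker A B a K) 1 y * wT X u y)| <=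
    mnx * ((1 + ml) * L2norm (vT X u)).
  apply: (@le_trans _ _ (mnx * L2norm (wT X u))); last by rewrite ler_wpM2l.
  apply: int_kernel_bound.
  - exact: Lw.
  - exact: lexx.
  - exact: ler01.
  - apply: eq_bmeas (cont_bmeas (@cont_rev R _ 1 (@cont_row_kernel_B R n B a K (A + B *m K)))).
    by move=> y _; rewrite partial1_nE.
  - by move=> y y01; exact: nx_le.
have hI2 : `|\int[mu]_(y in `[0, 1]) (partial1 (l_ker a c) 1 y * vT X u y)| <=
    mlx * L2norm (vT X u).
  apply: int_kernel_bound.
  - exact: Lv.
  - exact: lexx.
  - exact: ler01.
  - apply: eq_bmeas (cont_bmeas (@cont_gkx1 R (- la) 1)).
    by move=> y _; rewrite partial1_lE.
  - by move=> y y01; exact: lx_le.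
have hX := enorm_dot (dpsi_ker A B a K 1) X.
apply: (le_trans (normr_sum4 _ hX hI1 hI2)).
have -> : xi A B a K c = mnx * (1 + ml) + mlx by [].
rewrite normrM -/(c1 A B a K) -/(c3 a c).
move: (c1 _ _ _ _) (c3 _ _) mnx ml mlx (enorm _) (L2norm _) (Num.norm _) => *.
by rewrite le_eqVlt; apply/orP; left; apply/eqP; ring.
Qed.

(** By agmon1, |v(1)| <= sqrt 2 * |v| + |v'|, whence the constant c2. *)
Lemma feedback_bound X u u1 : ac u u1 -> bmeas u1 -> in_L2 (v1T X u u1) ->
  `|feedback A B a K c (X, u)| <=
  c1 A B a K * enorm X + c2 A B a K c * L2norm (vT X u) + c3 a c * L2norm (v1T X u u1).
Proof.
move=> au bu1 Lv1; apply: le_trans (feedback_trace_bound X au bu1) _.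
have av : ac (vT X u) (v1T X u u1) by exact: vtr_ac.
have hv1 : `|vT X u 1| <= Num.sqrt 2 * L2norm (vT X u) + L2norm (v1T X u u1).
  have s2 : Num.sqrt 2 ^+ 2 = 2 :> R by rewrite sqr_sqrtr.
  have s1 : 1 <= Num.sqrt 2 :> R by rewrite -{1}sqrtr1 ler_wsqrtr// ler1n.
  rewrite -ler_sqr ?nnegrE ?addr_ge0 ?mulr_ge0 ?sqrtr_ge0 ?L2norm_ge0//.
  rewrite real_normK ?num_real// (le_trans (agmon1 av Lv1))//.
  have := L2norm_ge0 (vT X u); have := L2norm_ge0 (v1T X u u1).
  move: (L2norm (vT X u)) (L2norm (v1T X u u1)) => p q q0 p0.
  have -> : (Num.sqrt 2 * p + q) ^+ 2 = Num.sqrt 2 ^+ 2 * p ^+ 2 + 2 * (Num.sqrt 2 * (p * q)) + q ^+ 2 by ring.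
  rewrite s2; have : p * q <= Num.sqrt 2 * (p * q) by rewrite ler_peMl// mulr_ge0.
  have := sqr_ge0 q; have := sqr_ge0 p; lra.
have {}hv1 : c3 a c * `|vT X u 1| <= c3 a c * (Num.sqrt 2 * L2norm (vT X u) + L2norm (v1T X u u1)).
  by rewrite ler_wpM2l// /c3.
apply: (le_trans (lerD (lexx _) hv1)); rewrite le_eqVlt; apply/orP; left; apply/eqP.
rewrite /c2 -/(c3 a c); move: (c3 a c) (xi _ _ _ _ _) (c1 _ _ _ _) (enorm X) => p q r s.
by move: (L2norm _) (L2norm _) => *; ring.
Qed.

Lemma xi_ge0 : 0 <= xi A B a K c.
Proof. exact: (addr_ge0 (mulr_ge0 mnx0 (addr_ge0 ler01 ml0)) mlx0). Qed.

Lemma M1_ge0 : 0 <= M1 A a K c.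
Proof.
rewrite /M1 -/mq -/mg -/mqd -/mqx -/mgx.
have := mulr_ge0 (sqr_ge0 (mqd + mqx)) (sqr_ge0 mg).
have := mulr_ge0 (sqr_ge0 (1 + mq)) (sqr_ge0 mg).
move: mgx0; lra.
Qed.

Lemma M2_ge0 : 0 <= M2 A B a K c.
Proof.
rewrite /M2 -/mq -/mk -/mkx -/mqd -/mqx.
have := mulr_ge0 (sqr_ge0 (mqd + mqx)) (sqr_ge0 (1 + mk)).
have := mulr_ge0 (sqr_ge0 (1 + mk)) (sqr_ge0 (1 + mq)).
move: mkx0; lra.
Qed.

Lemma mulmx_sol_bound (N : 'M[R]_n) (L : 'rV[R]_(n + n)) : exists2 C, 0 <= C &
  forall X w x, in_L2 w -> 0 <= x <= 1 ->
  `|(L *m St B a N X w x) 0 0| <= C * (enorm X + L2norm w).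
Proof.
have [C hC] := @sol_bound R _ (cmx a N) (col_mx B 0).
pose C' := `|C| * (n%:R + 1); have C'0 : 0 <= C' by rewrite mulr_ge0 ?addr_ge0.
exists ((\sum_i `|L 0 i|) * C') => [|X w x Lw x01]; first by rewrite mulr_ge0 ?sumr_ge0.
rewrite mxE; apply: le_trans (ler_norm_sum _ _ _) _.
rewrite -mulrA mulr_suml; apply: ler_sum => i _; rewrite normrM ler_wpM2l//.
apply: le_trans (hC (col_mx 0 X) w x i Lw x01) _.
rewrite big_split_ord/= big1 ?add0r; last by move=> j _; rewrite col_mxEu mxE normr0.
have -> : \sum_j `|col_mx (0 : 'cV[R]_n) X (rshift n j) 0| = \sum_j `|X j 0|.
  by apply: eq_bigr => j _; rewrite col_mxEd.
have s0 : 0 <= (\sum_j `|X j 0|) + L2norm w by rewrite addr_ge0 ?L2norm_ge0// sumr_ge0.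
apply: (@le_trans _ _ (`|C| * ((\sum_j `|X j 0|) + L2norm w))).
  by rewrite ler_wpM2r// ler_norm.
rewrite /C' -mulrA ler_wpM2l//.
have := sum_coord_le X; have := enorm_ge0 X; have := L2norm_ge0 w.
have : (0 : R) <= n%:R by []. 
move: (enorm X) (L2norm w) (n%:R : R) (\sum_j _) => p q m s m0 q0 p0 h.
have : 0 <= m * q by rewrite mulr_ge0.
lra.
Qed.

(** Undo the two transformations, first by the kernel l, then by the closed-loop
    equation for p. *)
Lemma inverse_bound : exists2 C, 0 <= C & forall X u u1, ac u u1 -> in_L2 u1 ->
  L2norm u <= C * (enorm X + L2norm (vT X u) + L2norm (v1T X u u1)) /\
  L2norm u1 <= C * (enorm X + L2norm (vT X u) + L2norm (v1T X u u1)).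
Proof.
have [C1 C10 h1] := mulmx_sol_bound (A + B *m K) (K1 K).
have [C2 C20 h2] := mulmx_sol_bound (A + B *m K) (K0 K).
pose Cw := 1 + ml; have Cw0 : 0 <= Cw by rewrite addr_ge0.
pose Q := mqd + mqx; have Q0 : 0 <= Q by rewrite addr_ge0.
pose Cu := Cw + (C1 + C2) * (1 + Cw) + 1 + Q * Cw.
have ? : 0 <= Cu by rewrite /Cu !addr_ge0 ?mulr_ge0 ?addr_ge0.
exists Cu => // X u u1 au Lu1.
have Iu := ac_intg au; have aw := wtr_ac A B a K X au; have Lw := ac_L2 aw.
have av : ac (vT X u) (v1T X u u1) by exact: vtr_ac.
have Lv := ac_L2 av.
have hw : L2norm (wT X u) <= Cw * L2norm (vT X u) := wtr_vtr_norm X au.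
have aK1 := K1_St_ac B a K (A + B *m K) X (ac_intg aw).
have aK0 := K0_St_ac B a K (A + B *m K) X (ac_intg aw).
have Lw1 : in_L2 (w1T X u u1).
  by apply: L2B => //; exact: ac_L2 (K0_St_ac B a K A X Iu).
have bw := ac_bmeas aw.
have Lgw : in_L2 (fun x => gk la x x * wT X u x).
  apply: L2M => //; apply: eq_bmeas (bmeasZ (la / 2) (ac_bmeas ac_idfun)) => x _.
  by rewrite gk_diag.
have LI : in_L2 (fun x => \int[mu]_(y in `[0, x]) (gkx la x y * wT X u y)).
  by apply: bmeas_L2; exact: volterra_bmeas (skernel_gkx la) (ac_intg aw).
have Lv1 : in_L2 (v1T X u u1) by apply: L2D => //; exact: L2D.
have hw1 : L2norm (w1T X u u1) <= L2norm (v1T X u u1) + Q * L2norm (wT X u).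
  rewrite (eq_L2norm (g := fun x => v1T X u u1 x - (gk la x x * wT X u x + \int[mu]_(y in `[0, x]) (gkx la x y * wT X u y)))); last first.
    by move=> x _; rewrite /v1T /q1T addrK.
  apply: le_trans (L2norm_triangleB Lv1 (L2D Lgw LI)) _.
  rewrite lerD2l; apply: le_trans (L2norm_triangle Lgw LI) _.
  rewrite mulrDl lerD//.
    rewrite -{1}(ger0_norm mqd0) -L2normZ//; apply: L2norm_le => //; first exact: L2Z.
    by move=> x x01; rewrite normrM [leRHS]normrM; apply: ler_wpM2r => //; apply: le_trans (qd_le x01) (ler_norm _).
  apply: L2norm_bound => // x /andP[x0 x1].
  apply: int_kernel_bound => //; first exact: bmeas_gkx1.
  by move=> y /andP[y0 yx]; exact: qx_le.
have hu : L2norm u <= L2norm (wT X u) + C1 * (enorm X + L2norm (wT X u)).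
  rewrite (eq_L2norm (g := fun x => wT X u x + (K1 K *m St B a (A + B *m K) X (wT X u) x) 0 0)); last first.
    by move=> x x01; exact: u_inverse.
  apply: le_trans (L2norm_triangle Lw (ac_L2 aK1)) _.
  by rewrite lerD2l; apply: L2norm_bound (ac_L2 aK1) _ => x x01; exact: h1.
have hu1 : L2norm u1 <= L2norm (w1T X u u1) + C2 * (enorm X + L2norm (wT X u)).
  rewrite (eq_L2norm (g := fun x => w1T X u u1 x + (K0 K *m St B a (A + B *m K) X (wT X u) x) 0 0)); last first.
    by move=> x x01; exact: u1_inverse.
  apply: le_trans (L2norm_triangle Lw1 (ac_L2 aK0)) _.
  by rewrite lerD2l; apply: L2norm_bound (ac_L2 aK0) _ => x x01; exact: h2.
have := L2norm_ge0 (vT X u); have := L2norm_ge0 (v1T X u u1); have := enorm_ge0 X.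
move: hw hw1 hu hu1; rewrite -/(v1T X u u1).
move: (enorm X) (L2norm (vT X u)) (L2norm (v1T X u u1)) (L2norm u) (L2norm u1) (L2norm (wT X u)) (L2norm (w1T X u u1)).
move=> x v v1 U U1 w w1 hw hw1 hu hu1 x0 v10 v0.
have e1 : C1 * w <= C1 * (Cw * v) by rewrite ler_wpM2l.
have e2 : C2 * w <= C2 * (Cw * v) by rewrite ler_wpM2l.
have e3 : Q * w <= Q * (Cw * v) by rewrite ler_wpM2l.
have k1 := mulr_ge0 C10 x0; have k2 := mulr_ge0 C10 v0; have k3 := mulr_ge0 C10 v10.
have k4 := mulr_ge0 C20 x0; have k5 := mulr_ge0 C20 v0; have k6 := mulr_ge0 C20 v10.
have k7 := mulr_ge0 Cw0 x0; have k8 := mulr_ge0 Cw0 v0; have k9 := mulr_ge0 Cw0 v10.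
have l1 := mulr_ge0 C10 k7; have l2 := mulr_ge0 C10 k8; have l3 := mulr_ge0 C10 k9.
have l4 := mulr_ge0 C20 k7; have l5 := mulr_ge0 C20 k8; have l6 := mulr_ge0 C20 k9.
have l7 := mulr_ge0 Q0 k7; have l8 := mulr_ge0 Q0 k8; have l9 := mulr_ge0 Q0 k9.
rewrite /Cu; split; lra.
Qed.

End Bounds.

(** * Space derivatives *)

Section Sobolev.
Context {R : realType}.
Local Notation D := (`[0%R, 1%R]%classic : set R).
Implicit Types (f g : R -> R) (x y : R).

Lemma cvg_withinP (S : set R) (f : R -> R) x (l : R) :
  f y @[y --> within S (nbhs x)] --> l <->
  forall e : R, 0 < e -> exists2 d : R, 0 < d &
    forall y, S y -> `|y - x| < d -> `|f y - l| < e.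
Proof.
split.
  move=> /cvgrPdist_lt h e e0; have /nbhs_ballP[d /= d0 hd] := h e e0.
  exists d => // y Sy yx; rewrite distrC; apply: (hd y) => //.
  by rewrite /ball /= distrC.
move=> h; apply/cvgrPdist_lt => e e0; have [d d0 hd] := h e e0.
apply/nbhs_ballP; exists d => //= y; rewrite /ball /= distrC => yx Sy.
by rewrite distrC; exact: hd.
Qed.

Lemma cvg_dwithinP (S : set R) (f : R -> R) x (l : R) :
  f y @[y --> within S x^'] --> l <->
  forall e : R, 0 < e -> exists2 d : R, 0 < d &
    forall y, S y -> y != x -> `|y - x| < d -> `|f y - l| < e.
Proof.
split.
  move=> /cvgrPdist_lt h e e0; have /nbhs_ballP[d /= d0 hd] := h e e0.
  exists d => // y Sy nyx yx; rewrite distrC; apply: (hd y) => //.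
  by rewrite /ball /= distrC.
move=> h; apply/cvgrPdist_lt => e e0; have [d d0 hd] := h e e0.
apply/nbhs_ballP; exists d => //= y; rewrite /ball /= distrC => yx nyx Sy.
by rewrite distrC; exact: hd.
Qed.

Lemma proper_dwithin01 x : 0 <= x <= 1 -> ProperFilter (within D x^').
Proof.
move=> /andP[x0 x1]; apply: Build_ProperFilter_ex => P /nbhs_ballP[d /= d0 hd].
pose e := Num.min d 1 / 2.
have m0 : 0 < Num.min d 1 by rewrite lt_min d0 ltr01.
have e0 : 0 < e by rewrite /e divr_gt0.
have ed : e < d by rewrite /e ltr_pdivrMr// (le_lt_trans (_ : _ <= d))// ?ge_min ?lexx// ltr_pMr// ltr1n.
have e2 : e <= 1 / 2 by rewrite ler_pdivrMr// divfK// ge_min lexx orbT.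
have [xh|xh] := leP x (1 / 2).
  exists (x + e); apply: hd => /=.
  - by rewrite /ball /= opprD addNKr normrN ger0_norm// ltW.
  - by rewrite -subr_eq0 addrC addKr gt_eqF.
  - by rewrite in_itv/= addr_ge0 ?(ltW e0)//=; lra.
exists (x - e); apply: hd => /=.
- by rewrite /ball /= opprB addrCA subrr addr0 ger0_norm// ltW.
- by rewrite -subr_eq0 addrC addKr oppr_eq0 gt_eqF.
- by rewrite in_itv/=; apply/andP; split; lra.
Qed.

Lemma ac_dist f g x y k e : ac f g -> 0 <= x <= 1 -> 0 <= y <= 1 ->
  (forall z, Num.min x y <= z <= Num.max x y -> `|g z - k| <= e) ->
  `|f y - f x - k * (y - x)| <= e * `|y - x|.
Proof.
move=> afg.
wlog xy : x y / x <= y.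
  move=> H x01 y01 hz; have [|/ltW yx] := leP x y; first by move=> h; exact: H.
  have := H y x yx y01 x01; rewrite minC maxC => /(_ hz).
  rewrite [`|x - y|]distrC -[`|f x - _ - _|]normrN.
  by rewrite (_ : - (f x - f y - k * (x - y)) = f y - f x - k * (y - x))//; ring.
move=> /andP[x0 x1] /andP[y0 y1]; rewrite min_l// max_r// => hz.
have Ig : intg g by case: afg.
have Ib : intg (fun z => g z - k) by apply: intgB => //; exact: intg_cst.
rewrite -(ac_int afg x0 xy y1) -int_cst//.
rewrite -intB//; last exact: intg_cst.
apply: le_trans (int_norm Ib x0 y1) _.
rewrite (ger0_norm (x := y - x)) ?subr_ge0// -int_cst//.
by apply: int_le => //; [exact: intg_norm|exact: intg_cst].
Qed.

(** A continuous density is a derivative at every point, one-sided at 0 and 1. *)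
Lemma dx_ac f g x : ac f g -> {within D, continuous g} -> 0 <= x <= 1 -> dx f x = g x.
Proof.
move=> afg cg x01; rewrite /dx.
have PF := proper_dwithin01 x01.
apply: (@cvg_lim _ _ _ (within D x^') PF); first exact: Rhausdorff.
apply/cvg_dwithinP => e e0.
have Dx : D x by rewrite /= in_itv.
have /subspace_continuousP/(_ x Dx)/cvg_withinP/(_ (e / 2)) := cg.
rewrite divr_gt0// => /(_ isT)[d d0 hd]; exists d => // y Dy yx ydx.
have y01 : 0 <= y <= 1 by move: Dy; rewrite /= in_itv.
have := @ac_dist f g x y (g x) (e / 2) afg x01 y01.
case/andP: x01 => x0 x1; case/andP: y01 => y0 y1.
have H z : Num.min x y <= z <= Num.max x y -> `|g z - g x| <= e / 2.
  move=> /andP[z1 z2]; apply/ltW/hd.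
    rewrite /= in_itv/=; apply/andP; split.
      by apply: le_trans z1; rewrite le_min x0.
    by apply: (le_trans z2); rewrite ge_max x1.
  apply: le_lt_trans ydx; move: z1 z2; have [xy|yx'] := leP x y => z1 z2.
    by rewrite !ger0_norm ?subr_ge0// lerD2r.
  by rewrite distrC [leRHS]distrC !ger0_norm ?subr_ge0 ?(ltW yx')// lerB.
move=> /(_ H) h.
have n0 : 0 < `|y - x| by rewrite normr_gt0 subr_eq0.
have yx0 : y - x != 0 by rewrite subr_eq0.
have -> : (f y - f x) / (y - x) - g x = (f y - f x - g x * (y - x)) / (y - x).
  by rewrite [RHS]mulrBl mulfK.
rewrite normrM normfV ltr_pdivrMr//; apply: (le_lt_trans h).
by rewrite ltr_pM2r// ltr_pdivrMr// ltr_pMr// ltr1n.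
Qed.

Lemma H1_ac f : in_H1 f -> ac f (dx f).
Proof. by move=> [L h]; split => //; exact: L2_intg. Qed.

Lemma H2_ac f : in_H2 f -> [/\ ac f (dx f), ac (dx f) (dx (dx f)),
  in_L2 (dx (dx f)) & in_L2 (dx f)].
Proof.
move=> [h1 h2]; split; [exact: H1_ac|exact: H1_ac|by case: h2|by case: h1].
Qed.

(** Limits of difference quotients add up only where they exist; for H^2
    functions they exist at every point. *)
Lemma dx_sub f g x : in_H2 f -> in_H2 g -> 0 <= x <= 1 ->
  dx (f - g) x = dx f x - dx g x.
Proof.
move=> /H2_ac[f1 f2 _ _] /H2_ac[g1 g2 _ _] x01.
exact: (@dx_ac (f - g) (fun x => dx f x - dx g x) x (acB f1 g1) (ac_within (acB f2 g2)) x01).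
Qed.

End Sobolev.

Section StateNorms.
Context {R : realType} {n : nat}.
Implicit Types z : 'cV[R]_n * (R -> R).

Lemma le_sqrt_sum (p q : R) : 0 <= q -> 0 <= p -> p <= Num.sqrt (p ^+ 2 + q).
Proof. by move=> q0 p0; apply: le_sqrtr => //; rewrite lerDl. Qed.

Lemma normH_X z : enorm z.1 <= normH z.
Proof. by apply: le_sqrt_sum; rewrite ?sqr_ge0. Qed.

Lemma normH_u z : L2norm z.2 <= normH z.
Proof. by rewrite /normH addrC; apply: le_sqrt_sum; rewrite ?sqr_ge0. Qed.

Lemma normH2_X z : enorm z.1 <= normH2 z.
Proof. by rewrite /normH2 -!addrA; apply: le_sqrt_sum; rewrite ?addr_ge0 ?sqr_ge0. Qed.

Lemma normH2_u z : L2norm z.2 <= normH2 z.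
Proof.
by rewrite /normH2 -!addrA addrCA; apply: le_sqrt_sum; rewrite ?addr_ge0 ?sqr_ge0.
Qed.

Lemma normH2_ux z : L2norm (dx z.2) <= normH2 z.
Proof.
rewrite /normH2 [X in Num.sqrt (X + _)]addrC -!addrA; apply: le_sqrt_sum => //.
by rewrite ?addr_ge0 ?sqr_ge0.
Qed.

Lemma normH1_le z : normH1 z <= enorm z.1 + L2norm z.2 + L2norm (dx z.2).
Proof.
have := enorm_ge0 z.1; have := L2norm_ge0 z.2; have := L2norm_ge0 (dx z.2).
rewrite /normH1; move: (enorm _) (L2norm z.2) (L2norm _) => p q r r0 q0 p0.
have s0 : 0 <= p + q + r by rewrite !addr_ge0.
rewrite -[leRHS](ger0_norm s0) -sqrtr_sqr ler_wsqrtr//.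
have := mulr_ge0 p0 q0; have := mulr_ge0 p0 r0; have := mulr_ge0 q0 r0.
by rewrite !expr2; lra.
Qed.

End StateNorms.

(** * Dissipation along the target system *)

Section Lyapunov.
Context {R : realType} {n : nat}.
Local Notation mu := (@lebesgue_measure R).
Local Notation D := (`[0%R, 1%R]%classic : set R).
Implicit Types (f g v : R -> R) (X Y : 'cV[R]_n).

Definition ip f g : R := \int[mu]_(x in D) (f x * g x).

Lemma ipC f g : ip f g = ip g f.
Proof. by apply: eq_int => x _; rewrite mulrC. Qed.

Lemma ip_ff f : ip f f = L2norm f ^+ 2.
Proof. by rewrite L2normE; apply: eq_int => x _; rewrite expr2. Qed.

Lemma eq_ip f f' g g' : (forall x, 0 <= x <= 1 -> f x = f' x) ->
  (forall x, 0 <= x <= 1 -> g x = g' x) -> ip f g = ip f' g'.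
Proof. by move=> ff gg; apply: eq_int => x x01; rewrite ff// gg. Qed.

Lemma ipDr f g h b : in_L2 f -> in_L2 g -> in_L2 h ->
  ip f (fun x => g x + b * h x) = ip f g + b * ip f h.
Proof.
move=> Lf Lg Lh.
rewrite /ip -(intZ b (L2_mul Lf Lh) (lexx 0) (lexx 1)).
rewrite -(intD (L2_mul Lf Lg) (intgZ b (L2_mul Lf Lh)) (lexx 0) (lexx 1)).
by apply: eq_int => x _; ring.
Qed.

Lemma ipDl f g h b : in_L2 f -> in_L2 g -> in_L2 h ->
  ip (fun x => g x + b * h x) f = ip g f + b * ip h f.
Proof. by move=> *; rewrite ipC ipDr// ipC [ip f h]ipC. Qed.

(** The product rule, integrated. *)
Lemma ip_parts f f1 g g1 : ac f f1 -> ac g g1 ->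
  ip f1 g = f 1 * g 1 - f 0 * g 0 - ip f g1.
Proof.
move=> af ag; have := ac_int (acM af ag) (lexx 0) ler01 (lexx 1).
have I1 : intg (fun x => f1 x * g x).
  apply: eq_intg (intgM (ac_bmeas ag) (_ : intg f1)) => [x _|]; first by rewrite mulrC.
  by case: af.
rewrite (intD I1 (intgM (ac_bmeas af) _) (lexx 0) (lexx 1)); last by case: ag.
by rewrite -/(ip f1 g) -/(ip f g1) => <-; rewrite addrK.
Qed.

Variables (A A1 : 'M[R]_n) (B : 'cV[R]_n) (a a2 : R) (K : 'rV[R]_n) (c : R).
Variables (P : 'M[R]_n) (p1 p2 d0 d1 lam lam1 r r1 beta : R).
Hypotheses (PT : P^T = P) (p10 : 0 < p1) (p20 : 0 < p2) (lam0 : 0 < lam).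
Hypotheses (lam10 : 0 <= lam1) (r0 : 0 < r) (r10 : 0 < r1) (d10 : 0 < d1) (dd : d1 = d0).
Hypothesis (beta0 : 0 < beta).
Hypothesis Xi0 : mx_lt0 (Xi_mx A A1 B K d0 d1 P lam +
  (p1 * r^-1 + p2 * r1^-1) *: R_mx A A1 B a a2 K c).
Hypothesis heat0 : mx_lt0 (heat_mx a2 c r r1 d0 d1 p1 p2 lam lam1).
Hypothesis third : - 2 * p1 - 2 * p2 * c + lam + 2 * d0 * p2 - pi ^+ 2 / 4 * lam1 <= 0.
Hypothesis PB : mx_ge0 (beta%:M - P).
Hypothesis p1B : p1 <= beta.

(** The left-hand side is the derivative of the Lyapunov functional along the
    target system. Integration by parts turns the product of v and v''
    into - |v'|^2; Young's inequality with r and r1 absorbs g; agmon0 bounds the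
    v(0)^2 needed by the first matrix inequality, and Wirtinger's inequality
    for v' supplies the multiplier lam1. The rate d1' < d0 is what the
    strictness of the two matrix inequalities leaves. *)
Lemma dissipation : exists2 d1' : R, 0 <= d1' < d0 &
  forall X Y v v1 v2 w g T,
    ac v v1 -> ac v1 v2 -> in_L2 v2 -> in_L2 w -> in_L2 g ->
    v1 0 = 0 -> v1 1 = 0 ->
    L2norm g ^+ 2 <= zeta A a K c * enorm ((A1 - a2%:M) *m Y) ^+ 2 ->
    (forall x, 0 <= x <= 1 -> T x = v2 x - c * v x + a2 * w x + g x) ->
    2 * bilin P X ((A + B *m K) *m X) + 2 * bilin P X (A1 *m Y) + 2 * v 0 * bilin P X B
    + p1 * (2 * ip v T) - p2 * (2 * ip T v2) <=
    - (2 * d0) * (bilin P X X + p1 * L2norm v ^+ 2 + p2 * L2norm v1 ^+ 2)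
    + 2 * d1' * (bilin P Y Y + p1 * L2norm w ^+ 2).
Proof.
have [e1 e10 hX] := Xi_coercive PT Xi0.
have [e2 e20 hH] := heat_coercive heat0.
(* eta * (Y^T P Y + p1 * |w|^2) <= e1 * |Y|^2 + e2 * |w|^2 because P, p1 <= beta *)
pose eta := Num.min (2 * d1) (Num.min e1 e2 / beta).
have m0 : 0 < Num.min e1 e2 by rewrite lt_min e10.
have eta0 : 0 < eta by rewrite lt_min mulr_gt0// divr_gt0.
have eta1 : eta <= 2 * d1 by rewrite ge_min lexx.
have eta2 : eta * beta <= Num.min e1 e2.
  by rewrite -ler_pdivlMr// /eta ge_min lexx orbT.
have [eta3 eta4] : eta * beta <= e1 /\ eta * beta <= e2.
  by split; apply: (le_trans eta2); rewrite ge_min lexx ?orbT.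
clear eta2; clearbody eta.
exists (d1 - eta / 2); first by rewrite -dd; apply/andP; split; lra.
move=> X Y v v1 v2 w g T av av1 L2 Lw Lg v10 v11 hg TE.
have Lv := ac_L2 av; have Lv1 := ac_L2 av1.
have E1 : ip v T = - L2norm v1 ^+ 2 - c * L2norm v ^+ 2 + a2 * ip v w + ip v g.
  have Lvv : in_L2 (fun x => v2 x + - c * v x) by apply: L2D => //; exact: L2Z.
  have Lvvw : in_L2 (fun x => v2 x + - c * v x + a2 * w x) by apply: L2D => //; exact: L2Z.
  rewrite (eq_ip (f' := v) (g' := fun x => (v2 x + - c * v x + a2 * w x) + 1 * g x))//; last first.
    by move=> x x01; rewrite TE// mul1r mulNr.
  rewrite ipDr// ipDr// ipDr// ip_ff mul1r.
  have := ip_parts av1 av; rewrite v10 v11 !mul0r subrr sub0r ip_ff ipC => ->.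
  by rewrite mulNr.
have E2 : ip T v2 = L2norm v2 ^+ 2 + c * L2norm v1 ^+ 2 + a2 * ip w v2 + ip g v2.
  have Lvv : in_L2 (fun x => v2 x + - c * v x) by apply: L2D => //; exact: L2Z.
  have Lvvw : in_L2 (fun x => v2 x + - c * v x + a2 * w x) by apply: L2D => //; exact: L2Z.
  rewrite (eq_ip (f' := fun x => (v2 x + - c * v x + a2 * w x) + 1 * g x) (g' := v2))//; last first.
    by move=> x x01; rewrite TE// mul1r mulNr.
  rewrite ipDl// ipDl// ipDl// ip_ff mul1r.
  have := ip_parts av1 av; rewrite v10 v11 !mul0r subrr sub0r ip_ff [ip v v2]ipC => ->.
  by rewrite mulrNN.
have ag : v 0 ^+ 2 <= 2 * L2norm v ^+ 2 + L2norm v1 ^+ 2.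
  apply: le_trans (agmon0 av Lv1) _.
  by have := sqr_ge0 (L2norm v - L2norm v1); rewrite !expr2; lra.
have wi := wirtinger av1 L2 v10.
have y1 := young_int Lv Lg r0.
have y2 : 2 * - ip g v2 <= r1 * L2norm v2 ^+ 2 + r1^-1 * L2norm g ^+ 2.
  have := young_int L2 (L2N Lg) r10; rewrite L2normN.
  rewrite (_ : \int[mu]_(x in D) (v2 x * - g x) = - ip g v2)//.
  rewrite -intN//; first by apply: eq_int => x _; rewrite mulrC mulNr.
  exact: L2_mul.
rewrite -/(ip v g) in y1.
have hx := hX X Y (v 0).
have hh : ((- 2 * c + 2 * d0 + r) * p1 + 2 * lam) * L2norm v ^+ 2 + 2 * (a2 * p1) * ip v w
  - 2 * d1 * p1 * L2norm w ^+ 2 - 2 * (a2 * p2) * ip w v2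
  + (- (2 - r1) * p2 + lam1) * L2norm v2 ^+ 2 <= - e2 * L2norm w ^+ 2.
  rewrite -!ip_ff /ip.
  have I1 := L2_mul Lv Lv; have I2 := L2_mul Lv Lw; have I3 := L2_mul Lw Lw.
  have I4 := L2_mul Lw L2; have I5 := L2_mul L2 L2.
  set k1 := (X in X * _ + _); set k2 := 2 * (a2 * p1); set k3 := 2 * d1 * p1.
  set k4 := 2 * (a2 * p2); set k5 := - (2 - r1) * p2 + lam1.
  have J1 := intgZ k1 I1; have J2 := intgZ k2 I2; have J3 := intgZ k3 I3.
  have J4 := intgZ k4 I4; have J5 := intgZ k5 I5.
  rewrite -(intZ k1 I1 (lexx 0) (lexx 1)) -(intZ k2 I2 (lexx 0) (lexx 1)).
  rewrite -(intZ k3 I3 (lexx 0) (lexx 1)) -(intZ k4 I4 (lexx 0) (lexx 1)).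
  rewrite -(intZ k5 I5 (lexx 0) (lexx 1)) -(intZ (- e2) I3 (lexx 0) (lexx 1)).
  rewrite -(intD J1 J2 (lexx 0) (lexx 1)) -(intB (intgD J1 J2) J3 (lexx 0) (lexx 1)).
  rewrite -(intB (intgB (intgD J1 J2) J3) J4 (lexx 0) (lexx 1)).
  rewrite -(intD (intgB (intgB (intgD J1 J2) J3) J4) J5 (lexx 0) (lexx 1)).
  apply: int_le => //; [exact: intgD (intgB (intgB (intgD J1 J2) J3) J4) J5|exact: intgZ|].
  by move=> x _; rewrite -!expr2; exact: hH.
have PY := mx_ge0_scalar PB Y; rewrite -/(bilin P Y Y) in PY.
have q1 : eta * bilin P Y Y <= e1 * enorm Y ^+ 2.
  apply: (@le_trans _ _ (eta * (beta * enorm Y ^+ 2))); first by rewrite ler_wpM2l// ltW.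
  by rewrite mulrA ler_wpM2r// sqr_ge0.
have q2 : eta * (p1 * L2norm w ^+ 2) <= e2 * L2norm w ^+ 2.
  rewrite mulrA ler_wpM2r ?sqr_ge0//; apply: (le_trans _ eta4).
  by rewrite ler_wpM2l// ltW.
have z1 := ler_wpM2l (ltW lam0) ag.
have z2 := ler_wpM2l lam10 wi.
have z3 := ler_wpM2l (ltW p10) y1.
have z4 := ler_wpM2l (ltW p20) y2.
have k0 : 0 <= p1 * r^-1 + p2 * r1^-1 by rewrite addr_ge0// mulr_ge0 ?invr_ge0 ?(ltW p10) ?(ltW p20) ?(ltW r0) ?(ltW r10).
have z5 := ler_wpM2l k0 hg.
have z6 := ler_wpM2r (sqr_ge0 (L2norm v1)) third.
rewrite E1 E2 -dd.
move: hx hh q1 q2 z1 z2 z3 z4 z5 z6; rewrite -dd.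
set ri := r^-1; set r1i := r1^-1.
move: (bilin P X X) (bilin P Y Y) (bilin P X ((A + B *m K) *m X)) (bilin P X (A1 *m Y)) (bilin P X B) => x1 x2 x3 x4 x5.
move: (zeta A a K c * _) (enorm Y ^+ 2) (L2norm v ^+ 2) (L2norm v1 ^+ 2) (L2norm v2 ^+ 2) (L2norm w ^+ 2) (L2norm g ^+ 2) => *.
lra.
Qed.

End Lyapunov.

(** * Increments of the Lyapunov functional *)

Section Step.
Context {R : realType} {n : nat}.
Implicit Types (f g v : R -> R) (X Y F : 'cV[R]_n).

Lemma le_sum3 (x p q y : R) : x <= p + 2 * q -> p <= y -> q <= y -> x <= 3 * y.
Proof. by lra. Qed.

Lemma enorm_tr X : enorm X^T = enorm X.
Proof.
apply/eqP; rewrite -(@eqrXn2 _ 2)// ?enorm_ge0// sqr_enorm_rV sqr_enorm_cV.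
by apply/eqP; apply: eq_bigr => i _; rewrite mxE.
Qed.

Lemma bilin_bound (P : 'M[R]_n) : exists2 C, 0 <= C &
  forall X Y, `|bilin P X Y| <= C * enorm X * enorm Y.
Proof.
have [C C0 hC] := enorm_mulmx_bound P; exists C => // X Y.
rewrite /bilin -mulmxA (le_trans (enorm_dot _ _))// enorm_tr mulrAC [leRHS]mulrC.
by rewrite ler_wpM2l ?enorm_ge0.
Qed.

Lemma ip_sub f g g' : in_L2 f -> in_L2 g -> in_L2 g' ->
  ip f (fun x => g x - g' x) = ip f g - ip f g'.
Proof.
move=> Lf Lg Lg'; rewrite (eq_ip (f' := f) (g' := fun x => g x + -1 * g' x))//.
  by rewrite ipDr// mulN1r.
by move=> x _; rewrite mulN1r.
Qed.

Lemma ip_add f g g' : in_L2 f -> in_L2 g -> in_L2 g' ->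
  ip f (fun x => g x + g' x) = ip f g + ip f g'.
Proof.
move=> Lf Lg Lg'; rewrite (eq_ip (f' := f) (g' := fun x => g x + 1 * g' x))//.
  by rewrite ipDr// mul1r.
by move=> x _; rewrite mul1r.
Qed.

Lemma ip_CS f g k l : in_L2 f -> in_L2 g -> L2norm f <= k -> L2norm g <= l ->
  `|ip f g| <= k * l.
Proof.
move=> Lf Lg fk gl; apply: le_trans (CS_norm Lf Lg) _.
by apply: ler_pM => //; exact: L2norm_ge0.
Qed.

Variables (P : 'M[R]_n) (p1 p2 g1 g2 g3 : R).
Hypotheses (PT : P^T = P) (p10 : 0 <= p1) (p20 : 0 <= p2).
Hypotheses (g10 : 0 <= g1) (g20 : 0 <= g2) (g30 : 0 <= g3).

Lemma bilin_increment X F X' (e : 'cV[R]_n) d : X' - X = d *: (F + e) ->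
  bilin P X' X' = bilin P X X + d * (2 * bilin P X F + (2 * bilin P X e + bilin P (X' - X) (F + e))).
Proof.
move=> h; have -> : X' = X + (X' - X) by rewrite addrC subrK.
set Z := X' - X; rewrite (_ : X + Z - X = Z); last by rewrite addrC addKr.
have E (Y : 'cV[R]_n) : bilin P (X + Y) (X + Y) = bilin P X X + 2 * bilin P X Y + bilin P Y Y.
  by rewrite bilinDr (bilinC PT (X + Y) X) (bilinC PT (X + Y) Y) !bilinDr (bilinC PT Y X); ring.
have hZ : Z = d *: (F + e) by [].
clearbody Z; rewrite E.
have -> : bilin P X Z = d * (bilin P X F + bilin P X e) by rewrite hZ bilinZr bilinDr.
have -> : bilin P Z Z = d * bilin P Z (F + e) by rewrite {2}hZ bilinZr.
by ring.
Qed.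

Lemma L2_increment v v' T E (d : R) : in_L2 v -> in_L2 T -> in_L2 E ->
  (forall x, 0 <= x <= 1 -> v' x - v x = d * (T x + E x)) ->
  L2norm v' ^+ 2 = L2norm v ^+ 2 +
    d * (2 * ip v T + (2 * ip v E + ip (fun x => v' x - v x) (fun x => T x + E x))).
Proof.
move=> Lv LT LE h.
pose G x := T x + E x; have LG : in_L2 G by exact: L2D.
have LdG : in_L2 (fun x => d * G x) by exact: L2Z.
have L' : in_L2 v' by apply: eq_L2 (L2D Lv LdG) => x x01; rewrite -h// addrC subrK.
rewrite -!ip_ff.
have -> : ip v' v' = ip v v + ip v' (fun x => v' x - v x) + ip v (fun x => v' x - v x).
  by rewrite !ip_sub// [ip v v']ipC; ring.
have e1 f : in_L2 f -> ip f (fun x => v' x - v x) = d * ip f G.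
  move=> Lf; rewrite (eq_ip (f' := f) (g' := fun x => 0 * G x + d * G x))//.
    by rewrite ipDr// ?(ipDr Lf)//; [rewrite (_ : ip f (fun x => 0 * G x) = 0) ?add0r//;
      rewrite /ip (eq_int (g := fun=> 0)) ?int_cst ?mul0r// => x _; rewrite mul0r mulr0
      |exact: L2Z].
  by move=> x x01; rewrite mul0r add0r h.
have e2 : ip (fun x => v' x - v x) G = ip v' G - ip v G.
  by rewrite ipC ip_sub// ![ip G _]ipC.
rewrite !e1// -/G e2 -addrA -mulrDr; congr (_ + _ * _).
by rewrite [ip v G]ip_add//; ring.
Qed.

(** Solutions are differentiable in time only with values in L^2, so that the
    norm of v' has to be handled by increments: with D = v(s) - v(t),
      |v'(s)|^2 - |v'(t)|^2 = D(1) * v'(1, s) - int D * (v''(s) + v''(t)),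
    where D / (s - t) converges in L^2. The boundary term is of smaller order
    than d = s - t: |v'(1, s)| is the increment of the feedback at most, hence
    O(d) + O(|D(1)|), and D(1)^2 <= |D|^2 + 2 * |D| * |D'| with |D| = O(d) and
    D' small. The number k bounds everything that tends to zero. *)
Lemma step_bound X F v v1 v2 T : ac v v1 -> ac v1 v2 -> in_L2 v2 -> in_L2 T ->
  v1 0 = 0 -> v1 1 = 0 -> exists2 M : R, 0 <= M &
  forall (k d : R) X' (e : 'cV[R]_n) v' v1' v2' E,
    0 <= k <= 1 -> 0 < d -> ac v' v1' -> ac v1' v2' -> in_L2 v2' -> in_L2 E ->
    v1' 0 = 0 -> X' - X = d *: (F + e) ->
    (forall x, 0 <= x <= 1 -> v' x - v x = d * (T x + E x)) ->
    `|v1' 1| <= g1 * enorm (X' - X) + g2 * L2norm (fun x => v' x - v x) +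
                g3 * `|v' 1 - v 1| ->
    enorm e <= k -> L2norm E <= k -> enorm (X' - X) <= k ->
    L2norm (fun x => v' x - v x) <= k -> L2norm (fun x => v1' x - v1 x) <= k ->
    L2norm (fun x => v2' x - v2 x) <= k ->
    bilin P X' X' + p1 * L2norm v' ^+ 2 + p2 * L2norm v1' ^+ 2 <=
    bilin P X X + p1 * L2norm v ^+ 2 + p2 * L2norm v1 ^+ 2 +
    d * (2 * bilin P X F + p1 * (2 * ip v T) - p2 * (2 * ip T v2) + M * k).
Proof.
move=> av av1 L2 LT v10 v11.
have [C C0 hC] := bilin_bound P.
have Lv := ac_L2 av; have Lv1 := ac_L2 av1.
pose g := L2norm T + 1; have g0 : 0 <= g by rewrite addr_ge0 ?L2norm_ge0.
pose f := enorm F + 1; have f0 : 0 <= f by rewrite addr_ge0 ?enorm_ge0.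
pose Ma := 2 * (C * enorm X) + C * f.
pose Mb := 2 * L2norm v + g.
pose Mc := 2 * L2norm v2 + g + (3 * (g1 * f + g2 * g) + 3 * (g3 * g)).
have Ma0 : 0 <= Ma by rewrite /Ma !(addr_ge0, mulr_ge0) ?enorm_ge0.
have Mb0 : 0 <= Mb by rewrite /Mb !(addr_ge0, mulr_ge0) ?L2norm_ge0.
have Mc0 : 0 <= Mc by rewrite /Mc !(addr_ge0, mulr_ge0) ?L2norm_ge0 ?enorm_ge0.
exists (Ma + p1 * Mb + p2 * Mc); first by apply: addr_ge0; [apply: addr_ge0 => //; exact: mulr_ge0|exact: mulr_ge0].
move=> k d X' e v' v1' v2' E /andP[k0 k1] d0 av' av1' L2' LE v1'0 hX hv hb he hE hdX hdv hdv1 hdv2.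
have Lv' := ac_L2 av'; have Lv1' := ac_L2 av1'.
pose G x := T x + E x; have LG : in_L2 G by exact: L2D.
have Gg : L2norm G <= g.
  apply: le_trans (L2norm_triangle LT LE) _; rewrite /g lerD2l; exact: le_trans hE k1.
have Ff : enorm (F + e) <= f.
  apply: le_trans (enorm_trD _ _) _; rewrite /f lerD2l; exact: le_trans he k1.
have dX2 : enorm (X' - X) <= d * f.
  by rewrite hX enormZ ger0_norm ?(ltW d0)// ler_wpM2l// ltW.
have Ldv : in_L2 (fun x => v' x - v x) by exact: L2B.
have dv2 : L2norm (fun x => v' x - v x) <= d * g.
  rewrite (eq_L2norm (g := fun x => d * G x))// L2normZ// ger0_norm ?(ltW d0)//.
  by rewrite ler_wpM2l// ltW.
have adv : ac (fun x => v' x - v x) (fun x => v1' x - v1 x) by exact: acB.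
have Ldv1 : in_L2 (fun x => v1' x - v1 x) by exact: L2B.
have Ldv2 : in_L2 (fun x => v2' x - v2 x) by exact: L2B.
have bound1 : bilin P X' X' <= bilin P X X + d * (2 * bilin P X F + Ma * k).
  rewrite (bilin_increment hX) lerD2l ler_wpM2l ?(ltW d0)// lerD2l.
  rewrite /Ma [leRHS]mulrDl; apply: lerD.
    rewrite -mulrA ler_wpM2l// (le_trans (ler_norm _))// (le_trans (hC _ _))//.
    by rewrite ler_wpM2l// mulr_ge0// enorm_ge0.
  rewrite (le_trans (ler_norm _))// (le_trans (hC _ _))// mulrAC.
  by apply: ler_pM => //; rewrite ?mulr_ge0 ?enorm_ge0//; apply: ler_wpM2l.
have bound2 : L2norm v' ^+ 2 <= L2norm v ^+ 2 + d * (2 * ip v T + Mb * k).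
  rewrite (L2_increment Lv LT LE hv) lerD2l ler_wpM2l ?(ltW d0)// lerD2l.
  rewrite /Mb [leRHS]mulrDl -[2 * _ * k]mulrA; apply: lerD.
    rewrite ler_wpM2l// (le_trans (ler_norm _))//; exact: ip_CS.
  by rewrite mulrC (le_trans (ler_norm _))//; rewrite mulrC; apply: le_trans (ip_CS Ldv LG hdv Gg) _; rewrite mulrC.
have D1 : (v' 1 - v 1) ^+ 2 <= 3 * (d * g * k).
  apply: le_sum3 (agmon1 adv Ldv1) _ _; rewrite ?expr2;
  by apply: ler_pM => //; exact: L2norm_ge0.
have D2 : `|v' 1 - v 1| <= 3 * k.
  rewrite -ler_sqr ?nnegrE ?mulr_ge0// real_normK ?num_real//.
  apply: (@le_trans _ _ (3 * (k * k))).
    apply: le_sum3 (agmon1 adv Ldv1) _ _; rewrite ?expr2;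
    by apply: ler_pM => //; exact: L2norm_ge0.
  by rewrite exprMn -expr2 ler_wpM2r ?sqr_ge0// expr2; lra.
have D3 : (v' 1 - v 1) * v1' 1 <= d * ((3 * (g1 * f + g2 * g) + 3 * (g3 * g)) * k).
  rewrite (le_trans (ler_norm _))// normrM.
  apply: le_trans (ler_wpM2l (normr_ge0 _) hb) _; rewrite mulrDr.
  have h1 : g1 * enorm (X' - X) + g2 * L2norm (fun x => v' x - v x) <= d * (g1 * f + g2 * g).
    rewrite mulrDr; apply: lerD; rewrite mulrCA; exact: ler_wpM2l.
  have h2 : `|v' 1 - v 1| * (g1 * enorm (X' - X) + g2 * L2norm (fun x => v' x - v x)) <=
     3 * k * (d * (g1 * f + g2 * g)).
    by apply: ler_pM => //; rewrite addr_ge0 ?mulr_ge0 ?enorm_ge0 ?L2norm_ge0.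
  have h3 : `|v' 1 - v 1| * (g3 * `|v' 1 - v 1|) <= g3 * (3 * (d * g * k)).
    by rewrite mulrCA -expr2 real_normK ?num_real// ler_wpM2l.
  apply: le_trans (lerD h2 h3) _; rewrite le_eqVlt; apply/orP; left; apply/eqP; ring.
have Lsum2 : in_L2 (fun x => v2' x + v2 x) by exact: L2D.
have bound3 : L2norm v1' ^+ 2 <= L2norm v1 ^+ 2 + d * (- (2 * ip T v2) + Mc * k).
  have e1 : L2norm v1' ^+ 2 - L2norm v1 ^+ 2 =
      ip (fun x => v1' x - v1 x) (fun x => v1' x + v1 x).
    rewrite -!ip_ff ip_add// ![ip (fun x => v1' x - v1 x) _]ipC !ip_sub//.
    by rewrite [ip v1 v1']ipC; ring.
  have := ip_parts adv (acD av1' av1).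
  rewrite v1'0 v10 v11 !addr0 mulr0 subr0 -e1.
  have -> : ip (fun x => v' x - v x) (fun x => v2' x + v2 x) =
     d * (2 * ip T v2 + (2 * ip E v2 + ip G (fun x => v2' x - v2 x))).
    have -> : ip (fun x => v' x - v x) (fun x => v2' x + v2 x) = d * ip G (fun x => v2' x + v2 x).
      rewrite (eq_ip (f' := fun x => 0 * G x + d * G x) (g' := fun x => v2' x + v2 x))//; last first.
        by move=> x x01; rewrite mul0r add0r hv.
      rewrite ipDl//; last exact: L2Z.
      rewrite (_ : ip (fun x => 0 * G x) _ = 0) ?add0r//.
      by rewrite /ip (eq_int (g := fun=> 0)) ?int_cst ?mul0r// => x _; rewrite !mul0r.
    congr (d * _); rewrite ip_add// ip_sub//.
    have -> : ip G v2 = ip T v2 + ip E v2 by rewrite ipC ip_add// ![ip v2 _]ipC.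
    by ring.
  have i1 : - (2 * ip E v2) <= 2 * L2norm v2 * k.
    have := ip_CS LE L2 hE (lexx _); rewrite ler_norml lerNl => /andP[h _].
    by rewrite -mulrN -mulrA ler_wpM2l// mulrC.
  have i2 : - ip G (fun x => v2' x - v2 x) <= g * k.
    by have := ip_CS LG Ldv2 Gg hdv2; rewrite ler_norml lerNl => /andP[].
  have i3 : d * (- (2 * ip E v2) + - ip G (fun x => v2' x - v2 x)) <= d * (2 * L2norm v2 * k + g * k).
    by rewrite ler_wpM2l ?(ltW d0)// lerD.
  move=> e2; rewrite -lerBlDl e2 /Mc; move: i3 D3.
  move: (ip G _) (ip E v2) (ip T v2) (_ * v1' 1) (L2norm v2) => *.
  lra.
move: bound1 {bound2 bound3 D1 D2 D3 Ma0 Mb0 Mc0} (ler_wpM2l p10 bound2) (ler_wpM2l p20 bound3).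
move: (bilin P X X) (bilin P X F) (bilin P X' X') (ip v T) (ip T v2) => ? ? ? ? ?.
move: (L2norm v1' ^+ 2) (L2norm v1 ^+ 2) (L2norm v' ^+ 2) (L2norm v ^+ 2) Ma Mb Mc => *.
lra.
Qed.

End Step.

(** * Differences of states, saturation *)

Section Differences.
Context {R : realType} {n : nat}.
Variables (A : 'M[R]_n) (B : 'cV[R]_n) (a : R) (K : 'rV[R]_n) (c : R).
Implicit Types (X Y : 'cV[R]_n) (u v : R -> R) (x y : R).
Local Notation vT := (vtr A B a K c).
Local Notation v1T := (vtr1 A B a K c).
Local Notation fb := (feedback A B a K c).

Lemma le_comb2 (p q x y : R) : 0 <= x -> 0 <= y ->
  p * y + q * x <= (`|p| + `|q|) * (x + y).
Proof.
move=> x0 y0.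
have h1 : p * y <= `|p| * y by rewrite ler_wpM2r// ler_norm.
have h2 : q * x <= `|q| * x by rewrite ler_wpM2r// ler_norm.
have h3 : 0 <= `|p| * x by rewrite mulr_ge0.
have h4 : 0 <= `|q| * y by rewrite mulr_ge0.
by rewrite mulrDl !mulrDr; move: h1 h2 h3 h4; lra.
Qed.

Lemma vtr_L2 : exists2 C, 0 <= C & forall X u, in_L2 u ->
  in_L2 (vT X u) /\ L2norm (vT X u) <= C * (enorm X + L2norm u).
Proof.
pose mq := max_on triangle (fun p : R * R => `|q_ker a c p.1 p.2|).
pose mk := max_on triangle (fun p : R * R => `|k_ker A B a K p.1 p.2|).
pose mg := max_on `[0, 1] (fun x : R => enorm (gamma_ker A a K x)).
pose C := `|1 + mq| * (`|1 + mk| + `|mg|).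
exists C => [|X u Lu]; first by rewrite mulr_ge0// addr_ge0.
have Iu := L2_intg Lu.
have Lw : in_L2 (wtr A B a K X u).
  by apply: L2B => //; exact: ac_L2 (K1_St_ac B a K A X Iu).
have Lv : in_L2 (vT X u).
  apply: eq_L2 (L2D Lw (bmeas_L2 (volterra_bmeas (skernel_gk (a + c)) (L2_intg Lw)))).
  by move=> x x01; rewrite -(qtrE a c (L2_intg Lw) x01).
split => //; apply: le_trans (qtr_norm a c Lw) _; rewrite -/mq /C -mulrA.
apply: (@le_trans _ _ (`|1 + mq| * L2norm (wtr A B a K X u))).
  by rewrite ler_wpM2r ?L2norm_ge0// ler_norm.
rewrite ler_wpM2l//; apply: le_trans (wtr_norm A B a K X Lu) _.
by apply: le_comb2; [exact: enorm_ge0|exact: L2norm_ge0].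
Qed.

Lemma vtr1_L2 : exists2 C, 0 <= C & forall X u u1, ac u u1 -> in_L2 u1 ->
  in_L2 (v1T X u u1) /\
  L2norm (v1T X u u1) <= C * (enorm X + L2norm u + L2norm u1).
Proof.
pose m1 := M1 A a K c; pose m2 := M2 A B a K c.
have m10 : 0 <= m1 by exact: M1_ge0.
have m20 : 0 <= m2 by exact: M2_ge0.
pose C := Num.sqrt (m1 + m2 + 4).
exists C => [|X u u1 au Lu1]; first exact: sqrtr_ge0.
have Iu := ac_intg au; have aw := wtr_ac A B a K X au.
split.
  apply: L2D; first by apply: L2B => //; exact: ac_L2 (K0_St_ac B a K A X Iu).
  apply: L2D; last exact: bmeas_L2 (volterra_bmeas (skernel_gkx (a + c)) (ac_intg aw)).
  apply: L2M (ac_L2 aw); apply: eq_bmeas (bmeasZ ((a + c) / 2) (ac_bmeas ac_idfun)) => x _.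
  by rewrite gk_diag.
have := transform_bound A B a K c X au Lu1; rewrite -/m1 -/m2.
have := enorm_ge0 X; have := L2norm_ge0 u; have := L2norm_ge0 u1.
have := sqr_ge0 (enorm X); have := sqr_ge0 (L2norm (vT X u)).
set V := L2norm (vT X u); set V1 := L2norm (v1T X u u1).
have V10 : 0 <= V1 by exact: L2norm_ge0.
move: (enorm X) (L2norm u) (L2norm u1) V => x y y1 V V0 x2 y10 y0 x0 h.
have s0 : 0 <= x + y + y1 by rewrite !addr_ge0.
rewrite -(ger0_norm s0) -sqrtr_sqr -sqrtrM; last by apply: addr_ge0 => //; exact: addr_ge0.
apply: le_sqrtr => //; apply: (@le_trans _ _ (m1 * x ^+ 2 + m2 * y ^+ 2 + 4 * y1 ^+ 2)).
  by move: h; lra.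
have e1 : x ^+ 2 <= (x + y + y1) ^+ 2.
  by rewrite ler_sqr ?nnegrE// -addrA lerDl addr_ge0.
have e2 : y ^+ 2 <= (x + y + y1) ^+ 2.
  by rewrite ler_sqr ?nnegrE// addrAC lerDr addr_ge0.
have e3 : y1 ^+ 2 <= (x + y + y1) ^+ 2.
  by rewrite ler_sqr ?nnegrE// lerDr addr_ge0.
rewrite (mulrDl (m1 + m2)) (mulrDl m1); apply: lerD; last by apply: ler_wpM2l.
by apply: lerD; apply: ler_wpM2l.
Qed.

Lemma vtr_sub X Y u v x : intg u -> intg v -> 0 <= x <= 1 ->
  vT (X - Y) (u - v) x = vT X u x - vT Y v x.
Proof.
move=> Iu Iv x01; rewrite -[- vT Y v x]mulN1r -(vtr_lin _ _ _ _ _ X Y (-1) Iu Iv x01).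
rewrite scaleN1r; congr (vtr _ _ _ _ _ _ _ _).
by apply/funext => y; rewrite mulN1r.
Qed.

Lemma vtr1_sub X Y u u1 v v1 x : intg u -> intg v -> 0 <= x <= 1 ->
  v1T (X - Y) (u - v) (fun x => u1 x - v1 x) x = v1T X u u1 x - v1T Y v v1 x.
Proof.
move=> Iu Iv x01.
rewrite -[- v1T Y v v1 x]mulN1r -(vtr1_lin _ _ _ _ _ X u1 Y v1 (-1) Iu Iv x01).
rewrite scaleN1r; congr (vtr1 _ _ _ _ _ _ _ _ _).
  by apply/funext => y; rewrite mulN1r.
by apply/funext => y; rewrite mulN1r.
Qed.

(** By vtr1_at1 the feedback is, up to the sign, the value at 1 of v1T at u1 = 0,
    which is linear. *)
Lemma feedback_sub X Y u v : intg u -> intg v ->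
  fb (X - Y, u - v) = fb (X, u) - fb (Y, v).
Proof.
move=> Iu Iv; have Iuv : intg (u - v) by exact: intgB.
have i1 : 0 <= (1 : R) <= 1 by rewrite ler01 lexx.
have := vtr1_sub X Y (fun=> 0) (fun=> 0) Iu Iv i1.
rewrite subr0 !vtr1_at1// !sub0r opprK => h.
by rewrite -[LHS]opprK h opprD opprK.
Qed.

Lemma vtr_add X Y u v x : intg u -> intg v -> 0 <= x <= 1 ->
  vT (X + Y) (fun x => u x + v x) x = vT X u x + vT Y v x.
Proof.
move=> Iu Iv x01; rewrite -[vT Y v x]mul1r -(vtr_lin _ _ _ _ _ X Y 1 Iu Iv x01).
rewrite scale1r; congr (vtr _ _ _ _ _ _ _ _).
by apply/funext => y; rewrite mul1r.
Qed.

Lemma vtr_scale X u b x : intg u -> 0 <= x <= 1 ->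
  vT (b *: X) (fun x => b * u x) x = b * vT X u x.
Proof.
move=> Iu x01.
have h0 := vtr_lin A B a K c 0 X b (intg_cst 0) Iu x01.
have z0 := vtr_lin A B a K c 0 (0 : 'cV[R]_n) (-1) (intg_cst 0) (intg_cst 0) x01.
rewrite scaler0 addr0 mulr0 addr0 in z0.
have {}z0 : vT 0 (fun=> 0) x = 0 by rewrite z0 mulN1r subrr.
rewrite add0r (_ : (fun y => 0 + b * u y) = (fun y => b * u y)) in h0; last first.
  by apply/funext => y; rewrite add0r.
by rewrite h0 z0 add0r.
Qed.

Lemma sat_id (U ub : R) : `|U| <= ub -> sat U ub = U.
Proof. by move=> h; rewrite /sat min_l// [RHS]numEsg. Qed.

(** Saturation is the projection onto [-ub, ub], to which V belongs. *)
Lemma sat_close (U V ub : R) : `|V| <= ub -> `|sat U ub - U| <= `|U - V|.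
Proof.
move=> hV; have [h|h] := leP `|U| ub; first by rewrite sat_id// subrr normr0.
rewrite /sat min_r; last exact: ltW.
move: hV h; rewrite ler_norml => /andP[V1 V2].
have [U0|U0] := leP 0 U.
  rewrite ger0_norm// => h; have U1 : 0 < U by apply: le_lt_trans h; lra.
  rewrite gtr0_sg// mul1r distrC ger0_norm ?subr_ge0 ?(ltW h)//.
  by apply: (@le_trans _ _ (U - V)); [lra|exact: ler_norm].
rewrite ltr0_norm// => h; rewrite ltr0_sg// mulN1r ger0_norm; last by lra.
by rewrite distrC; apply: (@le_trans _ _ (V - U)); [lra|exact: ler_norm].
Qed.

End Differences.

(** * Trajectories in time *)

Section Trajectory.
Context {R : realType} {n : nat}.
Local Notation state := ('cV[R]_n * (R -> R))%type.

Lemma cont_inP (V : zmodType) (N : V -> R) (S : set R) (F : R -> V) :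
  cont_in N S F -> forall t, S t -> forall e : R, 0 < e -> exists2 d : R, 0 < d &
  forall s, S s -> `|s - t| < d -> N (F s - F t) < e.
Proof.
move=> cF t St e e0; have /cvg_withinP/(_ e e0)[d d0 hd] := cF t St.
by exists d => // s Ss st; have := hd s Ss st; rewrite subr0; apply: le_lt_trans (ler_norm _).
Qed.

Lemma deriv_inP (V : lmodType R) (N : V -> R) (S : set R) (F F' : R -> V) :
  deriv_in N S F F' -> forall t, S t -> forall e : R, 0 < e -> exists2 d : R, 0 < d &
  forall s, S s -> s != t -> `|s - t| < d -> N ((s - t)^-1 *: (F s - F t) - F' t) < e.
Proof.
move=> cF t St e e0; have /cvg_dwithinP/(_ e e0)[d d0 hd] := cF t St.
exists d => // s Ss nst st; have := hd s Ss nst st.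
by rewrite subr0; apply: le_lt_trans (ler_norm _).
Qed.

Variables (A A1 : 'M[R]_n) (B : 'cV[R]_n) (a a2 : R) (K : 'rV[R]_n) (c : R).
Variables (ubar h h0 : R) (tau : R -> R) (z0 z : R -> state).
Hypotheses (h00 : 0 < h0) (hpos : 0 < h) (hW : W1 A B a K c h z0).
Hypothesis (htau : admissible_delay h0 h tau).
Hypothesis (hz : classical_solution A A1 B a a2 K c ubar h tau z0 z).

Lemma traj_H2 t : - h <= t -> in_H2 (z t).2.
Proof.
move=> ht; case: hz => zE [H2 _] _ _ _; have [t0|t0] := leP 0 t; first exact: H2.
have th : - h <= t <= 0 by rewrite ht ltW.
by rewrite zE//; case: hW => /(_ t th)[].
Qed.

Lemma S0P t : (`[0%R, +oo[%classic : set R) t <-> 0 <= t.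
Proof. by rewrite /= in_itv/= andbT. Qed.

(** The two one-sided continuities are glued at 0. *)
Lemma traj_cont t (e : R) : - h <= t -> 0 < e -> exists2 d : R, 0 < d &
  forall s, - h <= s -> `|s - t| < d -> normH2 (z s - z t) < e.
Proof.
move=> ht e0; case: hz => zE [_ cz] _ _ _; case: hW => _ cz0 _.
have right : 0 <= t -> exists2 d : R, 0 < d &
    forall s, 0 <= s -> `|s - t| < d -> normH2 (z s - z t) < e.
  move=> t0; have [d d0 hd] := cont_inP cz ((S0P t).2 t0) e0.
  by exists d => // s /S0P; exact: hd.
have left : t <= 0 -> exists2 d : R, 0 < d &
    forall s, - h <= s <= 0 -> `|s - t| < d -> normH2 (z s - z t) < e.
  move=> t0; have St : (`[- h, 0]%classic : set R) t by rewrite /= in_itv/= ht.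
  have [d d0 hd] := cont_inP cz0 St e0.
  have th : - h <= t <= 0 by rewrite ht.
  exists d; first exact: d0.
  move=> s s0 st; rewrite (zE s s0) (zE t th).
  by apply: (hd s _ st); rewrite /= in_itv.
have [t0|t0|t0] := ltgtP t 0.
- have [d d0 hd] := left (ltW t0); exists (Num.min d (- t)).
    by rewrite lt_min d0 oppr_gt0.
  move=> s hs; rewrite lt_min => /andP[sd st]; apply: hd => //.
  by rewrite hs/=; move: st; move/(le_lt_trans (ler_norm _)); rewrite ltrBlDr addNr => /ltW.
- have [d d0 hd] := right (ltW t0); exists (Num.min d t).
    by rewrite lt_min d0.
  move=> s hs; rewrite lt_min distrC => /andP[sd st]; apply: hd => //; last by rewrite distrC.
  by move: st; move/(le_lt_trans (ler_norm _)); rewrite ltrBlDr ltrDl => /ltW.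
have [d d0 hd] := right (ltac:(by rewrite t0)).
have [d' d'0 hd'] := left (ltac:(by rewrite t0)).
exists (Num.min d d'); first by rewrite lt_min d0.
move=> s hs; rewrite lt_min => /andP[sd sd'].
have [s0|s0] := leP 0 s; first exact: hd.
by apply: hd' => //; rewrite hs ltW.
Qed.

Lemma delay_bounds t : 0 <= t -> 0 <= tau t <= h.
Proof. by move=> t0; case: htau => _ /(_ t t0)[t1 t2]; rewrite t2 (le_trans _ t1)// ltW. Qed.

Lemma delay_ge t : 0 <= t -> - h <= t - tau t.
Proof. by move=> t0; have /andP[_ t2] := delay_bounds t0; lra. Qed.

Lemma delay_cont t (e : R) : 0 <= t -> 0 < e -> exists2 d : R, 0 < d &
  forall s, 0 <= s -> `|s - t| < d -> `|tau s - tau t| < e.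
Proof.
move=> t0 e0; case: htau => [[tau' [dt _]] _].
have [d d0 hd] := deriv_inP dt ((S0P t).2 t0) ltr01.
(* differentiability at t bounds the difference quotients by C near t *)
pose C := 1 + `|tau' t|; have C0 : 0 < C by rewrite ltr_pwDl.
exists (Num.min d (e / C)); first by rewrite lt_min d0 divr_gt0.
move=> s s0; rewrite lt_min => /andP[sd se].
have [->|nst] := eqVneq s t; first by rewrite subrr normr0.
have := hd s ((S0P s).2 s0) nst sd => h1.
have st0 : s - t != 0 by rewrite subr_eq0.
have h2 : `|(s - t)^-1 *: (tau s - tau t)| < C.
  rewrite -(subrK (tau' t) (_ *: _)); apply: le_lt_trans (ler_normD _ _) _.
  by rewrite ltrD2r.
have -> : tau s - tau t = (s - t) * ((s - t)^-1 *: (tau s - tau t)).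
  by rewrite /GRing.scale/= mulrA divff// mul1r.
rewrite normrM; have [e2|e2] := eqVneq `|s - t| 0; first by rewrite e2 mul0r.
have n0 : 0 < `|s - t| by rewrite lt_neqAle eq_sym e2 normr_ge0.
apply: (@lt_trans _ _ (`|s - t| * C)); first by rewrite ltr_pM2l.
by rewrite -ltr_pdivlMr.
Qed.

Lemma delayed_cont t (e : R) : 0 <= t -> 0 < e -> exists2 d : R, 0 < d &
  forall s, 0 <= s -> `|s - t| < d -> normH2 (z (s - tau s) - z (t - tau t)) < e.
Proof.
move=> t0 e0; have [d d0 hd] := traj_cont (delay_ge t0) e0.
have d20 : 0 < d / 2 by rewrite divr_gt0.
have [d' d'0 hd'] := delay_cont t0 d20.
exists (Num.min (d / 2) d'); first by rewrite lt_min d20.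
move=> s s0; rewrite lt_min => /andP[sd sd']; apply: hd; first exact: delay_ge.
rewrite (_ : s - tau s - (t - tau t) = (s - t) - (tau s - tau t)); last by ring.
by rewrite (le_lt_trans (ler_normB _ _))// [d]splitr ltrD// hd'.
Qed.

Lemma rhs_cont t (e : R) : 0 <= t -> 0 < e -> exists2 d : R, 0 < d &
  forall s, 0 <= s -> `|s - t| < d ->
  normH (rhs A A1 B a a2 tau z s - rhs A A1 B a a2 tau z t) < e.
Proof.
move=> t0 e0; case: hz => _ _ [_ cr] _ _.
have [d d0 hd] := cont_inP cr ((S0P t).2 t0) e0.
by exists d => // s /S0P; exact: hd.
Qed.

Lemma rhs_deriv t (e : R) : 0 <= t -> 0 < e -> exists2 d : R, 0 < d &
  forall s, t < s < t + d ->
  normH ((s - t)^-1 *: (z s - z t) - rhs A A1 B a a2 tau z t) < e.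
Proof.
move=> t0 e0; case: hz => _ _ [dr _] _ _.
have [d d0 hd] := deriv_inP dr ((S0P t).2 t0) e0.
exists d => // s /andP[ts sd]; apply: hd.
- by apply/S0P; rewrite (le_trans t0)// ltW.
- by rewrite gt_eqF.
- by rewrite ger0_norm ?subr_ge0 ?(ltW ts)// ltrBlDl.
Qed.

Lemma bounded_seg (f : R -> R) : (forall t (e : R), - h <= t <= 0 -> 0 < e ->
    exists2 d : R, 0 < d & forall s, - h <= s <= 0 -> `|s - t| < d -> `|f s - f t| < e) ->
  forall t, - h <= t <= 0 -> f t <= max_on `[- h, 0] f.
Proof.
move=> cf t ht; have h0' : - h <= 0 by rewrite oppr_le0 ltW.
have cw : {within `[- h, 0], continuous f}.
  apply/subspace_continuousP => x; rewrite /= in_itv/= => hx.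
  apply/cvg_withinP => e e0; have [d d0 hd] := cf x e hx e0.
  by exists d => // y; rewrite /= in_itv/=; exact: hd.
have [m _ hm] := EVT_max h0' cw.
apply: (@le_max_on _ _ `[- h, 0] f (f m)); last by rewrite /= in_itv.
by move=> s; rewrite /= => hs; apply: hm.
Qed.

Lemma sqr_cont (f : R -> R) : (forall t (e : R), - h <= t <= 0 -> 0 < e ->
    exists2 d : R, 0 < d & forall s, - h <= s <= 0 -> `|s - t| < d -> `|f s - f t| < e) ->
  forall t (e : R), - h <= t <= 0 -> 0 < e ->
    exists2 d : R, 0 < d & forall s, - h <= s <= 0 -> `|s - t| < d -> `|f s ^+ 2 - f t ^+ 2| < e.
Proof.
move=> cf t e ht e0; pose C := 2 * `|f t| + 1.
have C0 : 0 < C by rewrite ltr_wpDl// mulr_ge0.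
have m0 : 0 < Num.min 1 (e / C) by rewrite lt_min ltr01 divr_gt0.
have [d d0 hd] := cf t _ ht m0; exists d => // s hs st.
have := hd s hs st; rewrite lt_min => /andP[h1 h2].
rewrite subr_sqr normrM.
have h3 : `|f s + f t| <= C.
  have -> : f s + f t = (f s - f t) + (f t + f t) by ring.
  apply: le_trans (ler_normD _ _) _; rewrite /C addrC lerD//; last exact: ltW.
  by apply: le_trans (ler_normD _ _) _; lra.
apply: (@le_lt_trans _ _ (`|f s - f t| * C)); first by rewrite ler_wpM2l.
by rewrite -ltr_pdivlMr.
Qed.

Lemma enorm_subl (X Y : 'cV[R]_n) : `|enorm X - enorm Y| <= enorm (X - Y).
Proof.
have h1 := enorm_trD (X - Y) Y; rewrite subrK in h1.
have h2 := enorm_trD (Y - X) X; rewrite subrK in h2.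
have h3 : enorm (Y - X) = enorm (X - Y).
  by rewrite -opprB -scaleN1r enormZ normrN1 mul1r.
by rewrite ler_norml; apply/andP; split; lra.
Qed.

Lemma L2norm_subl (f g : R -> R) : in_L2 f -> in_L2 g ->
  `|L2norm f - L2norm g| <= L2norm (f - g).
Proof.
move=> Lf Lg; have Lfg := L2B Lf Lg; have Lgf := L2B Lg Lf.
have h1 := L2norm_triangle Lfg Lg.
have h2 := L2norm_triangle Lgf Lf.
rewrite (eq_L2norm (g := f)) in h1; last by move=> x _; rewrite subrK.
rewrite (eq_L2norm (g := g)) in h2; last by move=> x _; rewrite subrK.
have h3 : L2norm (fun x => g x - f x) = L2norm (fun x => f x - g x).
  by rewrite -L2normN; apply: eq_L2norm => x _; rewrite opprB.
by rewrite ler_norml; apply/andP; split; move: h1 h2 h3;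
  rewrite -[L2norm (f - g)]/(L2norm (fun x => f x - g x)); lra.
Qed.

Lemma traj_dx_sub s t : - h <= s -> - h <= t ->
  L2norm (dx (z s - z t).2) = L2norm (fun x => dx (z s).2 x - dx (z t).2 x).
Proof.
move=> hs ht; apply: eq_L2norm => x x01; rewrite /=.
by apply: dx_sub => //; exact: traj_H2.
Qed.

(** Continuity in time on the compact [-h, 0] makes these suprema bounds. *)
Lemma initial_max t : - h <= t <= 0 ->
  [/\ enorm (z t).1 ^+ 2 <= max_on `[- h, 0] (fun t => enorm (z0 t).1 ^+ 2),
      L2norm (z t).2 ^+ 2 <= max_on `[- h, 0] (fun t => L2norm (z0 t).2 ^+ 2) &
      L2norm (dx (z t).2) ^+ 2 <= max_on `[- h, 0] (fun t => L2norm (dx (z0 t).2) ^+ 2)].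
Proof.
move=> ht; case: hz => zE _ _ _ _.
have lo s : - h <= s <= 0 -> - h <= s by case/andP.
have cont (f : state -> R) : (forall s t, - h <= s -> - h <= t ->
     `|f (z s) - f (z t)| <= normH2 (z s - z t)) ->
   f (z t) ^+ 2 <= max_on `[- h, 0] (fun t => f (z0 t) ^+ 2).
  move=> fz; rewrite zE//.
  apply: (bounded_seg _ ht); apply: sqr_cont => {}t e {}ht e0.
  have [d d0 hd] := traj_cont (lo t ht) e0; exists d => // s hs st.
  have := hd s (lo s hs) st; apply: le_lt_trans.
  by rewrite -!zE//; apply: fz; exact: lo.
split.
- apply: (cont (fun z => enorm z.1)) => s s' hs hs'.
  by apply: le_trans (enorm_subl _ _) (normH2_X (z s - z s')).
- apply: (cont (fun z => L2norm z.2)) => s s' hs hs'.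
  have [/H1_ac f1 _] := traj_H2 hs; have [/H1_ac f2 _] := traj_H2 hs'.
  by apply: le_trans (L2norm_subl (ac_L2 f1) (ac_L2 f2)) (normH2_u (z s - z s')).
- apply: (cont (fun z => L2norm (dx z.2))) => s s' hs hs'.
  have [_ _ _ f1] := H2_ac (traj_H2 hs); have [_ _ _ f2] := H2_ac (traj_H2 hs').
  apply: le_trans (L2norm_subl f1 f2) _.
  by rewrite -[L2norm (_ - _)]/(L2norm (fun x => dx (z s).2 x - dx (z s').2 x)) -traj_dx_sub//; exact: normH2_ux.
Qed.

End Trajectory.

(** * The trajectory of the target system *)

Section ClosedLoop.
Context {R : realType} {n : nat}.
Local Notation state := ('cV[R]_n * (R -> R))%type.

Lemma source_regroup (t q cv v2 aw g : R) : t = q + (aw + g) -> v2 = q + cv ->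
  t = v2 - cv + aw + g.
Proof. by move=> -> ->; ring. Qed.

Lemma source_regroupB (k l t t' v v' w w' g g' q q' : R) :
  t = q - k * v + l * w + g -> t' = q' - k * v' + l * w' + g' ->
  q - q' = ((t - t') + k * (v - v')) - (l * (w - w') + (g - g')).
Proof. by move=> -> ->; ring. Qed.

Lemma L2norm_comb4 (k l n1 n2 n3 n4 : R) (f1 f2 f3 f4 : R -> R) :
  in_L2 f1 -> in_L2 f2 -> in_L2 f3 -> in_L2 f4 ->
  L2norm f1 <= n1 -> L2norm f2 <= n2 -> L2norm f3 <= n3 -> L2norm f4 <= n4 ->
  L2norm (fun x => (f1 x + k * f2 x) - (l * f3 x + f4 x)) <=
  n1 + `|k| * n2 + (`|l| * n3 + n4).
Proof.
move=> L1 L2 L3 L4 h1 h2 h3 h4.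
apply: le_trans (L2norm_triangleB (L2D L1 (L2Z k L2)) (L2D (L2Z l L3) L4)) _.
apply: lerD.
  apply: le_trans (L2norm_triangle L1 (L2Z k L2)) _; rewrite L2normZ//.
  by apply: lerD => //; apply: ler_wpM2l.
apply: le_trans (L2norm_triangle (L2Z l L3) L4) _; rewrite L2normZ//.
by apply: lerD => //; apply: ler_wpM2l.
Qed.

Lemma sqr_close (p q k : R) : 0 <= q -> 0 <= k <= 1 -> `|p - q| <= k ->
  `|p ^+ 2 - q ^+ 2| <= (2 * q + 1) * k.
Proof.
move=> q0 /andP[k0 k1] h; rewrite subr_sqr normrM mulrC; apply: ler_pM => //.
have -> : p + q = (p - q) + 2 * q by ring.
apply: le_trans (ler_normD _ _) _; rewrite addrC lerD//; last exact: le_trans h k1.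
by rewrite ger0_norm// mulr_ge0.
Qed.

Lemma quad_close (P : 'M[R]_n) (p1 p2 : R) X v v1 : P^T = P -> 0 <= p1 -> 0 <= p2 ->
  in_L2 v -> in_L2 v1 -> exists2 M : R, 0 <= M & forall (k : R) X' v' v1', 0 <= k <= 1 ->
  in_L2 v' -> in_L2 v1' ->
  enorm (X' - X) <= k -> L2norm (v' - v) <= k -> L2norm (v1' - v1) <= k ->
  `|(bilin P X' X' + p1 * L2norm v' ^+ 2 + p2 * L2norm v1' ^+ 2) -
    (bilin P X X + p1 * L2norm v ^+ 2 + p2 * L2norm v1 ^+ 2)| <= M * k.
Proof.
move=> PT p10 p20 Lv Lv1; have [C C0 hC] := bilin_bound P.
pose Ma := 2 * (C * enorm X) + C.
exists (Ma + p1 * (2 * L2norm v + 1) + p2 * (2 * L2norm v1 + 1)).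
  by rewrite /Ma !addr_ge0 ?mulr_ge0 ?addr_ge0 ?mulr_ge0 ?L2norm_ge0 ?enorm_ge0.
move=> k X' v' v1' k01 Lv' Lv1' hX hv hv1; have /andP[k0 k1] := k01.
have h1 : `|bilin P X' X' - bilin P X X| <= Ma * k.
  have -> : bilin P X' X' - bilin P X X = 2 * bilin P X (X' - X) + bilin P (X' - X) (X' - X).
    rewrite (@bilin_increment _ _ P PT X (X' - X) X' 0 1) ?addr0 ?scale1r//.
    by rewrite (_ : bilin P X 0 = 0) ?mulr0 ?add0r; [ring|rewrite -(scale0r X) bilinZr mul0r].
  rewrite /Ma [leRHS]mulrDl; apply: le_trans (ler_normD _ _) _; apply: lerD.
    rewrite normrM ger0_norm// -[2 * _ * k]mulrA; apply: ler_wpM2l => //.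
    apply: le_trans (hC _ _) _; apply: ler_wpM2l => //.
    by rewrite mulr_ge0// enorm_ge0.
  apply: le_trans (hC _ _) _; rewrite -mulrA; apply: ler_wpM2l => //.
  by rewrite -[leRHS]mul1r; apply: ler_pM => //; rewrite ?enorm_ge0//; apply: le_trans k1.
have h2 := sqr_close (L2norm_ge0 v) k01 (le_trans (L2norm_subl Lv' Lv) hv).
have h3 := sqr_close (L2norm_ge0 v1) k01 (le_trans (L2norm_subl Lv1' Lv1) hv1).
have {}h2 := ler_wpM2l p10 h2; have {}h3 := ler_wpM2l p20 h3.
set a := bilin P X' X' in h1 *; set b := bilin P X X in h1 *.
rewrite (_ : _ - _ = (a - b) + p1 * (L2norm v' ^+ 2 - L2norm v ^+ 2) +
  p2 * (L2norm v1' ^+ 2 - L2norm v1 ^+ 2)); last by ring.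
apply: le_trans (ler_normD _ _) _; rewrite mulrDl; apply: lerD; last first.
  by rewrite normrM ger0_norm// -mulrA.
apply: le_trans (ler_normD _ _) _; rewrite mulrDl; apply: lerD => //.
by rewrite normrM ger0_norm// -mulrA.
Qed.

Variables (A A1 : 'M[R]_n) (B : 'cV[R]_n) (a a2 : R) (K : 'rV[R]_n) (c : R).
Variables (ubar h h0 : R) (tau : R -> R) (z0 z : R -> state).
Hypotheses (h00 : 0 < h0) (hpos : 0 < h) (hW : W1 A B a K c h z0).
Hypothesis (htau : admissible_delay h0 h tau).
Hypothesis (hz : classical_solution A A1 B a a2 K c ubar h tau z0 z).

Local Notation vT := (vtr A B a K c).
Local Notation v1T := (vtr1 A B a K c).
Local Notation fb := (feedback A B a K c).
Local Notation F := (rhs A A1 B a a2 tau z).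

Let H2 := traj_H2 hW hz.
Let dge := delay_ge h00 htau.
Let u t := (z t).2.
Let X t := (z t).1.
Let v t := vT (X t) (u t).
Let v1 t := v1T (X t) (u t) (dx (u t)).
Let v2 t x := vT (A *m X t + u t 0 *: B) (fun x => dx (dx (u t)) x + a * u t x) x + c * v t x.
Let T t := vT (F t).1 (F t).2.
Let w t := v (t - tau t).
Let g t := vT ((A1 - a2%:M) *m X (t - tau t)) (fun=> 0).

Lemma u_ac t : - h <= t -> ac (u t) (dx (u t)).
Proof. by move=> ht; have [] := H2_ac (H2 ht). Qed.
Lemma u_L2 t : - h <= t -> in_L2 (u t).
Proof. by move=> ht; apply: ac_L2 (u_ac ht). Qed.
Lemma ux_L2 t : - h <= t -> in_L2 (dx (u t)).
Proof. by move=> ht; have [] := H2_ac (H2 ht). Qed.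
Lemma ux_ac t : - h <= t -> ac (dx (u t)) (dx (dx (u t))).
Proof. by move=> ht; have [] := H2_ac (H2 ht). Qed.
Lemma uxx_L2 t : - h <= t -> in_L2 (dx (dx (u t))).
Proof. by move=> ht; have [] := H2_ac (H2 ht). Qed.
Lemma v_ac t : - h <= t -> ac (v t) (v1 t).
Proof. by move=> ht; apply: vtr_ac; exact: u_ac. Qed.
Lemma v_L2 t : - h <= t -> in_L2 (v t).
Proof. by move=> ht; apply: ac_L2 (v_ac ht). Qed.
Lemma v1_L2 t : - h <= t -> in_L2 (v1 t).
Proof.
by move=> ht; have [C _ hC] := vtr1_L2 A B a K c; case: (hC (X t) _ _ (u_ac ht) (ux_L2 ht)).
Qed.

Let th t : 0 <= t -> - h <= t.
Proof. by apply: le_trans; rewrite oppr_le0 ltW. Qed.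

Lemma ux0 t : 0 <= t -> dx (u t) 0 = 0.
Proof. by case: hz => _ _ _ h1 _; exact: h1. Qed.

Lemma v1_ac t : 0 <= t -> ac (v1 t) (v2 t).
Proof.
by move=> t0; apply: vtr1_ac; [exact: u_ac (th t0)|exact: ux_ac (th t0)|exact: ux0].
Qed.

Lemma F2_L2 t : 0 <= t -> in_L2 (F t).2.
Proof.
move=> t0; apply: L2D; last by apply: L2Z; exact: u_L2 (th t0).
apply: L2D; first exact: uxx_L2 (th t0).
by apply: L2Z; exact: u_L2 (dge t0).
Qed.

Lemma v2_L2 t : 0 <= t -> in_L2 (v2 t).
Proof.
move=> t0; have [C _ hC] := vtr_L2 A B a K c.
apply: L2D; last by apply: L2Z; exact: v_L2 (th t0).
apply: (hC _ _ _).1; apply: L2D; first exact: uxx_L2 (th t0).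
by apply: L2Z; exact: u_L2 (th t0).
Qed.

Lemma T_L2 t : 0 <= t -> in_L2 (T t).
Proof. by move=> t0; have [C _ hC] := vtr_L2 A B a K c; case: (hC (F t).1 _ (F2_L2 t0)). Qed.

Lemma cst0_L2 : in_L2 (fun=> 0 : R).
Proof. by apply: bmeas_L2; exact: bmeas_cst. Qed.

Lemma g_L2 t : in_L2 (g t).
Proof.
by have [C _ hC] := vtr_L2 A B a K c; case: (hC ((A1 - a2%:M) *m X (t - tau t)) _ cst0_L2).
Qed.

Lemma v10 t : 0 <= t -> v1 t 0 = 0.
Proof. by move=> t0; apply: vtr1_at0; exact: ux0. Qed.

Lemma v11 t : 0 <= t -> v1 t 1 = sat (fb (z t)) ubar - fb (z t).
Proof.
move=> t0; rewrite /v1 vtr1_at1; last exact: L2_intg (u_L2 (th t0)).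
by case: hz => _ _ _ _ /(_ t t0) ->.
Qed.

(** The delayed terms of the plant are (A1 X, a2 u) at time t - tau t; writing
    A1 = a2 + (A1 - a2) splits their image into a2 times the delayed target
    state and the disturbance g. *)
Lemma T_decomp t x : 0 <= t -> 0 <= x <= 1 ->
  T t x = v2 t x - c * v t x + a2 * w t x + g t x.
Proof.
move=> t0 x01.
have Iu := L2_intg (u_L2 (th t0)); have Iud := L2_intg (u_L2 (dge t0)).
have Iuxx := L2_intg (uxx_L2 (th t0)).
set q := fun x => dx (dx (u t)) x + a * u t x.
have Iq : intg q by apply: intgD => //; exact: intgZ.
have F1E : (F t).1 = (A *m X t + u t 0 *: B) +
    (a2 *: X (t - tau t) + (A1 - a2%:M) *m X (t - tau t)).
  have -> : a2 *: X (t - tau t) + (A1 - a2%:M) *m X (t - tau t) = A1 *m X (t - tau t).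
    by rewrite mulmxBl mul_scalar_mx addrC subrK.
  exact: addrAC.
have F2E : (F t).2 = (fun x => q x +
    (fun x => (fun x => a2 * u (t - tau t) x) x + (fun=> 0 : R) x) x).
  by apply/funext => y; rewrite /= addr0; exact: addrAC.
have h1 : T t x = vT (A *m X t + u t 0 *: B) q x + (a2 * w t x + g t x).
  rewrite -[T t x]/(vT (F t).1 (F t).2 x) F1E F2E vtr_add//; last first.
    by apply: intgD; [exact: intgZ|exact: intg_cst].
  congr (_ + _); rewrite vtr_add//; [|exact: intgZ|exact: intg_cst].
  by congr (_ + _); exact: vtr_scale.
have h2 : v2 t x = vT (A *m X t + u t 0 *: B) q x + c * v t x := erefl.
exact: (source_regroup h1 h2).
Qed.

Lemma target_increment : exists2 C : R, 0 <= C & forall s t, - h <= s -> - h <= t ->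
  [/\ enorm (X s - X t) <= C * normH2 (z s - z t),
   L2norm (v s - v t) <= C * normH2 (z s - z t) &
   L2norm (v1 s - v1 t) <= C * normH2 (z s - z t)].
Proof.
have [C C0 hC] := vtr_L2 A B a K c; have [C' C'0 hC'] := vtr1_L2 A B a K c.
exists (1 + 2 * C + 3 * C'); first by rewrite !addr_ge0 ?mulr_ge0.
move=> s t hs ht.
have n1 := normH2_X (z s - z t); have n2 := normH2_u (z s - z t).
have n3 := normH2_ux (z s - z t); rewrite (traj_dx_sub hW hz hs ht) in n3.
move: n1 n2 n3; set N := normH2 _.
rewrite -[(z s - z t).1]/(X s - X t) -[(z s - z t).2]/(u s - u t) => n1 n2 n3.
have N0 : 0 <= N by exact: le_trans (enorm_ge0 _) n1.
have us := u_L2 hs; have ut := u_L2 ht.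
have Ius := L2_intg us; have Iut := L2_intg ut.
have Lu : in_L2 (u s - u t) by exact: L2B.
have au : ac (u s - u t) (fun x => dx (u s) x - dx (u t) x).
  exact: acB (u_ac hs) (u_ac ht).
have Lux : in_L2 (fun x => dx (u s) x - dx (u t) x) by apply: L2B; exact: ux_L2.
have [_ e1] := hC (X s - X t) _ Lu.
have [_ e2] := hC' (X s - X t) _ _ au Lux.
rewrite (eq_L2norm (g := v s - v t)) in e1; last by move=> x x01; exact: vtr_sub.
rewrite (eq_L2norm (g := v1 s - v1 t)) in e2; last by move=> x x01; exact: vtr1_sub.
have f1 : C * (enorm (X s - X t) + L2norm (u s - u t)) <= C * (2 * N).
  by apply: ler_wpM2l => //; rewrite mulrDl mul1r lerD.
have f2 : C' * (enorm (X s - X t) + L2norm (u s - u t) + L2norm (fun x => dx (u s) x - dx (u t) x)) <= C' * (3 * N).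
  apply: ler_wpM2l => //; rewrite (_ : 3 * N = N + N + N); last by ring.
  by rewrite !lerD.
have CN : 0 <= C * N by rewrite mulr_ge0.
have C'N : 0 <= C' * N by rewrite mulr_ge0.
split.
- apply: (le_trans n1); lra.
- apply: (le_trans e1); apply: (le_trans f1); lra.
- apply: (le_trans e2); apply: (le_trans f2); lra.
Qed.

(** The second derivative of v is read off the equation, so that its increments
    are bounded by those of the right-hand side F of the plant. *)
Lemma v2_increment : exists2 C : R, 0 <= C & forall s t, 0 <= s -> 0 <= t ->
  L2norm (fun x => v2 s x - v2 t x) <= C * (normH (F s - F t) + normH2 (z s - z t) +
    normH2 (z (s - tau s) - z (t - tau t))).
Proof.
have [C C0 hC] := vtr_L2 A B a K c; have [CA CA0 hCA] := enorm_mulmx_bound (A1 - a2%:M).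
have [C1 C10 hC1] := target_increment.
exists (2 * C + `|c| * C1 + (`|a2| * C1 + C * CA)).
  by rewrite !addr_ge0 ?mulr_ge0.
move=> s t s0 t0.
have [_ hv _] := hC1 s t (th s0) (th t0).
have [hX hw _] := hC1 _ _ (dge s0) (dge t0).
have hFx := normH_X (F s - F t); have hFu := normH_u (F s - F t).
have LF : in_L2 ((F s).2 - (F t).2) by exact: L2B (F2_L2 s0) (F2_L2 t0).
have [_ hT] := hC ((F s).1 - (F t).1) _ LF.
rewrite (eq_L2norm (g := T s - T t)) in hT; last first.
  by move=> x x01; apply: vtr_sub => //; apply: L2_intg; exact: F2_L2.
have hXd : enorm (X (s - tau s) - X (t - tau t)) <=
    normH2 (z (s - tau s) - z (t - tau t)) := normH2_X (z (s - tau s) - z (t - tau t)).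
have [_ hg] := hC ((A1 - a2%:M) *m X (s - tau s) - (A1 - a2%:M) *m X (t - tau t)) _ cst0_L2.
rewrite (eq_L2norm (g := fun x => g s x - g t x)) in hg; last first.
  move=> x x01; rewrite -(vtr_sub _ _ _ _ _ _ _ (intg_cst 0) (intg_cst 0) x01).
  by congr (vtr _ _ _ _ _ _ _ _); apply/funext => y; rewrite /= subrr.
rewrite L2norm_cst normr0 addr0 -mulmxBr in hg.
have {}hg : L2norm (fun x => g s x - g t x) <= C * (CA * normH2 (z (s - tau s) - z (t - tau t))).
  apply: (le_trans hg); apply: (ler_wpM2l C0); apply: (le_trans (hCA _)).
  exact: (ler_wpM2l CA0 hXd).
rewrite (eq_L2norm (g := fun x => ((T s x - T t x) + c * (v s x - v t x)) -
    (a2 * (w s x - w t x) + (g s x - g t x)))); last first.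
  by move=> x x01; exact: (source_regroupB (T_decomp s0 x01) (T_decomp t0 x01)).
have LT : in_L2 (fun x => T s x - T t x) by apply: L2B; exact: T_L2.
have Lv : in_L2 (fun x => v s x - v t x) by apply: L2B; apply: v_L2; exact: th.
have Lw : in_L2 (fun x => w s x - w t x) by apply: L2B; apply: v_L2; exact: dge.
have Lg : in_L2 (fun x => g s x - g t x) by apply: L2B; exact: g_L2.
have {}hT : L2norm (fun x => T s x - T t x) <= C * (2 * normH (F s - F t)).
  apply: (le_trans hT); apply: (ler_wpM2l C0).
  by rewrite mulrDl mul1r; exact: (lerD hFx hFu).
apply: (le_trans (L2norm_comb4 c a2 LT Lv Lw Lg hT hv hw hg)).
have N0 : 0 <= normH2 (z s - z t) by exact: le_trans (enorm_ge0 _) (normH2_X _).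
have N1 : 0 <= normH2 (z (s - tau s) - z (t - tau t)) by exact: le_trans (enorm_ge0 _) (normH2_X _).
have N2 : 0 <= normH (F s - F t) by exact: le_trans (enorm_ge0 _) (normH_X _).
clear -C0 CA0 C10 N0 N1 N2.
move: (normH2 (z s - z t)) (normH2 _) (normH _) N0 N1 N2 => n1 n2 n3 N0 N1 N2.
move: (Num.norm c) (normr_ge0 c) (Num.norm a2) (normr_ge0 a2) => c' c'0 a' a'0.
have := mulr_ge0 C0 N0; have := mulr_ge0 C0 N1; have := mulr_ge0 C0 N2.
have b1 := mulr_ge0 c'0 C10; have b2 := mulr_ge0 a'0 C10; have b3 := mulr_ge0 C0 CA0.
have := mulr_ge0 b1 N0; have := mulr_ge0 b1 N1; have := mulr_ge0 b1 N2.
have := mulr_ge0 b2 N0; have := mulr_ge0 b2 N1; have := mulr_ge0 b2 N2.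
have := mulr_ge0 b3 N0; have := mulr_ge0 b3 N1; have := mulr_ge0 b3 N2.
lra.
Qed.

(** The transformation is linear and bounded: it maps the error of the difference
    quotient of the state to that of the target state. *)
Lemma target_deriv : exists2 C : R, 0 <= C & forall t s, 0 <= t -> t < s ->
  exists (e : 'cV[R]_n) (E : R -> R), [/\ in_L2 E, X s - X t = (s - t) *: ((F t).1 + e),
   forall x, 0 <= x <= 1 -> v s x - v t x = (s - t) * (T t x + E x),
   enorm e <= C * normH ((s - t)^-1 *: (z s - z t) - F t) &
   L2norm E <= C * normH ((s - t)^-1 *: (z s - z t) - F t)].
Proof.
have [C C0 hC] := vtr_L2 A B a K c.
exists (1 + 2 * C); first by rewrite addr_ge0// mulr_ge0.
move=> t s t0 ts; set err := _ - F t.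
have s0 : 0 <= s by rewrite (le_trans t0)// ltW.
have d0 : s - t != 0 by rewrite subr_eq0 gt_eqF.
have us := u_L2 (th s0); have ut := u_L2 (th t0).
have Lerr : in_L2 err.2.
  by apply: L2B (L2Z _ (L2B us ut)) (F2_L2 t0).
have [LE hE] := hC err.1 _ Lerr.
have n1 := normH_X err; have n2 := normH_u err.
have N0 : 0 <= normH err by exact: le_trans (enorm_ge0 _) n1.
exists err.1, (vT err.1 err.2); split => //.
- have -> : err.1 = (s - t)^-1 *: (X s - X t) - (F t).1 by [].
  by rewrite [_ + (_ - _)]addrC subrK scalerA divff// scale1r.
- move=> x x01.
  have IF := L2_intg (F2_L2 t0); have Ie := L2_intg Lerr.
  have e1 : v s x - v t x = vT (X s - X t) (u s - u t) x.
    by apply/esym; apply: vtr_sub => //; exact: L2_intg.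
  have e2 : T t x + vT err.1 err.2 x = vT ((F t).1 + err.1) (fun x => (F t).2 x + err.2 x) x.
    by apply/esym; exact: vtr_add.
  have e3 := vtr_scale A B a K c ((F t).1 + err.1) (s - t) (intgD IF Ie) x01.
  apply: (etrans e1); apply: (etrans _ (congr1 ( *%R (s - t)) (esym e2))).
  apply: (etrans _ e3); congr (vtr _ _ _ _ _ _ _ _).
    have -> : err.1 = (s - t)^-1 *: (X s - X t) - (F t).1 by [].
    by rewrite [_ + (_ - _)]addrC subrK scalerA divff// scale1r.
  apply/funext => y.
  have -> : err.2 y = (s - t)^-1 * (u s y - u t y) - (F t).2 y by [].
  by rewrite [_ + (_ - _)]addrC subrK mulrA divff// mul1r.
- apply: (le_trans n1); rewrite mulrDl mul1r lerDl; apply: mulr_ge0 => //; exact: mulr_ge0.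
- apply: (le_trans hE).
  have h1 : C * (enorm err.1 + L2norm err.2) <= C * (normH err + normH err).
    by apply: (ler_wpM2l C0); exact: lerD.
  apply: (le_trans h1); rewrite (_ : C * _ = 2 * C * normH err); last by ring.
  by rewrite [leRHS]mulrDl lerDr mul1r.
Qed.

Lemma g_zeta t : L2norm (g t) ^+ 2 <= zeta A a K c * enorm ((A1 - a2%:M) *m X (t - tau t)) ^+ 2.
Proof. exact: (vtr_zeta A B a K c). Qed.

Lemma target_at0 t : v t 0 = u t 0 - (K *m X t) 0 0.
Proof. exact: vtr_at0. Qed.

Lemma feedback_le t : - h <= t -> `|fb (z t)| <=
  c1 A B a K * enorm (X t) + c2 A B a K c * L2norm (v t) + c3 a c * L2norm (v1 t).
Proof.
move=> ht; exact: (feedback_bound (u_ac ht) (ac_bmeas (ux_ac ht)) (v1_L2 ht)).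
Qed.

Lemma feedback_diff_le s t : - h <= s -> - h <= t -> `|fb (z s) - fb (z t)| <=
  c1 A B a K * enorm (X s - X t) + xi A B a K c * L2norm (fun x => v s x - v t x)
  + c3 a c * `|v s 1 - v t 1|.
Proof.
move=> hs ht; have Is := L2_intg (u_L2 hs); have It := L2_intg (u_L2 ht).
have i1 : 0 <= (1 : R) <= 1 by rewrite ler01 lexx.
have e0 : fb (z s) - fb (z t) = fb (X s - X t, u s - u t).
  by apply/esym; exact: (feedback_sub A B a K c (X s) (X t) Is It).
have au : ac (u s - u t) (fun x => dx (u s) x - dx (u t) x) := acB (u_ac hs) (u_ac ht).
have b := feedback_trace_bound A B a K c (X s - X t) au (bmeasB (ac_bmeas (ux_ac hs)) (ac_bmeas (ux_ac ht))).
rewrite -e0 in b; apply: (le_trans b); apply: lerD; last first.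
  apply: ler_wpM2l; first exact: normr_ge0.
  rewrite le_eqVlt; apply/orP; left; apply/eqP; congr (Num.norm _).
  exact: (vtr_sub A B a K c (X s) (X t) Is It i1).
rewrite lerD2l le_eqVlt; apply/orP; left; apply/eqP; congr (_ * _).
apply: eq_L2norm => x x01; exact: (vtr_sub A B a K c (X s) (X t) Is It x01).
Qed.

Lemma state_le : exists2 C : R, 0 <= C & forall t, - h <= t ->
  normH1 (z t) <= C * (enorm (X t) + L2norm (v t) + L2norm (v1 t)).
Proof.
have [C C0 hC] := inverse_bound A B a K c; exists (1 + 2 * C).
  by rewrite addr_ge0// mulr_ge0.
move=> t ht; have [h1 h2] := hC (X t) _ _ (u_ac ht) (ux_L2 ht).
apply: (le_trans (normH1_le (z t))).
have N0 : 0 <= L2norm (v t) + L2norm (v1 t) by apply: addr_ge0; exact: L2norm_ge0.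
rewrite -[enorm (z t).1]/(enorm (X t)) -[L2norm (z t).2]/(L2norm (u t)) -[dx (z t).2]/(dx (u t)).
rewrite -[L2norm (vT _ _)]/(L2norm (v t)) -[L2norm (v1T _ _ _)]/(L2norm (v1 t)) in h1 h2.
move: h1 h2 N0 (enorm_ge0 (X t)).
move: (L2norm (u t)) (L2norm (dx (u t))) (L2norm (v t)) (L2norm (v1 t)) (enorm (X t)).
move=> p q r s x h1 h2 N0 x0; lra.
Qed.

Lemma target_bound t : - h <= t ->
  enorm (X t) ^+ 2 + L2norm (v t) ^+ 2 + L2norm (v1 t) ^+ 2 <=
  M1 A a K c * enorm (X t) ^+ 2 + M2 A B a K c * L2norm (u t) ^+ 2 + 4 * L2norm (dx (u t)) ^+ 2.
Proof. by move=> ht; exact: (transform_bound A B a K c (X t) (u_ac ht) (ux_L2 ht)). Qed.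

End ClosedLoop.

Section Target.
Context {R : realType} {n : nat}.
Local Notation state := ('cV[R]_n * (R -> R))%type.
Variables (A A1 : 'M[R]_n) (B : 'cV[R]_n) (a a2 : R) (K : 'rV[R]_n) (c : R).
Variables (ubar h : R) (tau : R -> R) (z : R -> state).
Variables (v v1 v2 T g : R -> R -> R).
Local Notation fb := (feedback A B a K c).
Local Notation F := (rhs A A1 B a a2 tau z).
Local Notation X t := (z t).1.
Local Notation u t := (z t).2.

(** All that the stability proof needs to know about the target trajectory
    (X, v), with v1 and v2 the first and second space derivatives of v, T its
    time derivative and g the disturbance due to A1 - a2. *)
Record target_system : Prop := TargetSystem {
  ts_v_ac : forall t, - h <= t -> ac (v t) (v1 t);
  ts_v1_L2 : forall t, - h <= t -> in_L2 (v1 t);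
  ts_v1_ac : forall t, 0 <= t -> ac (v1 t) (v2 t);
  ts_v2_L2 : forall t, 0 <= t -> in_L2 (v2 t);
  ts_T_L2 : forall t, 0 <= t -> in_L2 (T t);
  ts_g_L2 : forall t, in_L2 (g t);
  ts_v0 : forall t, v t 0 = u t 0 - (K *m X t) 0 0;
  ts_v10 : forall t, 0 <= t -> v1 t 0 = 0;
  ts_v11 : forall t, 0 <= t -> v1 t 1 = sat (fb (z t)) ubar - fb (z t);
  ts_pde : forall t x, 0 <= t -> 0 <= x <= 1 ->
    T t x = v2 t x - c * v t x + a2 * v (t - tau t) x + g t x;
  ts_g : forall t, L2norm (g t) ^+ 2 <=
    zeta A a K c * enorm ((A1 - a2%:M) *m X (t - tau t)) ^+ 2;
  ts_incr : exists2 C : R, 0 <= C & forall s t, - h <= s -> - h <= t ->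
    [/\ enorm (X s - X t) <= C * normH2 (z s - z t),
     L2norm (v s - v t) <= C * normH2 (z s - z t) &
     L2norm (v1 s - v1 t) <= C * normH2 (z s - z t)];
  ts_v2_incr : exists2 C : R, 0 <= C & forall s t, 0 <= s -> 0 <= t ->
    L2norm (fun x => v2 s x - v2 t x) <= C * (normH (F s - F t) +
      normH2 (z s - z t) + normH2 (z (s - tau s) - z (t - tau t)));
  ts_deriv : exists2 C : R, 0 <= C & forall t s, 0 <= t -> t < s ->
    exists (e : 'cV[R]_n) (E : R -> R),
    [/\ in_L2 E, X s - X t = (s - t) *: ((F t).1 + e),
     forall x, 0 <= x <= 1 -> v s x - v t x = (s - t) * (T t x + E x),
     enorm e <= C * normH ((s - t)^-1 *: (z s - z t) - F t) &
     L2norm E <= C * normH ((s - t)^-1 *: (z s - z t) - F t)];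
  ts_fb : forall t, - h <= t -> `|fb (z t)| <=
    c1 A B a K * enorm (X t) + c2 A B a K c * L2norm (v t) + c3 a c * L2norm (v1 t);
  ts_fb_diff : forall s t, - h <= s -> - h <= t -> `|fb (z s) - fb (z t)| <=
    c1 A B a K * enorm (X s - X t) + xi A B a K c * L2norm (fun x => v s x - v t x)
    + c3 a c * `|v s 1 - v t 1|;
  ts_state : exists2 C : R, 0 <= C & forall t, - h <= t ->
    normH1 (z t) <= C * (enorm (X t) + L2norm (v t) + L2norm (v1 t));
  ts_bound : forall t, - h <= t ->
    enorm (X t) ^+ 2 + L2norm (v t) ^+ 2 + L2norm (v1 t) ^+ 2 <=
    M1 A a K c * enorm (X t) ^+ 2 + M2 A B a K c * L2norm (u t) ^+ 2
    + 4 * L2norm (dx (u t)) ^+ 2 }.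

End Target.

Lemma target_systemP (R : realType) (n : nat) (A A1 : 'M[R]_n) (B : 'cV[R]_n)
    (a a2 : R) (K : 'rV[R]_n) (c ubar h h0 : R) (tau : R -> R)
    (z0 z : R -> 'cV[R]_n * (R -> R)) :
  0 < h0 -> 0 < h -> W1 A B a K c h z0 -> admissible_delay h0 h tau ->
  classical_solution A A1 B a a2 K c ubar h tau z0 z ->
  exists v v1 v2 T g, target_system A A1 B a a2 K c ubar h tau z v v1 v2 T g.
Proof.
move=> h00 hpos hW htau hz.
do 5!eexists; split.
- exact: (v_ac hW hz).
- exact: (v1_L2 hW hz).
- exact: (v1_ac hpos hW hz).
- exact: (v2_L2 hpos hW hz).
- exact: (T_L2 h00 hpos hW htau hz).
- move=> t; exact: (g_L2 A A1 B a a2 K c tau z t).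
- move=> t; exact: (target_at0 A B a K c z t).
- exact: (v10 hz).
- exact: (v11 hpos hW hz).
- exact: (T_decomp h00 hpos hW htau hz).
- move=> t; exact: (g_zeta A A1 B a a2 K c tau z t).
- exact: (target_increment hW hz).
- exact: (v2_increment h00 hpos hW htau hz).
- exact: (target_deriv h00 hpos hW htau hz).
- exact: (feedback_le hW hz).
- exact: (feedback_diff_le hW hz).
- exact: (state_le hW hz).
- exact: (target_bound hW hz).
Qed.

(** * Decay *)

Section Decay.
Context {R : realType} {n : nat}.
Local Notation state := ('cV[R]_n * (R -> R))%type.

Lemma sqr_sum3 (p q r : R) : (p + q + r) ^+ 2 <= 3 * (p ^+ 2 + q ^+ 2 + r ^+ 2).
Proof.
have := sqr_ge0 (p - q); have := sqr_ge0 (p - r); have := sqr_ge0 (q - r).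
by rewrite !expr2; lra.
Qed.

Lemma le_const3 (x y w : R) : 0 <= x -> 0 <= y -> 0 <= w ->
  [/\ x <= x + 3 * y + w + 1, 3 * y <= x + 3 * y + w + 1 & w <= x + 3 * y + w + 1].
Proof. by move=> x0 y0 w0; split; lra. Qed.

Lemma le_thirds (q x y w k : R) : 3 * q * x <= k -> 3 * q * y <= k -> 3 * q * w <= k ->
  q * (x + y + w) <= k.
Proof. by lra. Qed.

Lemma exists_delta3 (P1 P2 P3 : R -> Prop) (t : R) :
  (exists2 d : R, 0 < d & forall s, t < s < t + d -> P1 s) ->
  (exists2 d : R, 0 < d & forall s, t < s < t + d -> P2 s) ->
  (exists2 d : R, 0 < d & forall s, t < s < t + d -> P3 s) ->
  exists2 d : R, 0 < d & forall s, t < s < t + d -> [/\ P1 s, P2 s & P3 s].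
Proof.
move=> [d1 d10 h1] [d2 d20 h2] [d3 d30 h3].
exists (Num.min d1 (Num.min d2 d3)); first by rewrite !lt_min d10 d20.
move=> s /andP[ts]; rewrite -ltrBlDl !lt_min !ltrBlDl => /and3P[s1 s2 s3].
by split; [apply: h1|apply: h2|apply: h3]; rewrite ts.
Qed.

Lemma right_of_ball (P : R -> Prop) (t : R) : 0 <= t ->
  (exists2 d : R, 0 < d & forall s, 0 <= s -> `|s - t| < d -> P s) ->
  exists2 d : R, 0 < d & forall s, t < s < t + d -> P s.
Proof.
move=> t0 [d d0 hd]; exists d => // s /andP[ts sd]; apply: hd.
  by rewrite (le_trans t0)// ltW.
by rewrite ger0_norm ?subr_ge0 ?(ltW ts)// ltrBlDl.
Qed.

Variables (A A1 : 'M[R]_n) (B : 'cV[R]_n) (a a2 : R) (K : 'rV[R]_n) (c : R).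
Variables (ubar h h0 beta : R) (tau : R -> R) (z0 z : R -> state).
Hypotheses (h00 : 0 < h0) (hpos : 0 < h) (ubar0 : 0 < ubar) (beta0 : 0 < beta).
Hypothesis (hX : Xu A B a K c beta h z0).
Hypothesis (htau : admissible_delay h0 h tau).
Hypothesis (hz : classical_solution A A1 B a a2 K c ubar h tau z0 z).

Variables (P : 'M[R]_n) (p1 p2 d0 d1 lam lam1 r r1 : R).
Hypotheses (Ppos : mx_gt0 P) (p10 : 0 < p1) (p20 : 0 < p2) (lam0 : 0 < lam).
Hypotheses (lam10 : 0 <= lam1) (r0 : 0 < r) (r10 : 0 < r1) (d10 : 0 < d1) (dd : d1 = d0).
Hypothesis Xi0 : mx_lt0 (Xi_mx A A1 B K d0 d1 P lam +
  (p1 * r^-1 + p2 * r1^-1) *: R_mx A A1 B a a2 K c).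
Hypothesis heat0 : mx_lt0 (heat_mx a2 c r r1 d0 d1 p1 p2 lam lam1).
Hypothesis third : - 2 * p1 - 2 * p2 * c + lam + 2 * d0 * p2 - pi ^+ 2 / 4 * lam1 <= 0.
Hypothesis PB : mx_ge0 (beta%:M - P).
Hypotheses (p1B : p1 <= beta) (p2B : p2 <= beta).
Hypothesis S1 : mx_ge0 ((ubar ^+ 2 / 3) *: P - (c1 A B a K ^+ 2)%:M).
Hypothesis S2 : 0 <= p1 * (ubar ^+ 2 / 3) - c2 A B a K c ^+ 2.
Hypothesis S3 : 0 <= p2 * (ubar ^+ 2 / 3) - c3 a c ^+ 2.

Variables (v v1 v2 T g : R -> R -> R).
Hypothesis ts : target_system A A1 B a a2 K c ubar h tau z v v1 v2 T g.
Local Notation fb := (feedback A B a K c).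
Local Notation F := (rhs A A1 B a a2 tau z).
Local Notation X t := (z t).1.
Local Notation u t := (z t).2.

Let PT : P^T = P. Proof. by case: Ppos. Qed.
Let th t : 0 <= t -> - h <= t.
Proof. by apply: le_trans; rewrite oppr_le0 ltW. Qed.
Let dge := delay_ge h00 htau.
Let hW : W1 A B a K c h z0. Proof. by case: hX. Qed.

Definition lyap t := bilin P (X t) (X t) + p1 * L2norm (v t) ^+ 2 + p2 * L2norm (v1 t) ^+ 2.

Lemma bilin_ge0 Y : 0 <= bilin P Y Y.
Proof.
have [-> | Y0] := eqVneq Y 0; first by rewrite /bilin mulmx0 mxE.
by case: Ppos => _ h1; exact: ltW (h1 Y Y0).
Qed.

(** As P <= beta and p1, p2 <= beta, V is at most beta times the left-hand side of
    transform_bound, and M1 and M2 are the weights of the initial ball. *)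
Lemma V_init t : - h <= t <= 0 -> lyap t <= 1.
Proof.
move=> ht; have hlo : - h <= t by case/andP: ht.
have [m1 m2 m3] := initial_max hpos hW hz ht.
have [_ hball] := hX.
apply: (@le_trans _ _ (beta * (enorm (X t) ^+ 2 + L2norm (v t) ^+ 2 + L2norm (v1 t) ^+ 2))).
  rewrite !mulrDr; apply: lerD; first apply: lerD.
  - exact: (mx_ge0_scalar PB).
  - by rewrite ler_wpM2r// sqr_ge0.
  - by rewrite ler_wpM2r// sqr_ge0.
have bb : beta * beta^-1 = 1 by rewrite mulfV// gt_eqF.
rewrite -bb; apply: (ler_wpM2l (ltW beta0)).
apply: le_trans (ts_bound ts hlo) _; apply: le_trans hball.
apply: lerD; last by apply: ler_wpM2l.
by apply: lerD; apply: ler_wpM2l => //; [exact: M1_ge0|exact: M2_ge0].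
Qed.

(** The three saturation inequalities make each of the three terms of
    feedback_bound at most ubar / sqrt 3 times the root of a part of V. *)
Lemma V_unsaturated t : - h <= t -> lyap t <= 1 -> `|fb (z t)| <= ubar.
Proof.
move=> ht V1; rewrite -ler_sqr ?nnegrE ?(ltW ubar0)//.
have := ts_fb ts ht; set f := `|_| => hf.
have f0 : 0 <= f by exact: normr_ge0.
apply: (@le_trans _ _ ((c1 A B a K * enorm (X t) + c2 A B a K c * L2norm (v t) + c3 a c * L2norm (v1 t)) ^+ 2)).
  by rewrite ler_sqr ?nnegrE// (le_trans f0).
apply: le_trans (sqr_sum3 _ _ _) _.
have e1 := mx_ge0_scalar2 S1 (X t); rewrite -/(bilin P (X t) (X t)) in e1.
have e2 := mulr_ge0 S2 (sqr_ge0 (L2norm (v t))).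
have e3 := mulr_ge0 S3 (sqr_ge0 (L2norm (v1 t))).
have e4 := ler_wpM2l (sqr_ge0 ubar) V1.
rewrite mulr1 /lyap in e4; rewrite !exprMn.
move: e1 e2 e3 e4.
move: (ubar ^+ 2) (c1 _ _ _ _ ^+ 2) (c2 _ _ _ _ _ ^+ 2) (c3 _ _ ^+ 2) (enorm _ ^+ 2) (L2norm (v t) ^+ 2) (L2norm (v1 t) ^+ 2) (bilin _ _ _).
by move=> *; lra.
Qed.

Lemma V_continuous : continuous_half_line lyap.
Proof.
move=> t e t0 e0; have ht := th t0.
have [M M0 hM] := quad_close (X t) PT (ltW p10) (ltW p20)
  (ac_L2 (ts_v_ac ts ht)) (ts_v1_L2 ts ht).
have [C C0 hC] := ts_incr ts.
pose k := Num.min 1 (e / (M + 1)).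
have M10 : 0 < M + 1 by rewrite ltr_wpDl.
have C10 : 0 < C + 1 by rewrite ltr_wpDl.
have k0 : 0 < k by rewrite lt_min ltr01 divr_gt0.
have k1 : k <= 1 by rewrite ge_min lexx.
have ke : M * k < e.
  apply: (@lt_le_trans _ _ ((M + 1) * k)); first by rewrite ltr_pM2r// ltrDl.
  by rewrite mulrC -ler_pdivlMr// ge_min lexx orbT.
have kC : 0 < k / (C + 1) by rewrite divr_gt0.
have [d d_gt0 hd] := traj_cont hW hz ht kC.
exists d => // s s0 st; have hs := th s0.
have [hx hv hv1] := hC s t hs ht.
have Nk : C * normH2 (z s - z t) <= k.
  have := hd s hs st; rewrite ltr_pdivlMr// => /ltW; apply: le_trans.
  rewrite mulrC ler_wpM2l ?lerDl//; exact: le_trans (enorm_ge0 _) (normH2_X _).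
apply: le_lt_trans ke; apply: hM.
- by rewrite k1 ltW.
- exact: ac_L2 (ts_v_ac ts hs).
- exact: ts_v1_L2 ts _ hs.
- exact: le_trans hx Nk.
- exact: le_trans hv Nk.
- exact: le_trans hv1 Nk.
Qed.

(** As long as V <= 1 the actuator is unsaturated, the target Neumann datum at 1
    vanishes, and the one-step estimate meets the dissipation inequality. *)
Lemma V_dini : exists2 d1' : R, 0 <= d1' < d0 &
  forall t e, 0 <= t -> lyap t <= 1 -> 0 < e -> exists2 d : R, 0 < d &
     forall s, t < s < t + d ->
     lyap s <= lyap t + (- (2 * d0) * lyap t + 2 * d1' * lyap (t - tau t) + e) * (s - t).
Proof.
have [d1' hd1' diss] := dissipation PT p10 p20 lam0 lam10 r0 r10 d10 dd beta0 Xi0 heat0 third PB p1B.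
exists d1' => // t e t0 V1 e0.
have /andP[d1'0 _] := hd1'.
have ht := th t0; have hd := dge t0.
have av := ts_v_ac ts ht; have av1 := ts_v1_ac ts t0.
have L2 := ts_v2_L2 ts t0; have LT := ts_T_L2 ts t0.
have v10 := ts_v10 ts t0.
have fbt := V_unsaturated ht V1.
have v11 : v1 t 1 = 0 by rewrite (ts_v11 ts t0) sat_id// subrr.
have Lw := ac_L2 (ts_v_ac ts hd); have Lg := ts_g_L2 ts t.
have hdiss := diss (X t) (X (t - tau t)) (v t) (v1 t) (v2 t) (v (t - tau t)) (g t) (T t)
  av av1 L2 Lw Lg v10 v11 (ts_g ts t) (fun x x01 => ts_pde ts t0 x01).
have [M M0 step] := step_bound PT (ltW p10) (ltW p20)
  (enorm_ge0 (dpsi_ker A B a K 1)) (xi_ge0 A B a K c) (normr_ge0 (l_ker a c 1 1))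
  (X t) (F t).1 av av1 L2 LT v10 v11.
have [Ci Ci0 incr] := ts_incr ts; have [C2 C20 incr2] := ts_v2_incr ts.
have [Cd Cd0 der] := ts_deriv ts.
pose k := Num.min 1 (e / (M + 1)).
have M10 : 0 < M + 1 by rewrite ltr_wpDl.
have k0 : 0 < k by rewrite lt_min ltr01 divr_gt0.
have k1 : k <= 1 by rewrite ge_min lexx.
have ke : M * k <= e.
  apply: (@le_trans _ _ ((M + 1) * k)); first by rewrite ler_wpM2r ?(ltW k0)// lerDl.
  by rewrite mulrC -ler_pdivlMr// ge_min lexx orbT.
pose C := Ci + 3 * C2 + Cd + 1.
have CC0 : 0 < C by rewrite /C ltr_wpDl// !addr_ge0// mulr_ge0.
have kC : 0 < k / C by rewrite divr_gt0.
have near1 := exists_delta3 (right_of_ball t0 (let: ex_intro2 d d0 hd := traj_cont hW hz ht kC in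
   ex_intro2 _ _ d d0 (fun s s0 => hd s (th s0))))
  (right_of_ball t0 (delayed_cont h00 hW htau hz t0 kC))
  (right_of_ball t0 (rhs_cont hz t0 kC)).
have [da da0 ha] := near1.
have [db db0 hb] := rhs_deriv hz t0 kC.
exists (Num.min da db); first by rewrite lt_min da0.
move=> s /andP[lts]; rewrite -ltrBlDl lt_min !ltrBlDl => /andP[sa sb].
have [n1 n2 n3] := ha s (ltac:(by rewrite lts)).
have n4 := hb s (ltac:(by rewrite lts)).
have s0 : 0 <= s by rewrite (le_trans t0)// ltW.
have hs := th s0.
have [e' [E [LE hXs hvs he hE]]] := der t s t0 lts.
have small (q N : R) : 0 <= q -> q <= C -> N < k / C -> 0 <= N -> q * N <= k.
  move=> q0 qC /ltW Nk N0; apply: (@le_trans _ _ (C * (k / C))).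
    exact: ler_pM.
  by rewrite mulrC divfK// gt_eqF.
have [CiC C2C CdC] := le_const3 Ci0 C20 Cd0.
have N1 : 0 <= normH2 (z s - z t) by exact: le_trans (enorm_ge0 _) (normH2_X _).
have N2 : 0 <= normH2 (z (s - tau s) - z (t - tau t)) by exact: le_trans (enorm_ge0 _) (normH2_X _).
have N3 : 0 <= normH (F s - F t) by exact: le_trans (enorm_ge0 _) (normH_X _).
have N4 : 0 <= normH ((s - t)^-1 *: (z s - z t) - F t) by exact: le_trans (enorm_ge0 _) (normH_X _).
have [i1 i2 i3] := incr s t hs ht.
have j1 := le_trans i1 (small _ _ Ci0 CiC n1 N1).
have j2 := le_trans i2 (small _ _ Ci0 CiC n1 N1).
have j3 := le_trans i3 (small _ _ Ci0 CiC n1 N1).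
have j4 := le_trans he (small _ _ Cd0 CdC n4 N4).
have j5 := le_trans hE (small _ _ Cd0 CdC n4 N4).
have j6 : L2norm (fun x => v2 s x - v2 t x) <= k.
  have C320 : 0 <= 3 * C2 by rewrite mulr_ge0.
  have q1 := small _ _ C320 C2C n1 N1; have q2 := small _ _ C320 C2C n2 N2.
  have q3 := small _ _ C320 C2C n3 N3.
  exact: (le_trans (incr2 s t s0 t0) (le_thirds q3 q1 q2)).
have k01 : 0 <= k <= 1 by rewrite (ltW k0) k1.
have st0 : 0 < s - t by rewrite subr_gt0.
have v1s : `|v1 s 1| <= c1 A B a K * enorm (X s - X t) + xi A B a K c * L2norm (fun x => v s x - v t x)
    + c3 a c * `|v s 1 - v t 1|.
  rewrite (ts_v11 ts s0); apply: le_trans (sat_close _ fbt) _.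
  exact: (ts_fb_diff ts hs ht).
have main := step k (s - t) (X s) e' (v s) (v1 s) (v2 s) E k01 st0 (ts_v_ac ts hs)
  (ts_v1_ac ts s0) (ts_v2_L2 ts s0) LE (ts_v10 ts s0) hXs hvs v1s j4 j5 j1 j2 j3 j6.
apply: (le_trans main); rewrite -/(lyap t) lerD2l mulrC ler_wpM2r ?(ltW st0)//.
have pfF : 2 * bilin P (X t) (F t).1 = 2 * bilin P (X t) ((A + B *m K) *m X t) +
    2 * bilin P (X t) (A1 *m X (t - tau t)) + 2 * v t 0 * bilin P (X t) B.
  have -> : (F t).1 = A *m X t + A1 *m X (t - tau t) + u t 0 *: B by [].
  rewrite (ts_v0 ts) mulmxDl -mulmxA.
  have -> : B *m (K *m X t) = (K *m X t) 0 0 *: B.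
    by rewrite {1}[K *m X t]mx11_scalar mul_mx_scalar.
  by rewrite !bilinDr !bilinZr; ring.
rewrite pfF.
have Vd : bilin P (X (t - tau t)) (X (t - tau t)) + p1 * L2norm (v (t - tau t)) ^+ 2 <= lyap (t - tau t).
  by rewrite /lyap lerDl mulr_ge0 ?sqr_ge0// ltW.
have Vd2 := ler_wpM2l (mulr_ge0 (ler0n _ 2) d1'0) Vd.
apply: lerD => //; apply: (le_trans hdiss); rewrite -/(lyap t).
by rewrite lerD2l.
Qed.

Lemma V_decay : exists2 al : R, 0 < al & forall t, 0 <= t -> lyap t <= expR (- (al * t)).
Proof.
have [d1' /andP[d1'0 d1'd] hd] := V_dini.
apply: (halanay hpos d1'0 d1'd (tau := tau)).
- by move=> t t0; exact: (delay_bounds h00 htau t0).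
- exact: V_init.
- exact: V_continuous.
- exact: hd.
Qed.

Lemma state_decay : exists C al : R, 0 < al /\
  forall t, 0 <= t -> normH1 (z t) <= C * expR (- (al * t)).
Proof.
have [al al0 hal] := V_decay; have [C C0 hC] := ts_state ts.
have [e e0 he] := pd_coercive Ppos.
pose m := Num.min e (Num.min p1 p2).
have m0 : 0 < m by rewrite !lt_min e0 p10.
exists (3 * C * Num.sqrt m^-1), (al / 2); split; first by rewrite divr_gt0.
move=> t t0; have ht := th t0; apply: (le_trans (hC t ht)).
set N := 3 * C * _ * _.
have sq (q : R) : 0 <= q -> m * q ^+ 2 <= lyap t -> q <= Num.sqrt m^-1 * expR (- (al / 2 * t)).
  move=> q0 hq; rewrite -ler_sqr ?nnegrE ?mulr_ge0 ?sqrtr_ge0 ?expR_ge0//.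
  rewrite exprMn sqr_sqrtr ?invr_ge0 ?(ltW m0)// mulrC -ler_pdivrMr ?invr_gt0// invrK mulrC.
  apply: (le_trans hq); apply: (le_trans (hal t t0)).
  rewrite -expRM_natl ler_expR le_eqVlt; apply/orP; left; apply/eqP.
  by field.
have px : 0 <= bilin P (X t) (X t) by exact: bilin_ge0.
have pv : 0 <= p1 * L2norm (v t) ^+ 2 by rewrite mulr_ge0 ?sqr_ge0// ltW.
have pv1 : 0 <= p2 * L2norm (v1 t) ^+ 2 by rewrite mulr_ge0 ?sqr_ge0// ltW.
have me : m <= e by rewrite ge_min lexx.
have mp1 : m <= p1 by rewrite !ge_min lexx !orbT.
have mp2 : m <= p2 by rewrite !ge_min lexx !orbT.
have q1 : enorm (X t) <= Num.sqrt m^-1 * expR (- (al / 2 * t)).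
  apply: (sq _ (enorm_ge0 _)).
  apply: (@le_trans _ _ (e * enorm (X t) ^+ 2)); first by rewrite ler_wpM2r ?sqr_ge0.
  apply: (le_trans (he (X t))); rewrite -/(bilin P (X t) (X t)) /lyap -addrA lerDl.
  exact: addr_ge0.
have q2 : L2norm (v t) <= Num.sqrt m^-1 * expR (- (al / 2 * t)).
  apply: (sq _ (L2norm_ge0 _)).
  apply: (@le_trans _ _ (p1 * L2norm (v t) ^+ 2)); first by rewrite ler_wpM2r ?sqr_ge0.
  by rewrite /lyap addrAC lerDr addr_ge0.
have q3 : L2norm (v1 t) <= Num.sqrt m^-1 * expR (- (al / 2 * t)).
  apply: (sq _ (L2norm_ge0 _)).
  apply: (@le_trans _ _ (p2 * L2norm (v1 t) ^+ 2)); first by rewrite ler_wpM2r ?sqr_ge0.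
  by rewrite /lyap lerDr addr_ge0.
have -> : N = C * (Num.sqrt m^-1 * expR (- (al / 2 * t)) + Num.sqrt m^-1 * expR (- (al / 2 * t)) + Num.sqrt m^-1 * expR (- (al / 2 * t))).
  by rewrite /N; ring.
by apply: ler_wpM2l => //; apply: lerD => //; apply: lerD.
Qed.

End Decay.

Lemma exp_decay_cvg (R : realType) (f : R -> R) (C al : R) : 0 < al ->
  (forall t, 0 <= t -> 0 <= f t <= C * expR (- (al * t))) ->
  f t @[t --> +oo] --> 0.
Proof.
move=> al0 hf; apply/cvgrPdist_lt => e e0.
have C0 : 0 <= C.
  have /andP[h1 h2] := hf 0 (lexx 0).
  by have := le_trans h1 h2; rewrite mulr0 oppr0 expR0 mulr1.
pose s := Num.max 0 ((C / e) / al).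
exists s; split; first exact: num_real.
move=> t st; rewrite sub0r normrN.
have t0 : 0 < t by apply: le_lt_trans st; rewrite le_max lexx.
have /andP[f0 ft] := hf t (ltW t0); rewrite ger0_norm//.
have st2 : C / e < al * t.
  by rewrite [ltRHS]mulrC -ltr_pdivrMr//; apply: le_lt_trans st; rewrite le_max lexx orbT.
apply: (le_lt_trans ft); rewrite expRN ltr_pdivrMr ?expR_gt0//.
have := expR_ge1Dx (al * t) => h1.
have : C < e * (al * t) by rewrite mulrC -ltr_pdivrMr.
move=> h2; apply: (lt_le_trans h2); rewrite ler_wpM2l ?(ltW e0)//.
by apply: le_trans h1; rewrite lerDr.
Qed.

Theorem theorem5p2 (R : realType) (n : nat)
  (A A1 : 'M[R]_n) (B : 'cV[R]_n) (a a2 : R)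
  (hAB : controllable A B)
  (ubar beta : R) (hubar : 0 < ubar) (hbeta : 0 < beta)
  (K : 'rV[R]_n) (c : R) (hc : 0 < c)
  (r r1 delta0 delta1 : R) (hr : 0 < r) (hr1 : 0 < r1 < 2)
  (hdelta1 : 0 < delta1) (hdelta : delta1 = delta0)
  (hLMI : exists (P : 'M[R]_n) (p1 p2 lambda lambda1 : R),
    [/\ mx_gt0 P,
        [/\ 0 < p1, 0 < p2, 0 < lambda & 0 <= lambda1],
        [/\ mx_lt0 (Xi_mx A A1 B K delta0 delta1 P lambda
                    + (p1 * r^-1 + p2 * r1^-1) *: R_mx A A1 B a a2 K c),
            mx_lt0 (heat_mx a2 c r r1 delta0 delta1 p1 p2 lambda lambda1) &
            - 2 * p1 - 2 * p2 * c + lambda + 2 * delta0 * p2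
              - pi ^+ 2 / 4 * lambda1 <= 0],
        [/\ mx_ge0 (beta%:M - P), p1 <= beta & p2 <= beta] &
        [/\ mx_ge0 ((ubar ^+ 2 / 3) *: P - (c1 A B a K ^+ 2)%:M),
            0 <= p1 * (ubar ^+ 2 / 3) - c2 A B a K c ^+ 2 &
            0 <= p2 * (ubar ^+ 2 / 3) - c3 a c ^+ 2]]) :
  forall h0 h : R, 0 < h0 -> 0 < h ->
  forall z0 : R -> 'cV[R]_n * (R -> R), Xu A B a K c beta h z0 ->
  forall tau : R -> R, admissible_delay h0 h tau ->
  forall z : R -> 'cV[R]_n * (R -> R),
    classical_solution A A1 B a a2 K c ubar h tau z0 z ->
    normH1 (z t) @[t --> +oo] --> 0.
Proof.
move: hLMI => [P [p1 [p2 [lam [lam1 [Ppos [p10 p20 lam0 lam10] [Xi0 heat0 third]]]]]]].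
move=> [PB p1B p2B] [S1 S2 S3] h0 h h00 hpos z0 hX tau htau z hz.
have [hW _] := hX.
have [v [v1 [v2 [T [g ts]]]]] := target_systemP h00 hpos hW htau hz.
have /andP[r10 _] := hr1.
have [C [al [al0 hdec]]] := state_decay h00 hpos hubar hbeta hX htau hz Ppos p10 p20
  lam0 lam10 hr r10 hdelta1 hdelta Xi0 heat0 third PB p1B p2B S1 S2 S3 ts.
apply: (exp_decay_cvg al0) => t t0; apply/andP; split; [exact: sqrtr_ge0|exact: hdec].
Qed.
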